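(* Let $X$ and $Y$ be independent discrete random variables with finite supports of size $r$ and $s$, respectively. Let $(X_1,Y_1),(X_2,Y_2),\dots$ be i.i.d. copies of $(X,Y)$, and let $t^*$ be the empirical sign covariance of the sample $(X_1,Y_1),\dots,(X_n,Y_n)$. Let $\lambda^X_1,\dots,\lambda^X_r$ be the eigenvalues of the matrix $R^X$, and let $\lambda^Y_1,\dots,\lambda^Y_s$ be the eigenvalues of the matrix $R^Y$. Then, as $n\to\infty$, $$n t^* \overset{d}{\longrightarrow} 4\sum_{i=1}^r\sum_{j=1}^s \lambda_i^X\lambda_j^Y\left(\chi^2_{1,ij}-1\right),$$ where $\{\chi^2_{1,ij}: i\le r,\ j\le s\}$ is a collection of $rs$ i.i.d. $\chi^2_1$ random variables.
   Context: Eigenvalues are listed with multiplicity. $\chi^2_1$ denotes the chi-square distribution with one degree of freedom, and $\overset{d}{\to}$ is convergence in distribution. For $z_1,\dots,z_4\in\mathbb{R}$ let $$a(z_1,z_2,z_3,z_4) = I(z_1,z_3<z_2,z_4) + I(z_1,z_3>z_2,z_4) - I(z_1,z_2<z_3,z_4) - I(z_1,z_2>z_3,z_4),$$ where $I(\cdot)$ is the indicator function, $p,q<r,s$ is shorthand for $\max(p,q)<\min(r,s)$, and $p,q>r,s$ is shorthand for $\min(p,q)>\max(r,s)$. The empirical (Bergsma-Dassios) sign covariance of a sample $(x_1,y_1),\dots,(x_n,y_n)$ in $\mathbb{R}^2$, $n\ge4$, is $$t^* = \frac{(n-4)!}{n!}\sum_{\substack{1\le i,j,k,l\le n\\ i,j,k,l\text{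 distinct}}} a(x_i,x_j,x_k,x_l)\,a(y_i,y_j,y_k,y_l).$$ For a random variable $U$ with finite support $\{u_1,\dots,u_r\}$, cumulative distribution function $F_U$ and probability mass function $p_U$, $R^U$ is the $r\times r$ symmetric matrix with $(i,j)$-th entry $$R^U_{ij} = \sqrt{p_U(u_i)p_U(u_j)}\,\Big\{\big[(F_U(u_i\wedge u_j)-p_U(u_i\wedge u_j))^2+(1-F_U(u_i\vee u_j))^2\big] - I(u_i\neq u_j)\big[F_U(u_i\wedge u_j)(1-F_U(u_i\wedge u_j))+\sum_{\ell:\,u_i\wedge u_j<u_\ell<u_i\vee u_j}p_U(u_\ell)(1-F_U(u_\ell))\big]\Big\},$$ where $\wedge$ and $\vee$ denote minimum and maximum. *)

(* Defs.v *)
From HB Require Import structures.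
From mathcomp Require Import all_boot all_order all_algebra finmap.
From mathcomp Require Import all_classical all_reals all_analysis.
From mathcomp Require Import measurable_realfun.

Set Implicit Arguments.
Unset Strict Implicit.
Unset Printing Implicit Defensive.

Import Order.TTheory GRing.Theory Num.Theory.
Import numFieldNormedType.Exports.

Local Open Scope classical_set_scope.
Local Open Scope ring_scope.

Section probability_notions.
Context d (T : measurableType d) (R : realType) (P : probability T R).

Definition independent_RV (X Y : {RV P >-> R}) : Prop :=
  forall A B : set R, measurable A -> measurable B ->
    P (X @^-1` A `&` Y @^-1` B) = (P (X @^-1` A) * P (Y @^-1` B))%E.

Definition mutually_independent d' (E : measurableType d') (I : choiceType)
    (Z : I -> {RV P >-> E}) : Prop :=
  forall (J : {fset I}) (A : I -> set E), (forall i, measurable (A i)) ->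
    P (\bigcap_(i in [set` J]) (Z i @^-1` A i)) =
    (\prod_(i <- J) P (Z i @^-1` A i))%E.

Definition pair_RV (X Y : {RV P >-> R}) (w : T) : R * R := (X w, Y w).

Lemma measurable_pair_RV (X Y : {RV P >-> R}) :
  measurable_fun setT (pair_RV X Y).
Proof. by apply: measurable_fun_pair. Qed.

HB.instance Definition _ (X Y : {RV P >-> R}) :=
  @isMeasurableFun.Build _ _ _ _ (pair_RV X Y) (measurable_pair_RV X Y).

(* [u] enumerates without repetition the atoms of [U], and these atoms carry
   the whole mass. *)
Definition enumerates_support (U : {RV P >-> R}) r (u : 'I_r -> R) : Prop :=
  [/\ injective u, [set x | 0 < pmf U x] = range u
    & P (U @^-1` range u) = 1%E].

End probability_notions.

Arguments independent_RV {d T R} P X Y.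
Arguments mutually_independent {d T R} P {d' E I} Z.
Arguments enumerates_support {d T R} P U {r} u.

Definition same_distribution d1 (T1 : measurableType d1)
    d2 (T2 : measurableType d2) d' (E : measurableType d') (R : realType)
    (P1 : probability T1 R) (P2 : probability T2 R)
    (Z1 : {RV P1 >-> E}) (Z2 : {RV P2 >-> E}) : Prop :=
  forall A : set E, measurable A -> distribution P1 Z1 A = distribution P2 Z2 A.

Definition cvg_in_distribution d (T : measurableType d)
    d' (T' : measurableType d') (R : realType)
    (P : probability T R) (P' : probability T' R)
    (W : nat -> {RV P >-> R}) (V : {RV P' >-> R}) : Prop :=
  forall x : R, {for x, continuous (cdf V)} ->
    cdf (W n) x @[n --> \oo] --> cdf V x.

Arguments same_distribution {d1 T1 d2 T2 d' E R} P1 P2 Z1 Z2.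
Arguments cvg_in_distribution {d T d' T' R} P P' W V.

Definition chi_square1 (R : realType) : set R -> \bar R :=
  pushforward (normal_prob (0 : R) 1) (fun z : R => z ^+ 2).

Section sign_covariance.
Context {R : realType}.

Definition lt22 (p q r s : R) : bool := Num.max p q < Num.min r s.
Definition gt22 (p q r s : R) : bool := Num.min p q > Num.max r s.

Definition sign_a (z1 z2 z3 z4 : R) : R :=
  (lt22 z1 z3 z2 z4)%:R + (gt22 z1 z3 z2 z4)%:R
  - (lt22 z1 z2 z3 z4)%:R - (gt22 z1 z2 z3 z4)%:R.

(* For [n < 4] the sum is empty, so that [tstar] is 0. *)
Definition tstar n (x y : 'I_n -> R) : R :=
  (n - 4)`!%:R / n`!%:R *
  \sum_(i < n) \sum_(j < n) \sum_(k < n) \sum_(l < n | uniq [:: i; j; k; l])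
    sign_a (x i) (x j) (x k) (x l) * sign_a (y i) (y j) (y k) (y l).

End sign_covariance.

Section random_variables.
Context d (T : measurableType d) (R : realType) (P : probability T R).

Definition n_tstar (X Y : nat -> {RV P >-> R}) (n : nat) (w : T) : R :=
  n%:R * tstar (fun i : 'I_n => X i w) (fun i : 'I_n => Y i w).

Let measurable_natr (b : T -> bool) : measurable_fun setT b ->
  measurable_fun setT (fun w => (b w)%:R : R).
Proof.
move=> mb; rewrite (_ : (fun w => _) = fun w => if b w then 1 else 0).
  exact: measurable_fun_ifT.
by apply/funext => w; case: (b w).
Qed.

Lemma measurable_sign_a (f1 f2 f3 f4 : T -> R) :
  measurable_fun setT f1 -> measurable_fun setT f2 ->
  measurable_fun setT f3 -> measurable_fun setT f4 ->
  measurable_fun setT (fun w => sign_a (f1 w) (f2 w) (f3 w) (f4 w)).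
Proof.
move=> m1 m2 m3 m4; rewrite /sign_a /lt22 /gt22.
apply: measurable_funB; last first.
  apply: measurable_natr; apply: measurable_fun_ltr;
    by [exact: measurable_maxr|exact: measurable_minr].
apply: measurable_funB; last first.
  apply: measurable_natr; apply: measurable_fun_ltr;
    by [exact: measurable_maxr|exact: measurable_minr].
apply: measurable_funD; apply: measurable_natr; apply: measurable_fun_ltr;
  by [exact: measurable_maxr|exact: measurable_minr].
Qed.

Lemma measurable_n_tstar X Y n : measurable_fun setT (n_tstar X Y n).
Proof.
rewrite /n_tstar /tstar; do 2 (apply: measurable_funM => //).
apply: measurable_sum => i; apply: measurable_sum => j.
apply: measurable_sum => k.
rewrite (_ : (fun w => _) = fun w => \sum_(l < n)
    if uniq [:: i; j; k; l] then
      sign_a (X i w) (X j w) (X k w) (X l w) *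
      sign_a (Y i w) (Y j w) (Y k w) (Y l w)
    else 0); last by apply/funext => w; rewrite big_mkcond.
apply: measurable_sum => l; case: (uniq _) => //.
by apply: measurable_funM; exact: measurable_sign_a.
Qed.

HB.instance Definition _ X Y n :=
  @isMeasurableFun.Build _ _ _ _ (n_tstar X Y n) (@measurable_n_tstar X Y n).

Definition weighted_chi_square r s (lX : 'I_r -> R) (lY : 'I_s -> R)
    (C : 'I_r * 'I_s -> {RV P >-> R}) (w : T) : R :=
  4 * \sum_(i < r) \sum_(j < s) lX i * lY j * (C (i, j) w - 1).

Lemma measurable_weighted_chi_square r s (lX : 'I_r -> R) (lY : 'I_s -> R) C :
  measurable_fun setT (weighted_chi_square lX lY C).
Proof.
apply: measurable_funM => //; apply: measurable_sum => i.
apply: measurable_sum => j; apply: measurable_funM => //.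
exact: measurable_funB.
Qed.

HB.instance Definition _ r s (lX : 'I_r -> R) (lY : 'I_s -> R) C :=
  @isMeasurableFun.Build _ _ _ _ (weighted_chi_square lX lY C)
    (@measurable_weighted_chi_square r s lX lY C).

Definition R_mx (U : {RV P >-> R}) r (u : 'I_r -> R) : 'M[R]_r :=
  let F x := fine (cdf U x) in
  let p x := pmf U x in
  \matrix_(i, j)
    let m := Num.min (u i) (u j) in
    let M := Num.max (u i) (u j) in
    Num.sqrt (p (u i) * p (u j)) *
    (((F m - p m) ^+ 2 + (1 - F M) ^+ 2)
     - (u i != u j)%:R *
       (F m * (1 - F m) + \sum_(l < r | m < u l < M) p (u l) * (1 - F (u l)))).

End random_variables.

Arguments R_mx {d T R} P U {r} u.

Definition eigenvalues_of (R : realType) r (A : 'M[R]_r) (l : 'I_r -> R) : Prop :=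
  char_poly A = \prod_(i < r) ('X - (l i)%:P).

(* Main.v *)
Require Import Defs.
From HB Require Import structures.
From mathcomp Require Import all_boot all_order all_algebra finmap.
From mathcomp Require Import all_classical all_reals all_analysis.
From mathcomp Require Import measurable_realfun zify ring lra.
Import Order.TTheory GRing.Theory Num.Theory.
Import numFieldNormedType.Exports.

Local Open Scope classical_set_scope.
Local Open Scope ring_scope.

Set Implicit Arguments.
Unset Strict Implicit.
Unset Printing Implicit Defensive.

(** The statistic is a U-statistic of order four, and its kernel is a product
    of the sign function of the first coordinates and of that of the second
    coordinates. Exchanging the two outer arguments of the sign function, or its
    two middle ones, changes its sign. Hence its average over such a pair is 0,
    and its average over any other pair is, up to sign, one and the same
    symmetric kernel [sign_kernel], which is itself centred. When [X] and [Y] are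
    independent, averages of the product kernel are products of averages, in
    which the signs cancel: the Hoeffding projections of order 0 and 1 vanish and
    that of order 2 is the product [G] of the two sign kernels
    ([joint_sign_degenerate]). The projections of order 3 and 4 have mean square
    [O(1 / n)] after normalisation, because two 4-tuples of indices contribute to
    the second moment only if they share three entries ([u_sum_sqr_mean]).

    The matrix [R_mx] is minus the sign kernel on the atoms, weighted by the
    square roots of their masses ([R_mx_sign_kernel]). Its orthonormal
    eigenvectors thus give functions that are orthonormal for the law and that
    diagonalise the sign kernel ([sign_kernel_spectral]). The two minus signs
    cancel in [G], whose eigenvalues are the products [lX i * lY j] and whose
    eigenfunctions are products, centred whenever the eigenvalue is not 0. So,
    up to negligible terms, [n t*] is
    [4 * \sum_k w k * (S_k ^+ 2 / n - 1)], where [S_k] is the sum over the sample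
    of the [k]-th eigenfunction, the [S_k / sqrt n] being uncorrelated with
    variance 1.

    It remains to prove a central limit theorem for this quadratic form. The
    sample almost surely takes finitely many values, so that expectations are
    finite sums and the law of a sum of independent steps is given by the
    iterates of an averaging operator ([avg]). Replacing the steps one by one by
    vectors of independent signs, which have the same covariances, costs
    [O(n^(-3/2))] for each of the [n] steps; the remainder is not bounded, but it
    is dominated by a weight whose mean stays bounded along the walk
    ([lindeberg_swap], [quadratic_lindeberg]). The coordinates are now independent
    Rademacher walks. For one such walk, each step is replaced by a convolution
    with the standard Gaussian law, and the semigroup property of these
    convolutions identifies the limit ([rademacher_clt]); a spline squeezing the
    indicators of half-lines turns this into convergence of distribution
    functions. Rounding the squares of the coordinates to the cells of a fine
    mesh makes them finitely valued, so that the joint law converges because its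
    marginals do ([walks_mean_cells]).

    All these comparisons hold up to a small shift of the threshold, which is
    harmless where the limiting distribution function is continuous. *)

(** * Averaging over the step of a random walk *)

(** The transition operator of the random walk whose step is [xi z] with weight
    [p z]: its iterates give the law of the walk as a finite sum. *)
Definition avg (R : realType) (S : finType) (V : zmodType) (p : S -> R)
  (xi : S -> V) (f : V -> R) (x : V) : R := \sum_z p z * f (x + xi z).

Section averaging.
Context {R : realType} {S : finType} {V : zmodType}.
Variables (p : S -> R) (xi : S -> V).
Hypothesis p_ge0 : forall z, 0 <= p z.

Lemma avg_le f g : (forall x, f x <= g x) ->
  forall x, avg p xi f x <= avg p xi g x.
Proof. by move=> fg x; apply: ler_sum => z _; exact: ler_wpM2l. Qed.

Lemma iter_avg_le n f g : (forall x, f x <= g x) ->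
  forall x, iter n (avg p xi) f x <= iter n (avg p xi) g x.
Proof. by move=> fg; elim: n => //= n; exact: avg_le. Qed.

Lemma avgB f g : avg p xi (f \- g) = avg p xi f \- avg p xi g.
Proof.
by apply/funext => x /=; rewrite -sumrB; apply: eq_bigr => z _; rewrite mulrBr.
Qed.

Lemma iter_avgB n f g :
  iter n (avg p xi) (f \- g) = iter n (avg p xi) f \- iter n (avg p xi) g.
Proof. by elim: n => //= n ->; rewrite avgB. Qed.

Lemma avgZ c f : avg p xi (fun x => c * f x) = fun x => c * avg p xi f x.
Proof.
by apply/funext => x; rewrite mulr_sumr; apply: eq_bigr => z _; rewrite mulrCA.
Qed.

Lemma iter_avgZ n c f :
  iter n (avg p xi) (fun x => c * f x) = fun x => c * iter n (avg p xi) f x.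
Proof. by elim: n => //= n ->; rewrite avgZ. Qed.

Lemma avg_norm_le f w : (forall x, `|f x| <= w x) ->
  forall x, `|avg p xi f x| <= avg p xi w x.
Proof.
move=> fw x; apply: le_trans (ler_norm_sum _ _ _) _; apply: ler_sum => z _.
by rewrite normrM ger0_norm// ler_wpM2l.
Qed.

Lemma iter_avg_norm_le n f w : (forall x, `|f x| <= w x) ->
  forall x, `|iter n (avg p xi) f x| <= iter n (avg p xi) w x.
Proof. by move=> fw; elim: n => //= n; exact: avg_norm_le. Qed.

(** This is what allows unbounded weights in the replacement argument below. *)
Lemma iter_avg_lyapunov n w rho : 0 <= rho ->
  (forall x, avg p xi w x <= rho * w x) ->
  forall x, iter n (avg p xi) w x <= rho ^+ n * w x.
Proof.
move=> rho0 wrho; elim: n => [x|n ih x /=]; first by rewrite expr0 mul1r.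
apply: le_trans (avg_le ih x) _; rewrite avgZ exprSr -mulrA ler_wpM2l//.
exact: exprn_ge0.
Qed.

Lemma iter_avg_cst n c : \sum_z p z = 1 ->
  iter n (avg p xi) (fun=> c) = fun=> c.
Proof.
move=> p1; elim: n => //= n ->; apply/funext => x.
by rewrite /avg -mulr_suml p1 mul1r.
Qed.

End averaging.

Section averaging2.
Context {R : realType} {S S' : finType} {V : zmodType}.
Variables (p : S -> R) (xi : S -> V) (q : S' -> R) (eta : S' -> V).

Lemma avgC f : avg p xi (avg q eta f) = avg q eta (avg p xi f).
Proof.
apply/funext => x; rewrite /avg.
under eq_bigr do rewrite mulr_sumr.
rewrite exchange_big/=; apply: eq_bigr => z _; rewrite mulr_sumr.
by apply: eq_bigr => z' _; rewrite mulrCA addrAC.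
Qed.

(** Lindeberg's replacement, in operator form: since the two averagings
    commute, the [n] replacements of a [p]-step by a [q]-step all reduce to
    one error term, that of a single replacement, further averaged. The weight
    [w] may be unbounded as long as a step increases its mean only by a factor
    [rho]. *)
Lemma lindeberg_swap n f (w : V -> R) (e rho : R) :
  (forall z, 0 <= p z) -> (forall z, 0 <= q z) -> 0 <= e -> 1 <= rho ->
  (forall x, 0 <= w x) ->
  (forall x, avg p xi w x <= rho * w x) ->
  (forall x, avg q eta w x <= rho * w x) ->
  (forall x, `|avg p xi f x - avg q eta f x| <= e * w x) ->
  forall x, `|iter n (avg p xi) f x - iter n (avg q eta) f x|
            <= n%:R * e * rho ^+ n * w x.
Proof.
move=> p0 q0 e0 rho1 w0 pw qw.
have rho0 : 0 <= rho by apply: le_trans rho1.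
elim: n f e e0 => [|n ih] f e e0 fe x.
  by rewrite !iter0 subrr normr0 !mul0r.
rewrite !iterSr.
have -> : iter n (avg p xi) (avg p xi f) x - iter n (avg q eta) (avg q eta f) x
  = iter n (avg p xi) (avg p xi f \- avg q eta f) x
  + (iter n (avg p xi) (avg q eta f) x - iter n (avg q eta) (avg q eta f) x).
  by rewrite iter_avgB /= addrA subrK.
apply: le_trans (ler_normD _ _) _.
have h1 : `|iter n (avg p xi) (avg p xi f \- avg q eta f) x|
    <= e * rho ^+ n * w x.
  apply: le_trans (iter_avg_norm_le xi p0 n (w := fun x => e * w x) fe x) _.
  by rewrite iter_avgZ -mulrA ler_wpM2l// iter_avg_lyapunov.
have h2 : `|iter n (avg p xi) (avg q eta f) x
           - iter n (avg q eta) (avg q eta f) x|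
    <= n%:R * (e * rho) * rho ^+ n * w x.
  apply: ih; first exact: mulr_ge0.
  move=> y; rewrite avgC.
  have -> : avg q eta (avg p xi f) y - avg q eta (avg q eta f) y
      = avg q eta (avg p xi f \- avg q eta f) y by rewrite avgB.
  apply: le_trans (avg_norm_le eta q0 (w := fun x => e * w x) fe y) _.
  by rewrite avgZ -mulrA ler_wpM2l.
apply: le_trans (lerD h1 h2) _.
have -> : n.+1%:R * e * rho ^+ n.+1 * w x = e * rho ^+ n * w x * rho
    + n%:R * (e * rho) * rho ^+ n * w x.
  by rewrite -natr1 exprS; ring.
rewrite lerD2r ler_peMr//; apply: mulr_ge0 => //; apply: mulr_ge0 => //.
exact: exprn_ge0.
Qed.

End averaging2.

(** * Expectations over finite samples *)

Definition sample_mean (R : realType) (S : finType) (p : S -> R) n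
  (F : {ffun 'I_n -> S} -> R) : R :=
  \sum_(om : {ffun 'I_n -> S}) (\prod_i p (om i)) * F om.

Definition resample (S : finType) n (om : {ffun 'I_n -> S}) (i : 'I_n) (z : S)
  : {ffun 'I_n -> S} := [ffun j => if j == i then z else om j].

Section sample_mean.
Context {R : realType} {S : finType}.
Variable (p : S -> R).
Hypothesis p1 : \sum_z p z = 1.

Local Notation E := (sample_mean p).

Lemma eq_sample_mean n (F G : {ffun 'I_n -> S} -> R) :
  F =1 G -> E F = E G.
Proof. by move=> FG; apply: eq_bigr => om _; rewrite FG. Qed.

Lemma sample_meanD n (F G : {ffun 'I_n -> S} -> R) :
  E (fun om => F om + G om) = E F + E G.
Proof. by rewrite -big_split; apply: eq_bigr => om _; rewrite mulrDr. Qed.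

Lemma sample_meanZ n c (F : {ffun 'I_n -> S} -> R) :
  E (fun om => c * F om) = c * E F.
Proof. by rewrite mulr_sumr; apply: eq_bigr => om _; rewrite mulrCA. Qed.

Lemma sample_mean_sum n (J : Type) (r : seq J) (P : pred J)
    (F : J -> {ffun 'I_n -> S} -> R) :
  E (fun om => \sum_(j <- r | P j) F j om) = \sum_(j <- r | P j) E (F j).
Proof.
rewrite /sample_mean exchange_big/=; apply: eq_bigr => om _.
by rewrite mulr_sumr.
Qed.

Lemma sample_mean_cst n c : @sample_mean R S p n (fun=> c) = c.
Proof.
rewrite /sample_mean -mulr_suml -(bigA_distr_bigA (fun _ => p)).
by rewrite big1 ?mul1r.
Qed.

Lemma sample_mean_le n (F G : {ffun 'I_n -> S} -> R) : (forall z, 0 <= p z) ->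
  (forall om, F om <= G om) -> E F <= E G.
Proof.
move=> p0 FG; apply: ler_sum => om _; apply: ler_wpM2l => //.
exact: prodr_ge0.
Qed.

(** Replacing one coordinate by an independent copy does not change the law:
    exchanging the old and the new value is a weight-preserving involution. *)
Lemma sample_mean_resample n (i : 'I_n) (F : {ffun 'I_n -> S} -> R) :
  E F = E (fun om => \sum_z p z * F (resample om i z)).
Proof.
rewrite /sample_mean; under [RHS]eq_bigr do rewrite mulr_sumr.
rewrite (pair_big xpredT xpredT
  (fun (om : {ffun 'I_n -> S}) z => (\prod_k p (om k)) * (p z * F (resample om i z))))/=.
pose s (u : {ffun 'I_n -> S} * S) := (resample u.1 i u.2, u.1 i).
have sK : involutive s.
  move=> [om z]; rewrite /s /= ffunE eqxx; congr pair.
  by apply/ffunP => j; rewrite !ffunE; case: eqP => // ->.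
rewrite (reindex_inj (inv_inj sK))/=.
have -> : \sum_(om : {ffun 'I_n -> S}) (\prod_k p (om k)) * F om =
    \sum_(om : {ffun 'I_n -> S}) \sum_z p z * ((\prod_k p (om k)) * F om).
  by apply: eq_bigr => om _; rewrite -mulr_suml p1 mul1r.
rewrite pair_big; apply: eq_bigr => -[om z] _ /=.
have -> : resample (resample om i z) i (om i) = om by have := sK (om, z) => -[].
rewrite !mulrA; congr (_ * _).
rewrite (bigD1 i)//= [in RHS](bigD1 i)//= ffunE eqxx -!mulrA; congr (_ * _).
rewrite mulrC; congr (_ * _); apply: eq_bigr => k ki.
by rewrite ffunE (negbTE ki).
Qed.

(** The law of the walk after [n] steps, seen on the samples of size [n]. *)
Lemma sample_mean_iter_avg (V : zmodType) (xi : S -> V) n (f : V -> R) x :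
  iter n (avg p xi) f x = @sample_mean R S p n (fun om => f (x + \sum_i xi (om i))).
Proof.
elim: n x => [|n ih] x.
  (* there is exactly one empty sample *)
  have o1 (om : {ffun 'I_0 -> S}) :
    (\prod_i p (om i)) * f (x + \sum_i xi (om i)) = f x.
    by rewrite !big_ord0 mul1r addr0.
  rewrite /sample_mean (eq_bigr (fun=> f x)) => [|om _]; last exact: o1.
  by rewrite sumr_const card_ffun card_ord expn0.
rewrite iterS /avg; under eq_bigr do rewrite ih /sample_mean mulr_sumr.
rewrite pair_big/=.
(* the first coordinate is split off from the others *)
pose c (u : S * {ffun 'I_n -> S}) : {ffun 'I_n.+1 -> S} :=
  [ffun j => if unlift ord0 j is Some k then u.2 k else u.1].
pose d (om : {ffun 'I_n.+1 -> S}) : S * {ffun 'I_n -> S} :=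
  (om ord0, [ffun k => om (lift ord0 k)]).
have cd : cancel d c.
  move=> om; apply/ffunP => j; rewrite ffunE; case: unliftP => [k|] -> //=.
  by rewrite ffunE.
have dc : cancel c d.
  move=> [z om]; rewrite /d !ffunE unlift_none; congr pair.
  by apply/ffunP => k; rewrite !ffunE liftK.
rewrite /sample_mean (reindex c); last by exists d => u _; [exact: dc|exact: cd].
apply: eq_bigr => -[z om] _ /=.
rewrite !big_ord_recl !ffunE !unlift_none -mulrA addrA; congr (_ * (_ * f (_ + _))).
  by apply: eq_bigr => k _; rewrite ffunE liftK.
by apply: eq_bigr => k _; rewrite ffunE liftK.
Qed.

Lemma sample_mean1 n (i : 'I_n) (f : S -> R) :
  E (fun om : {ffun 'I_n -> S} => f (om i)) = \sum_z p z * f z.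
Proof.
rewrite (sample_mean_resample i) -[RHS](sample_mean_cst n).
apply: eq_bigr => om _; congr (_ * _); apply: eq_bigr => z _.
by rewrite ffunE eqxx.
Qed.

(** Distinct coordinates are uncorrelated: one of the two can be resampled. *)
Lemma sample_mean_sum_sqr n (f : S -> R) : \sum_z p z * f z = 0 ->
  E (fun om : {ffun 'I_n -> S} => (\sum_i f (om i)) ^+ 2)
  = n%:R * \sum_z p z * f z ^+ 2.
Proof.
move=> f0.
rewrite (_ : (fun om => _) = fun om : {ffun 'I_n -> S} =>
    \sum_i \sum_j f (om i) * f (om j)); last first.
  by apply/funext => om; rewrite expr2 big_distrlr.
rewrite sample_mean_sum.
under eq_bigr do rewrite sample_mean_sum.
rewrite -[n in n%:R]card_ord -sumr_const mulr_suml; apply: eq_bigr => i _.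
rewrite (bigD1 i)//= [X in _ + X]big1 ?addr0.
  rewrite mul1r -(sample_mean1 i); apply: eq_bigr => om _.
  by rewrite expr2.
move=> j ji; rewrite (sample_mean_resample i) -[RHS](sample_mean_cst n).
apply: eq_bigr => om _; congr (_ * _).
transitivity (\sum_z p z * f z * f (om j)); last by rewrite -mulr_suml f0 mul0r.
by apply: eq_bigr => z _; rewrite !ffunE eqxx (negbTE ji) mulrA.
Qed.

End sample_mean.

(** * Gaussian means and the heat semigroup *)

Section substitution.
Context {R : realType}.
Local Notation mu := (@lebesgue_measure R).
Implicit Types G f : R -> R.

Lemma ge0_integral_affine G a b : 0 < a -> continuous G ->
  (forall x, 0 <= G x) ->
  (\int[mu]_x (G x)%:E = \int[mu]_x (G (a * x + b) * a)%:E)%E.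
Proof.
move=> a0 cG G0.
pose F (x : R) : R := a * x + b.
have dF : F^`()%classic = cst a.
  apply/funext => x; rewrite derive1E /F deriveD// deriveM// derive_id.
  by rewrite !derive_cst scaler0 addr0 addr0 /GRing.scale/= mulr1.
rewrite (@increasing_ge0_integration_by_substitutionT _ F G)//.
- by apply: eq_integral => x _ /=; rewrite fctE dF.
- by move=> x y xy; rewrite /F ltrD2r ltr_pM2l.
- by rewrite dF => x; exact: cvg_cst.
- by rewrite dF; exact: is_cvg_cst.
- by rewrite dF; exact: is_cvg_cst.
- apply: (cvg_comp (fun x => a * x) (fun x => x + b)) (cvg_addrr_Ny b).
  by apply: gt0_cvgMrNy => //; exact: cvg_id.
- apply: (cvg_comp (fun x => a * x) (fun x => x + b)) (cvg_addrr b).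
  by apply: gt0_cvgMry => //; exact: cvg_id.
Qed.

Lemma ge0_integral_opp (G : R -> R) : measurable_fun setT G ->
  (forall x, 0 <= G x) ->
  (\int[mu]_x (G x)%:E = \int[mu]_x (G (- x))%:E)%E.
Proof.
move=> mG G0.
have mGN : measurable_fun setT (fun x : R => G (- x)).
  by apply: (measurableT_comp mG) => /=; exact: oppr_measurable.
have half (H : R -> R) : measurable_fun setT H -> (forall x, 0 <= H x) ->
    (\int[mu]_x (H x)%:E = \int[mu]_(x in `[0%R, +oo[) (H x)%:E
       + \int[mu]_(x in `]-oo, 0%R]) (H x)%:E)%E.
  move=> mH H0.
  rewrite -(setUv `[0%R, +oo[%classic) ge0_integral_setU//=; last 4 first.
  - exact: measurableC.
  - by rewrite setUv; apply/measurable_EFinP.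
  - by move=> x _; rewrite lee_fin.
  - by rewrite disj_set2E setICr.
  rewrite setCitvr integral_itv_bndo_bndc//.
  exact/measurable_EFinP/measurable_funTS.
rewrite (half G)// (half (fun x => G (- x)))// addeC; congr adde.
- rewrite (@ge0_integration_by_substitution0 R (fun x => (G (- x))%:E)).
  + by apply: eq_integral => x _; rewrite opprK.
  + exact/measurable_EFinP.
  + by move=> x; rewrite lee_fin.
- rewrite (@ge0_integration_by_substitution0 R (fun x => (G x)%:E))//.
  exact/measurable_EFinP.
Qed.
End substitution.

Section heat.
Context {R : realType}.
Local Notation mu := (@lebesgue_measure R).
Implicit Types f : R -> R.

(** [s] is a standard deviation, so that [heat s] is the heat semigroup at a
    time proportional to [s ^+ 2]. *)
Definition gauss_mean (s : R) f : R := \int[mu]_y (f y * normal_pdf 0 s y).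
Definition heat (s : R) f (x : R) : R := gauss_mean s (fun y => f (x + y)).

Definition gauss_integrable (s : R) f : Prop :=
  mu.-integrable setT (fun y => (f y * normal_pdf 0 s y)%:E).

Lemma gauss_integrable_bounded s f B : measurable_fun setT f ->
  (forall y, `|f y| <= B) -> gauss_integrable s f.
Proof.
move=> mf fB.
have iB : mu.-integrable setT (fun y => (B%:E * (normal_pdf 0 s y)%:E)%E).
  by apply: integrableZl => //; exact: integrable_normal_pdf.
apply: (le_integrable measurableT _ _ iB).
  by apply/measurable_EFinP/measurable_funM => //; exact: measurable_normal_pdf.
move=> y _ /=; rewrite lee_fin !normrM ler_wpM2r//.
by rewrite (le_trans (fB y))// ler_norm.
Qed.

Lemma gauss_mean_cst s c : gauss_mean s (fun=> c) = c.
Proof.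
rewrite /gauss_mean RintegralZl//; last exact: integrable_normal_pdf.
by rewrite /Rintegral integral_normal_pdf mulr1.
Qed.

Lemma gauss_meanD s f g : gauss_integrable s f -> gauss_integrable s g ->
  gauss_mean s (fun y => f y + g y) = gauss_mean s f + gauss_mean s g.
Proof.
move=> If Ig; rewrite /gauss_mean -RintegralD//.
by apply: eq_Rintegral => y _; rewrite mulrDl.
Qed.

Lemma gauss_integrableD s f g : gauss_integrable s f -> gauss_integrable s g ->
  gauss_integrable s (fun y => f y + g y).
Proof.
move=> If Ig; rewrite /gauss_integrable.
under eq_fun do rewrite mulrDl EFinD.
exact: integrableD.
Qed.

Lemma gauss_meanZ s c f : gauss_integrable s f ->
  gauss_mean s (fun y => c * f y) = c * gauss_mean s f.
Proof.
move=> If; rewrite /gauss_mean -RintegralZl//.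
by apply: eq_Rintegral => y _; rewrite mulrA.
Qed.

Lemma gauss_integrableZ s c f : gauss_integrable s f ->
  gauss_integrable s (fun y => c * f y).
Proof.
move=> If; rewrite /gauss_integrable.
under eq_fun do rewrite -mulrA EFinM.
exact: integrableZl.
Qed.

Lemma gauss_mean_norm_le s f w : measurable_fun setT f -> gauss_integrable s w ->
  (forall y, `|f y| <= w y) -> `|gauss_mean s f| <= gauss_mean s w.
Proof.
move=> mf Iw fw.
have mfp : measurable_fun setT (fun y => f y * normal_pdf 0 s y).
  by apply/measurable_funM => //; exact: measurable_normal_pdf.
have If : gauss_integrable s f.
  apply: (le_integrable measurableT _ _ Iw); first exact/measurable_EFinP.
  move=> y _ /=; rewrite lee_fin !normrM ler_wpM2r//.
  by rewrite (le_trans (fw y))// ler_norm.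
apply: le_trans (le_normr_Rintegral measurableT If) _.
apply: le_Rintegral => //.
  by have := integrable_norm If.
move=> y _; rewrite normrM [X in _ * X]ger0_norm ?normal_pdf_ge0//.
by rewrite ler_wpM2r// normal_pdf_ge0.
Qed.

Lemma gauss_mean_le s f g : gauss_integrable s f -> gauss_integrable s g ->
  (forall y, f y <= g y) -> gauss_mean s f <= gauss_mean s g.
Proof.
move=> If Ig fg; apply: le_Rintegral => // y _.
by rewrite ler_wpM2r// normal_pdf_ge0.
Qed.

Lemma gauss_mean_opp s f : s != 0 -> measurable_fun setT f ->
  (forall y, 0 <= f y) -> gauss_mean s (fun y => f (- y)) = gauss_mean s f.
Proof.
move=> s0 mf f0; rewrite /gauss_mean /Rintegral; congr fine.
rewrite [RHS]ge0_integral_opp.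
- by apply: eq_integral => y _; rewrite normal_pdfE// /normal_fun !subr0 sqrrN.
- by apply/measurable_funM => //; exact: measurable_normal_pdf.
- by move=> y; rewrite mulr_ge0 ?normal_pdf_ge0.
Qed.

Lemma gauss_mean_scale s f : 0 < s -> continuous f -> (forall y, 0 <= f y) ->
  gauss_mean s f = gauss_mean 1 (fun y => f (s * y)).
Proof.
move=> s0 cf f0; rewrite /gauss_mean /Rintegral; congr fine.
have sn0 : s != 0 by rewrite gt_eqF.
rewrite (@ge0_integral_affine _ _ s 0 s0).
- apply: eq_integral => y _; rewrite addr0; congr EFin; rewrite -mulrA; congr (_ * _).
  rewrite !normal_pdfE// /normal_peak /normal_fun expr1n mul1r mulrC mulrA; congr (_ * expR _).
    rewrite -mulrnAr sqrtrM ?sqr_ge0// sqrtr_sqr gtr0_norm// invfM mulrA.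
    by rewrite divff// mul1r.
  by rewrite !subr0; field.
- by move=> y; apply: cvgM; [exact: cf|exact: continuous_normal_pdf].
- by move=> y; rewrite mulr_ge0 ?normal_pdf_ge0.
Qed.

(** Completing the square: the joint density of two successive Gaussian
    increments, rewritten as the density of their sum times the conditional
    density of the first one. *)
Lemma normal_pdf_convolution s w y : 0 < s ->
  normal_pdf 0 1 y * normal_pdf 0 s (w - y) =
  normal_pdf 0 (Num.sqrt (1 + s ^+ 2)) w *
  normal_pdf (w / (1 + s ^+ 2)) (s / Num.sqrt (1 + s ^+ 2)) y :> R.
Proof.
move=> s0; have t0 : 0 < 1 + s ^+ 2 by rewrite ltr_wpDr ?sqr_ge0.
have sn0 : s != 0 by rewrite gt_eqF.
have tn0 : 1 + s ^+ 2 != 0 by rewrite gt_eqF.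
have st0 : Num.sqrt (1 + s ^+ 2) != 0 by rewrite gt_eqF// sqrtr_gt0.
rewrite !normal_pdfE// ?mulf_neq0 ?invr_neq0// /normal_fun.
rewrite mulrACA [RHS]mulrACA -!expRD; congr (_ * expR _).
  rewrite /normal_peak -!invfM -!sqrtrM; last 2 first.
  - by rewrite mulrn_wge0// mulr_ge0 ?pi_ge0 ?sqr_ge0.
  - by rewrite mulrn_wge0// mulr_ge0 ?pi_ge0 ?sqr_ge0.
  congr (_^-1); congr Num.sqrt; rewrite exprMn exprVn sqr_sqrtr ?ltW//.
  by field.
rewrite !subr0 exprMn exprVn sqr_sqrtr ?ltW//.
by field; rewrite tn0 sn0.
Qed.

Lemma heat_bounds s f x : measurable_fun setT f ->
  (forall y, 0 <= f y <= 1) -> 0 <= heat s f x <= 1.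
Proof.
move=> mf f01.
have mfx : measurable_fun setT (fun y => f (x + y)).
  by apply: (measurableT_comp mf) => /=; exact: measurable_funD.
have If : gauss_integrable s (fun y => f (x + y)).
  apply: (@gauss_integrable_bounded _ _ 1) => // y.
  by have /andP[f0 f1] := f01 (x + y); rewrite ger0_norm.
apply/andP; split.
  by apply: Rintegral_ge0 => y _; rewrite mulr_ge0 ?normal_pdf_ge0//; case/andP: (f01 (x + y)).
rewrite -[leRHS](gauss_mean_cst s); apply: gauss_mean_le => //.
  by apply: (@gauss_integrable_bounded _ _ 1); [exact: measurable_cst|move=> _; rewrite normr1].
by move=> y; case/andP: (f01 (x + y)).
Qed.

(** Tonelli's theorem and the convolution of the densities. The first time is
    that of one step of a walk with steps of variance 1, which is how the
    semigroup is used. *)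
Lemma heat_semigroup s f x : 0 < s -> continuous f ->
  (forall y, 0 <= f y <= 1) ->
  heat 1 (heat s f) x = heat (Num.sqrt (1 + s ^+ 2)) f x.
Proof.
move=> s0 cf f01; have sn0 : s != 0 by rewrite gt_eqF.
have mf : measurable_fun setT f by exact: continuous_measurable_fun.
have f0 y : 0 <= f y by case/andP: (f01 y).
have cfx a : continuous (fun y => f (a + y)).
  by move=> y; apply: continuous_comp; [apply: cvgD; [exact: cvg_cst|exact: cvg_id]|exact: cf].
pose H (u : R * R) : \bar R :=
  (f (x + u.2) * normal_pdf 0 1 u.1 * normal_pdf 0 s (u.2 - u.1))%:E.
have mH : measurable_fun setT H.
  apply/measurable_EFinP; apply: measurable_funM; [apply: measurable_funM|].
  - apply: measurableT_comp => //; exact: measurable_funD.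
  - by apply: measurableT_comp => //; exact: measurable_normal_pdf.
  - apply: (measurableT_comp (measurable_normal_pdf 0 s)).
    exact: measurable_funB.
have H0 u : (0 <= H u)%E by rewrite lee_fin !mulr_ge0 ?normal_pdf_ge0.
rewrite /heat {1}/gauss_mean /Rintegral.
have step1 y : ((gauss_mean s (fun z => f (x + y + z)) * normal_pdf 0 1 y)%:E
    = \int[mu]_w H (y, w))%E.
  rewrite /gauss_mean EFinM fineK; last first.
    apply: integrable_fin_num => //; apply: (@gauss_integrable_bounded _ _ 1).
      by apply: continuous_measurable_fun; exact: cfx.
    by move=> z; rewrite ger0_norm//; case/andP: (f01 (x + y + z)).
  rewrite muleC -ge0_integralZl//; last 3 first.
  - apply/measurable_EFinP/measurable_funM; last exact: measurable_normal_pdf.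
    by apply: continuous_measurable_fun; exact: cfx.
  - by move=> z _; rewrite lee_fin mulr_ge0 ?normal_pdf_ge0.
  - by rewrite lee_fin normal_pdf_ge0.
  rewrite [RHS](@ge0_integral_affine _ (fun w => f (x + w) * normal_pdf 0 1 y
     * normal_pdf 0 s (w - y)) 1 y)//.
  - apply: eq_integral => z _; rewrite mul1r mulr1 addrK -EFinM; congr EFin.
    by rewrite mulrCA mulrA (addrC z) addrA.
  - move=> w; apply: cvgM; [apply: cvgM; [exact: cfx|exact: cvg_cst]|].
    apply: (@continuous_comp _ _ _ (fun w : R => w - y) (normal_pdf 0 s)).
      by apply: cvgB; [exact: cvg_id|exact: cvg_cst].
    exact: continuous_normal_pdf.
  - by move=> w; rewrite !mulr_ge0 ?normal_pdf_ge0.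
under eq_integral do rewrite step1.
rewrite fubini_tonelli// /gauss_mean /Rintegral; congr fine.
apply: eq_integral => w _; rewrite /H /=.
under eq_integral do rewrite -mulrA normal_pdf_convolution// mulrA EFinM.
rewrite ge0_integralZl//; last 3 first.
- apply/measurable_EFinP; exact: measurable_normal_pdf.
- by move=> z _; rewrite lee_fin normal_pdf_ge0.
- by rewrite lee_fin mulr_ge0 ?normal_pdf_ge0.
by rewrite integral_normal_pdf mule1.
Qed.

End heat.

Section gaussian_moments.
Context {R : realType}.
Local Notation mu := (@lebesgue_measure R).
Implicit Types f : R -> R.

Lemma normal_pdf01 (y : R) :
  normal_pdf 0 1 y = normal_peak 1 * expR (- (y ^+ 2 / 2)).
Proof.
by rewrite normal_pdfE ?oner_neq0// /normal_fun subr0 expr1n mulNr.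
Qed.

(** The cube is dominated by a multiple of [exp (y^2/4)], a factor that turns the
    density of variance 1 into a multiple of that of variance 2. *)
Lemma gauss_integrable_norm_cube : gauss_integrable (1 : R) (fun y => `|y| ^+ 3).
Proof.
pose t : R := Num.sqrt 2.
have t0 : t != 0 by rewrite gt_eqF// sqrtr_gt0.
(* with [x = y^2/8 <= exp x], the cube is at most
   [1 + y^4 = 1 + 64 x^2 <= 65 exp (2 x)] *)
pose c : R := 65 * normal_peak 1 / normal_peak t.
have Ic : mu.-integrable setT (fun y => (c%:E * (normal_pdf 0 t y)%:E)%E).
  by apply: integrableZl => //; exact: integrable_normal_pdf.
apply: (le_integrable measurableT _ _ Ic).
  apply/measurable_EFinP/measurable_funM; last exact: measurable_normal_pdf.
  by apply: measurable_funX; exact: normr_measurable.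
move=> y _ /=; rewrite lee_fin normrM normrX normr_id normrM.
rewrite !(ger0_norm (normal_pdf_ge0 _ _ _)).
have c0 : 0 <= c.
  by rewrite divr_ge0 ?mulr_ge0 ?normal_peak_ge0.
rewrite (ger0_norm c0) normal_pdf01 normal_pdfE// /normal_fun subr0.
rewrite sqr_sqrtr// /c.
have -> : 65 * normal_peak 1 / normal_peak t *
    (normal_peak t * expR (- y ^+ 2 / (2 *+ 2))) =
  normal_peak 1 * (65 * expR (y ^+ 2 / 4) * expR (- (y ^+ 2 / 2))).
  have -> : - y ^+ 2 / (2 *+ 2) = y ^+ 2 / 4 + - (y ^+ 2 / 2) :> R by field.
  by rewrite expRD; field; rewrite gt_eqF ?normal_peak_gt0.
rewrite mulrCA ler_wpM2l ?normal_peak_ge0// ler_wpM2r ?expR_ge0//.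
set x := y ^+ 2 / 8.
have x0 : 0 <= x by rewrite mulr_ge0 ?sqr_ge0.
have ex : x <= expR x by rewrite (le_trans _ (expR_ge1Dx x))// lerDr.
have -> : y ^+ 2 / 4 = x + x by rewrite /x; field.
rewrite expRD.
have e1 : 1 <= expR x by rewrite (le_trans _ (expR_ge1Dx x))// lerDl.
have y4 : `|y| ^+ 4 = 64 * (x * x).
  by rewrite /x (exprM _ 2 2) real_normK ?num_real//; field.
have : `|y| ^+ 3 <= 1 + `|y| ^+ 4.
  have [y1|y1] := lerP `|y| 1.
    by rewrite (@le_trans _ _ 1) ?exprn_ile1 ?lerDl ?exprn_ge0.
  by rewrite (exprS _ 3) (le_trans (ler_peMl _ (ltW y1)))// ?exprn_ge0// lerDr.
rewrite y4; nra.
Qed.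

Let F (y : R) : R := y * expR (- (y ^+ 2 / 2)).

Let dF (y : R) : is_derive y 1 F ((1 - y ^+ 2) * expR (- (y ^+ 2 / 2))).
Proof.
by apply: is_derive_eq; rewrite /GRing.scale/=; field.
Qed.

Let dF1 (y : R) : F^`()%classic y = (1 - y ^+ 2) * expR (- (y ^+ 2 / 2)).
Proof. by rewrite derive1E; exact: (@derive_val _ _ _ _ _ _ _ (dF y)). Qed.

Let cvgF : F y @[y --> +oo%R] --> (0 : R).
Proof.
apply: (@squeeze_cvgr _ _ _ _ (cst 0) (fun y => 2 * y^-1)).
- near=> y.
  have y0 : 0 < y by near: y; exact: nbhs_pinfty_gt.
  rewrite /F mulr_ge0 ?expR_ge0 ?(ltW y0)//= expRN ler_pdivrMr ?expR_gt0//.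
  rewrite mulrAC ler_pdivlMr// -ler_pdivrMl// mulrC.
  by rewrite (le_trans _ (expR_ge1Dx _))// lerDr.
- exact: cvg_cst.
- rewrite -[X in _ --> X](mulr0 2); apply: cvgM; first exact: cvg_cst.
  apply/(gtr0_cvgV0 (f := fun y : R => y)); last exact: cvg_id.
  exact: nbhs_pinfty_gt.
Unshelve. all: by end_near. Qed.

Let cF' : continuous (fun y : R => (1 - y ^+ 2) * expR (- (y ^+ 2 / 2))).
Proof.
move=> y; apply: cvgM.
  by apply: cvgB; [exact: cvg_cst|exact: exprn_continuous].
apply: (@continuous_comp _ _ _ (fun y : R => - (y ^+ 2 / 2)) expR).
  by apply: cvgN; apply: cvgM; [exact: exprn_continuous|exact: cvg_cst].
exact: continuous_expR.
Qed.

Let cF'N : continuous (fun y : R => (y ^+ 2 - 1) * expR (- (y ^+ 2 / 2))).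
Proof.
move=> y; rewrite (_ : (fun y : R => _) = fun y => - ((1 - y ^+ 2) * expR (- (y ^+ 2 / 2)))).
  by apply: cvgN; exact: cF'.
by apply/funext => z; ring.
Qed.

Let cF : continuous F.
Proof. by move=> y; apply: differentiable_continuous; apply/derivable1_diffP; have [] := dF y. Qed.

Let int01 : (\int[mu]_(y in `[0%R, 1%R]) ((1 - y ^+ 2) * expR (- (y ^+ 2 / 2)))%:E = (F 1)%:E)%E.
Proof.
rewrite (@continuous_FTC2 _ _ F) ?ltr01//.
- by rewrite {2}/F mul0r sube0.
- exact: continuous_subspaceT.
- split => [y _||]; first by have [] := dF y.
    by apply: cvg_at_right_filter; exact: cF.
  by apply: cvg_at_left_filter; exact: cF.
Qed.

Let int1y : (\int[mu]_(y in `[1%R, +oo[) ((y ^+ 2 - 1) * expR (- (y ^+ 2 / 2)))%:E = (F 1)%:E)%E.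
Proof.
rewrite (@ge0_continuous_FTC2y _ _ (fun y => - F y) 1 0).
- by rewrite -EFinB sub0r opprK.
- by move=> y y1; rewrite mulr_ge0 ?expR_ge0// subr_ge0 expr_ge1// (le_trans ler01).
- exact: continuous_subspaceT.
- by rewrite -[X in _ --> X]oppr0; apply: cvgN; exact: cvgF.
- by move=> y _; apply: derivableN; have [] := dF y.
- by apply: cvg_at_right_filter; apply: cvgN; exact: cF.
- move=> y _; rewrite derive1E deriveN; last by have [] := dF y.
  by rewrite -derive1E dF1; ring.
Qed.

Lemma gauss_integrable_sqr : gauss_integrable (1 : R) (fun y => y ^+ 2).
Proof.
have I1 : gauss_integrable (1 : R) (fun=> 1).
  by apply: (@gauss_integrable_bounded _ _ _ 1); [exact: measurable_cst|move=> _; rewrite normr1].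
apply: (le_integrable measurableT _ _ (gauss_integrableD I1 gauss_integrable_norm_cube)).
  apply/measurable_EFinP/measurable_funM; last exact: measurable_normal_pdf.
  exact: measurable_funX.
move=> y _; rewrite lee_fin normrM [leRHS]normrM ler_wpM2r//.
rewrite normrX [leRHS]ger0_norm ?addr_ge0//.
have [y1|y1] := lerP `|y| 1.
  by rewrite (@le_trans _ _ 1) ?exprn_ile1 ?lerDl ?exprn_ge0.
by rewrite (exprS _ 2) (le_trans (ler_peMl _ (ltW y1)))// ?exprn_ge0// lerDr.
Qed.

(** The second moment is computed from the two monotone pieces of the
    primitive [y * exp (- y^2/2)] of [(1 - y^2) * exp (- y^2/2)]. *)
Lemma gauss_mean_sqr : gauss_mean (1 : R) (fun y => y ^+ 2) = 1.
Proof.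
pose D (y : R) : R := y ^+ 2 * normal_pdf 0 1 y - normal_pdf 0 1 y.
have I2 := gauss_integrable_sqr.
have I0 := @integrable_normal_pdf R 0 1.
have ID : mu.-integrable setT (EFin \o D).
  exact: (@integrableB _ _ _ mu setT measurableT _ _ I2 I0).
have mp : 0 < normal_peak (1 : R) by rewrite normal_peak_gt0.
have DE y : D y = normal_peak 1 * ((y ^+ 2 - 1) * expR (- (y ^+ 2 / 2))).
  by rewrite /D normal_pdf01; ring.
have IDS A : measurable A -> mu.-integrable A (EFin \o D).
  by move=> mA; apply: integrableS ID.
have Ie A : measurable A ->
    mu.-integrable A (fun y => ((y ^+ 2 - 1) * expR (- (y ^+ 2 / 2)))%:E).
  move=> mA; have -> : (fun y : R => ((y ^+ 2 - 1) * expR (- (y ^+ 2 / 2)))%:E)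
     = (fun y => ((normal_peak (1 : R))^-1%:E * (D y)%:E)%E).
    by apply/funext => y; rewrite -EFinM DE mulKf// gt_eqF.
  by apply: integrableZl => //; exact: IDS.
have D0 : \int[mu]_(y in `[0, +oo[) D y = 0.
  have -> : [set` `[0, +oo[] = `[(0 : R), 1] `|` `](1 : R), +oo[.
    by rewrite -itv_bndbnd_setU// bnd_simp.
  rewrite Rintegral_setU//=; last 2 first.
  - by apply: IDS; exact: measurableU.
  - apply/disj_set2P/seteqP; split => y //= [].
    by rewrite !in_itv/= => /andP[_ y1]; rewrite andbT ltNge y1.
  rewrite Rintegral_itv_obnd_cbnd; last exact: IDS.
  have intD A : measurable A -> \int[mu]_(y in A) D y =
      normal_peak 1 * \int[mu]_(y in A) ((y ^+ 2 - 1) * expR (- (y ^+ 2 / 2))).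
    move=> mA; rewrite -RintegralZl//; last exact: Ie.
    by apply: eq_Rintegral => y _; rewrite DE.
  rewrite !intD//.
  rewrite -mulrDr; apply/eqP; rewrite mulf_eq0 gt_eqF//=; apply/eqP.
  rewrite {2}/Rintegral int1y /=.
  have -> : \int[mu]_(y in `[0, 1]) ((y ^+ 2 - 1) * expR (- (y ^+ 2 / 2))) =
    \int[mu]_(y in `[0, 1]) (-1 * ((1 - y ^+ 2) * expR (- (y ^+ 2 / 2)))).
    by apply: eq_Rintegral => y _; ring.
  rewrite RintegralZl//; last first.
    have := integrableZl _ (-1) (Ie _ (measurable_itv `[(0 : R), 1])).
    move=> /(_ (measurable_itv _)); apply: eq_integrable => //.
    by move=> y _ /=; rewrite -EFinM; congr EFin; ring.
  by rewrite {1}/Rintegral int01 /= mulN1r addNr.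
have half : \int[mu]_(y in `[0, +oo[) (y ^+ 2 * normal_pdf 0 1 y) =
            \int[mu]_(y in `[0, +oo[) (normal_pdf 0 1 y).
  apply/eqP; rewrite -subr_eq0 -RintegralB//; first by rewrite D0.
  - exact: integrableS I2.
  - exact: integrableS I0.
have sym (f : R -> R) : (forall y, 0 <= f y) -> continuous f -> f =1 f \o -%R ->
    mu.-integrable setT (EFin \o f) ->
    \int[mu]_y f y = 2 * \int[mu]_(y in `[0, +oo[) f y.
  move=> f0 cf fN If; rewrite /Rintegral ge0_symfun_integralT// -set_itvcy fineM//.
  by apply: integrable_fin_num => //; exact: integrableS If.
have cp := @continuous_normal_pdf R 0 1 (oner_neq0 _).
have pN : normal_pdf (0 : R) 1 =1 normal_pdf 0 1 \o -%R.
  by move=> y; rewrite /= !normal_pdf01 sqrrN.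
rewrite /gauss_mean sym//.
- rewrite half -sym//.
  by rewrite /Rintegral integral_normal_pdf.
  by move=> y; exact: normal_pdf_ge0.
- by move=> y; rewrite mulr_ge0 ?sqr_ge0 ?normal_pdf_ge0.
- by move=> y; apply: cvgM; [exact: exprn_continuous|exact: cp].
- by move=> y /=; rewrite sqrrN pN.
Qed.

End gaussian_moments.

(** * The central limit theorem for Rademacher walks *)

(** This holds for functions of class C^3 with bounded derivatives, but also for
    the spline used below, which is only piecewise cubic. *)
Definition taylor2 (R : realType) (M : R) (f : R -> R) : Prop :=
  exists D1 D2 : R -> R, (forall a, `|D1 a| <= M /\ `|D2 a| <= M) /\
  forall a b, `|f (a + b) - (f a + D1 a * b + D2 a * b ^+ 2)| <= M * `|b| ^+ 3.

Definition second_diff (R : realType) (f : R -> R) (x z : R) : R :=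
  f (x + z) + f (x - z) - 2 * f x.

(** The symmetric second difference is nearly quadratic in the step. It is
    compared to its value at the step 1 because averaging [z ^+ 2] over any
    centred step of variance 1 then gives exactly twice the effect of a
    Rademacher step. The estimate is linear in the function and
    mentions no other one, so that it is preserved by convolution. *)
Definition quadratic_diff (R : realType) (M : R) (f : R -> R) : Prop :=
  forall x z, `|second_diff f x z - z ^+ 2 * second_diff f x 1|
    <= M * (z ^+ 2 + `|z| ^+ 3).

Section one_dimensional_clt.
Context {R : realType}.
Implicit Types (f : R -> R) (M L : R).

Definition sign_step (b : bool) : R := (-1) ^+ b.
Definition coin : bool -> R := fun=> 2^-1.
Definition walk_avg : (R -> R) -> R -> R := avg coin sign_step.

Lemma coin_ge0 b : 0 <= coin b. Proof. by rewrite /coin. Qed.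

Lemma coin_sum : \sum_b coin b = 1.
Proof. by rewrite /coin big_bool /=; field. Qed.

Lemma walk_avgE f x : walk_avg f x = (f (x + 1) + f (x - 1)) / 2.
Proof.
by rewrite /walk_avg /avg big_bool /= /sign_step /coin expr1 expr0; ring.
Qed.

Lemma lipschitz_continuous L f :
  (forall x y, `|f x - f y| <= L * `|x - y|) -> continuous f.
Proof.
move=> fL x; apply/cvgrPdist_le => e e0.
have L1 : 0 < `|L| + 1 by rewrite ltr_wpDl.
near=> y.
rewrite (le_trans (fL x y))// (@le_trans _ _ ((`|L| + 1) * `|x - y|))//.
  by rewrite ler_wpM2r// (le_trans (ler_norm _))// lerDl.
rewrite mulrC -ler_pdivlMr//.
near: y; apply: cvgr_dist_le; first exact: cvg_id.
by rewrite divr_gt0.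
Unshelve. all: by end_near. Qed.

Lemma gauss_integrable_continuous s f : continuous f ->
  (forall y, 0 <= f y <= 1) -> gauss_integrable s f.
Proof.
move=> cf f01; apply: (@gauss_integrable_bounded _ _ _ 1).
  exact: continuous_measurable_fun.
by move=> y; have /andP[f0 f1] := f01 y; rewrite ger0_norm.
Qed.

Section translates.
Variables (s : R) (f : R -> R).
Hypotheses (s0 : s != 0) (cf : continuous f) (f01 : forall y, 0 <= f y <= 1).

Lemma continuous_translate (x : R) : continuous (fun y => f (x + y)).
Proof.
move=> y; apply: continuous_comp; last exact: cf.
by apply: cvgD; [exact: cvg_cst|exact: cvg_id].
Qed.

Lemma gauss_integrable_translate x : gauss_integrable s (fun y => f (x + y)).
Proof.
by apply: gauss_integrable_continuous; [exact: continuous_translate|].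
Qed.

Lemma heat_second_diff x z :
  second_diff (heat s f) x z = gauss_mean s (fun y => second_diff f (x + y) z) /\
  gauss_integrable s (fun y => second_diff f (x + y) z).
Proof.
have I a := gauss_integrable_translate a.
have E : (fun y => second_diff f (x + y) z) =
    (fun y => f (x + z + y) + f (x - z + y) + -2 * f (x + y)).
  apply/funext => y; rewrite /second_diff mulNr.
  by rewrite (addrAC x y z) (addrAC x y (- z)).
have I12 := gauss_integrableD (I (x + z)) (I (x - z)).
have I3 := gauss_integrableZ (-2) (I x).
rewrite E; split; last exact: gauss_integrableD.
by rewrite gauss_meanD// gauss_meanD// gauss_meanZ// /second_diff mulNr.
Qed.

Lemma heat_quadratic_diff M : quadratic_diff M f -> quadratic_diff M (heat s f).
Proof.
move=> fM x z.
have [-> I1] := heat_second_diff x z.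
have [-> I2] := heat_second_diff x 1.
rewrite -gauss_meanZ// -mulN1r -gauss_meanZ; last exact: gauss_integrableZ.
have I3 := gauss_integrableZ (-1) (gauss_integrableZ (z ^+ 2) I2).
rewrite -gauss_meanD//.
rewrite -[leRHS](gauss_mean_cst s).
have cM : gauss_integrable s (fun=> M * (z ^+ 2 + `|z| ^+ 3)).
  by apply: gauss_integrable_bounded => //; exact: measurable_cst.
apply: gauss_mean_norm_le => //; last by move=> y; rewrite mulN1r; exact: fM.
have mt (a : R) : measurable_fun setT (fun y : R => f (a + y)).
  by apply: continuous_measurable_fun; exact: continuous_translate.
rewrite /second_diff.
have m1 (w : R) : measurable_fun setT (fun y : R => f (x + y + w)).
  by have := mt (x + w); under eq_fun do rewrite addrAC.
apply: measurable_funD.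
  apply: measurable_funB; last exact: measurable_funM.
  by apply: measurable_funD.
apply: measurable_funM => //; apply: measurable_funM => //.
apply: measurable_funB; last exact: measurable_funM.
by apply: measurable_funD.
Qed.

Lemma heat_lipschitz L : (forall x y, `|f x - f y| <= L * `|x - y|) ->
  forall x y, `|heat s f x - heat s f y| <= L * `|x - y|.
Proof.
move=> fL x y.
have I a := gauss_integrable_translate a.
rewrite /heat -mulN1r -gauss_meanZ// -gauss_meanD//; last exact: gauss_integrableZ.
rewrite -[leRHS](gauss_mean_cst s); apply: gauss_mean_norm_le.
- have mt (a : R) : measurable_fun setT (fun y : R => f (a + y)).
    by apply: continuous_measurable_fun; exact: continuous_translate.
  by apply: measurable_funD => //; exact: measurable_funM.
- by apply: gauss_integrable_bounded => //; exact: measurable_cst.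
by move=> z; rewrite mulN1r (le_trans (fL _ _))// opprD addrACA subrr addr0.
Qed.

End translates.

Definition third_moment_bound : R := 1 + gauss_mean 1 (fun y => `|y| ^+ 3).

Lemma third_moment_bound_ge0 : 0 <= third_moment_bound.
Proof.
by rewrite addr_ge0//; apply: Rintegral_ge0 => y _; rewrite mulr_ge0 ?normal_pdf_ge0 ?exprn_ge0.
Qed.

(** Both the Gaussian and the Rademacher step are centred with variance 1, so
    they only differ on the part of the second difference that is not
    quadratic in the step. *)
Lemma walk_avg_heat_le M f x : continuous f -> (forall y, 0 <= f y <= 1) ->
  quadratic_diff M f -> `|walk_avg f x - heat 1 f x| <= M * third_moment_bound.
Proof.
move=> cf f01 fM.
have I a := gauss_integrable_translate 1 cf f01 a.
have f0 y : 0 <= f y by case/andP: (f01 y).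
have cfN : continuous (fun y => f (x - y)).
  move=> y; apply: continuous_comp; last exact: cf.
  by apply: cvgB; [exact: cvg_cst|exact: cvg_id].
have IN : gauss_integrable 1 (fun y => f (x - y)) by apply: gauss_integrable_continuous.
have hN : heat 1 f x = gauss_mean 1 (fun y => f (x - y)).
  rewrite /heat -(@gauss_mean_opp _ 1 (fun y => f (x + y)))//.
  by apply: continuous_measurable_fun; exact: continuous_translate.
have M0 : 0 <= M.
  have := fM 0 1; rewrite expr1n mul1r subrr normr0 normr1 expr1n.
  by rewrite pmulr_lge0.
have Ic c : gauss_integrable 1 (fun=> c : R).
  by apply: (@gauss_integrable_bounded _ _ _ `|c|) => //; exact: measurable_cst.
have I2 := @gauss_integrable_sqr R.
have I3 := @gauss_integrable_norm_cube R.
pose c := second_diff f x 1.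
have E : 2 * (heat 1 f x - walk_avg f x) =
    gauss_mean 1 (fun y => second_diff f x y + (- c) * y ^+ 2).
  rewrite (_ : (fun y => _) = fun y => f (x + y) + f (x - y) + (- (2 * f x)) + (- c) * y ^+ 2)//.
  rewrite gauss_meanD//; last 2 first.
  - by apply: gauss_integrableD => //; exact: gauss_integrableD.
  - exact: gauss_integrableZ.
  rewrite gauss_meanD//; last exact: gauss_integrableD.
  rewrite gauss_meanD// gauss_mean_cst gauss_meanZ// gauss_mean_sqr -hN -/(heat 1 f x).
  by rewrite walk_avgE /c /second_diff; field.
have : `|2 * (heat 1 f x - walk_avg f x)| <= M * third_moment_bound.
  have -> : third_moment_bound = gauss_mean 1 (fun y => y ^+ 2 + `|y| ^+ 3).
    by rewrite gauss_meanD// gauss_mean_sqr.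
  rewrite E -gauss_meanZ; last exact: gauss_integrableD.
  apply: gauss_mean_norm_le.
  - apply: measurable_funD; last by apply: measurable_funM => //; exact: measurable_funX.
    apply: measurable_funB => //; apply: measurable_funD.
      by apply: continuous_measurable_fun; exact: continuous_translate.
    exact: continuous_measurable_fun.
  - by apply: gauss_integrableZ; exact: gauss_integrableD.
  - by move=> y; rewrite mulNr [c * _]mulrC; exact: fM.
rewrite normrM distrC [X in X * _]ger0_norm//.
apply: le_trans; rewrite ler_peMl//; lra.
Qed.

(** The walk and the heat semigroup are exchanged one step at a time: averaging
    does not increase the error made so far, and the semigroup keeps the
    regularity of the test function. *)
Lemma walk_heat_le n M L f x : (forall y, 0 <= f y <= 1) ->
  (forall x y, `|f x - f y| <= L * `|x - y|) -> quadratic_diff M f ->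
  `|iter n.+1 walk_avg f x - heat (Num.sqrt n.+1%:R) f x|
    <= n.+1%:R * (M * third_moment_bound).
Proof.
move=> f01 fL fM; have cf := lipschitz_continuous fL.
elim: n x => [|n ih] x.
  by rewrite /= sqrtr1 mul1r; exact: walk_avg_heat_le.
have sn0 : 0 < Num.sqrt n.+1%:R :> R by rewrite sqrtr_gt0.
set g := heat (Num.sqrt n.+1%:R) f.
have -> : heat (Num.sqrt n.+2%:R) f x = heat 1 g x.
  have -> : n.+2%:R = 1 + n.+1%:R :> R by rewrite -natr1 addrC.
  by rewrite -[n.+1%:R in LHS](@sqr_sqrtr R) ?ler0n// -heat_semigroup.
have mg : measurable_fun setT f by exact: continuous_measurable_fun.
have h1 : `|walk_avg g x - heat 1 g x| <= M * third_moment_bound.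
  apply: walk_avg_heat_le.
  - by apply: (@lipschitz_continuous L); exact: heat_lipschitz.
  - by move=> y; exact: heat_bounds.
  - by apply: heat_quadratic_diff => //; rewrite gt_eqF.
have h2 : `|iter n.+2 walk_avg f x - walk_avg g x|
    <= n.+1%:R * (M * third_moment_bound).
  have -> : iter n.+2 walk_avg f x - walk_avg g x =
      walk_avg (iter n.+1 walk_avg f \- g) x by rewrite /walk_avg avgB.
  apply: le_trans (avg_norm_le sign_step coin_ge0
    (w := fun=> n.+1%:R * (M * third_moment_bound)) ih x) _.
  by rewrite /avg -mulr_suml coin_sum mul1r.
rewrite -[n.+2%:R]natr1 mulrDl mul1r.
by rewrite (le_trans (ler_distD (walk_avg g x) _ _))// lerD.
Qed.

(** The quadratic terms cancel, so that rescaling by [h] gains [h ^+ 3]; this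
    beats the number [h ^- 2] of steps. *)
Lemma taylor2_quadratic_diff M h f : 0 <= h -> taylor2 M f ->
  quadratic_diff (2 * M * h ^+ 3) (fun x => f (h * x)).
Proof.
move=> h0 [D1 [D2 [_ fT]]] x z.
have key y : `|second_diff (fun x => f (h * x)) x y - 2 * D2 (h * x) * (h * y) ^+ 2|
    <= 2 * M * h ^+ 3 * `|y| ^+ 3.
  have e1 := fT (h * x) (h * y); have e2 := fT (h * x) (- (h * y)).
  rewrite /second_diff mulrDr mulrBr.
  set A := f (h * x + h * y) in e1 *; set B := f (h * x - h * y) in e2 *.
  have -> : A + B - 2 * f (h * x) - 2 * D2 (h * x) * (h * y) ^+ 2 =
    (A - (f (h * x) + D1 (h * x) * (h * y) + D2 (h * x) * (h * y) ^+ 2)) +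
    (B - (f (h * x) + D1 (h * x) * - (h * y) + D2 (h * x) * (- (h * y)) ^+ 2)).
    ring.
  apply: le_trans (ler_normD _ _) _; apply: le_trans (lerD e1 e2) _.
  by rewrite normrN normrM (ger0_norm h0) exprMn; lra.
have k1 := key z; have k2 := key 1.
rewrite normr1 expr1n !mulr1 in k2.
set c := D2 (h * x) in k1 k2.
set S := second_diff _ _ _ in k1 *; set S1 := second_diff _ _ _ in k2 *.
have -> : S - z ^+ 2 * S1 = (S - 2 * c * (h * z) ^+ 2) - z ^+ 2 * (S1 - 2 * c * h ^+ 2).
  ring.
apply: le_trans (ler_normB _ _) _; rewrite normrM (ger0_norm (sqr_ge0 z)).
have := lerD k1 (ler_wpM2l (sqr_ge0 z) k2) => /le_trans; apply.
lra.
Qed.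

Lemma taylor2_ge0 M f : taylor2 M f -> 0 <= M.
Proof. by move=> [D1 [_ [/(_ 0)[+ _] _]]]; apply: le_trans. Qed.

(** Far-apart points are handled by the bounds on the values, close points by
    the expansion. *)
Lemma taylor2_lipschitz M f : (forall y, 0 <= f y <= 1) -> taylor2 M f ->
  forall x y, `|f x - f y| <= (3 * M + 1) * `|x - y|.
Proof.
move=> f01 fT x y; have M0 := taylor2_ge0 fT.
have [D1 [D2 [DM fE]]] := fT.
have [xy|xy] := lerP 1 `|x - y|.
  have : `|f x - f y| <= 1.
    by rewrite ler_norml; have := f01 x; have := f01 y; lra.
  by move/le_trans; apply; rewrite (le_trans xy)// ler_peMl// lerDr mulr_ge0.
have [D1M D2M] := DM y; have := fE y (x - y); rewrite subrKC.
set b := `|x - y| in xy *; have b0 : 0 <= b by exact: normr_ge0.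
have -> : f x - f y = (f x - (f y + D1 y * (x - y) + D2 y * (x - y) ^+ 2))
    + (D1 y * (x - y) + D2 y * (x - y) ^+ 2) by ring.
move=> h; apply: le_trans (ler_normD _ _) _.
have h1 : `|D1 y * (x - y)| <= M * b by rewrite normrM ler_wpM2r.
have h2 : `|D2 y * (x - y) ^+ 2| <= M * b ^+ 2.
  by rewrite normrM normrX ler_wpM2r// exprn_ge0.
have b2 : b ^+ 2 <= b by rewrite expr2 ler_piMl// ltW.
have b3 : b ^+ 3 <= b by rewrite exprS ler_piMr// (le_trans b2)// ltW.
have := ler_normD (D1 y * (x - y)) (D2 y * (x - y) ^+ 2).
have := ler_wpM2l M0 b2; have := ler_wpM2l M0 b3; lra.
Qed.

Lemma rademacher_clt n M f : (forall y, 0 <= f y <= 1) -> taylor2 M f ->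
  `|iter n.+1 walk_avg (fun x => f ((Num.sqrt n.+1%:R)^-1 * x)) 0 - gauss_mean 1 f|
    <= 2 * M * third_moment_bound / Num.sqrt n.+1%:R.
Proof.
move=> f01 fM; have fL := taylor2_lipschitz f01 fM.
set h : R := (Num.sqrt n.+1%:R)^-1.
have s0 : 0 < Num.sqrt n.+1%:R :> R by rewrite sqrtr_gt0.
have h0 : 0 < h by rewrite invr_gt0.
have cf := lipschitz_continuous fL.
have <- : heat (Num.sqrt n.+1%:R) (fun x => f (h * x)) 0 = gauss_mean 1 f.
  rewrite /heat gauss_mean_scale//.
  - congr (gauss_mean 1 _); apply/funext => y; rewrite add0r mulrA.
    by rewrite mulVf ?mul1r// gt_eqF.
  - move=> y; apply: continuous_comp; last exact: cf.
    apply: cvgM; first exact: cvg_cst.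
    by apply: cvgD; [exact: cvg_cst|exact: cvg_id].
  - by move=> y; case/andP: (f01 (h * (0 + y))).
have L' x y : `|f (h * x) - f (h * y)| <= ((3 * M + 1) * h) * `|x - y|.
  by rewrite (le_trans (fL _ _))// -mulrBr normrM (gtr0_norm h0) mulrA.
apply: le_trans (walk_heat_le n 0 _ L' (taylor2_quadratic_diff (ltW h0) fM)) _.
  by move=> y; exact: f01.
have -> : n.+1%:R = h ^- 2 :> R by rewrite exprVn invrK sqr_sqrtr.
rewrite le_eqVlt; apply/orP; left; apply/eqP.
by field; rewrite gt_eqF.
Qed.

End one_dimensional_clt.

Section smooth_step.
Context {R : realType}.
Implicit Types (x a b h c M : R).

Definition pos_part x : R := Num.max x 0.

Lemma pos_partE x : pos_part x = if 0 <= x then x else 0.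
Proof. by rewrite /pos_part; case: (lerP 0 x). Qed.

Definition third_diff (g : R -> R) x : R :=
  g x - 3 * g (x - 1) + 3 * g (x - 2) - g (x - 3).

(** A cubic spline falling from 1 on the negative numbers to 0 beyond 3: on
    cubes the third difference is constant, equal to 6. *)
Definition smooth_step x : R := 1 - third_diff (fun y => pos_part y ^+ 3) x / 6.

(** The truncated cube has a second derivative that is Lipschitz, which is all
    that a cubic remainder requires. *)
Lemma cube_pos_part_taylor a b :
  `|pos_part (a + b) ^+ 3 -
    (pos_part a ^+ 3 + 3 * pos_part a ^+ 2 * b + 3 * pos_part a * b ^+ 2)|
  <= `|b| ^+ 3.
Proof.
rewrite -normrX !pos_partE; case: (lerP 0 a) => a0; case: (lerP 0 (a + b)) => ab0.
- by rewrite (_ : _ - _ = b ^+ 3)//; ring.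
- have -> : `|b ^+ 3| = - b ^+ 3.
    by rewrite ler0_norm// -oppr_ge0 (_ : - b ^+ 3 = (- b) ^+ 3) ?exprn_ge0//; [lra|ring].
  rewrite ler_norml; apply/andP; split; last first.
    have : 0 <= a * (a ^+ 2 + 3 * a * b + 3 * b ^+ 2) by apply: mulr_ge0 => //; nra.
    have := sqr_ge0 b; nra.
  have : 0 <= (- (a + b)) ^+ 3 by apply: exprn_ge0; lra.
  lra.
- rewrite !expr0n/= !(mulr0, mul0r, addr0, subr0).
  have b0 : 0 <= b by lra.
  by rewrite !normrX lerXn2r ?nnegrE ?normr_ge0// !ger0_norm//; lra.
- by rewrite !expr0n/= !(mulr0, mul0r, addr0, subr0) normr0.
Qed.

Lemma pos_part_le0 x : x <= 0 -> pos_part x = 0.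
Proof. by move=> x0; rewrite /pos_part max_r. Qed.

Lemma pos_part_ge0 x : 0 <= x -> pos_part x = x.
Proof. by move=> x0; rewrite /pos_part max_l. Qed.

Lemma smooth_step_le0 x : x <= 0 -> smooth_step x = 1.
Proof.
move=> x0; rewrite /smooth_step /third_diff !pos_part_le0; lra.
Qed.

Lemma smooth_step_ge3 x : 3 <= x -> smooth_step x = 0.
Proof.
move=> x3; rewrite /smooth_step /third_diff !pos_part_ge0; lra.
Qed.

Lemma smooth_step_bounds x : 0 <= smooth_step x <= 1.
Proof.
have [x0|x0] := lerP x 0; first by rewrite smooth_step_le0// ler01 lexx.
have [x3|x3] := lerP 3 x; first by rewrite smooth_step_ge3// lexx ler01.
rewrite /smooth_step /third_diff [pos_part x]pos_part_ge0 ?(ltW x0)//.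
rewrite [pos_part (x - 3)]pos_part_le0; last lra.
have [x1|x1] := lerP 1 x; last first.
  rewrite !pos_part_le0; [|lra|lra].
  have : x ^+ 3 <= 1 by apply: exprn_ile1; lra.
  have : 0 <= x ^+ 3 by apply: exprn_ge0; lra.
  lra.
rewrite [pos_part (x - 1)]pos_part_ge0; last lra.
have [x2|x2] := lerP 2 x.
  rewrite pos_part_ge0; last lra.
  have -> : 1 - (x ^+ 3 - 3 * (x - 1) ^+ 3 + 3 * (x - 2) ^+ 3 - 0 ^+ 3) / 6
      = (3 - x) ^+ 3 / 6 by field.
  have : 0 <= (3 - x) ^+ 3 by apply: exprn_ge0; lra.
  have : (3 - x) ^+ 3 <= 1 by apply: exprn_ile1; lra.
  lra.
rewrite pos_part_le0; last lra.
set t := x - 1; have -> : x = 1 + t by rewrite /t; ring.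
have t0 : 0 <= t by rewrite /t; lra.
have t1 : t <= 1 by rewrite /t; lra.
have : t ^+ 2 <= 1 by exact: exprn_ile1.
have : 0 <= t ^+ 3 by exact: exprn_ge0.
have : t ^+ 3 <= t ^+ 2 by rewrite exprS ler_piMl// exprn_ge0.
have : 0 <= (1 - t) ^+ 2 * (1 + 2 * t) by rewrite mulr_ge0 ?sqr_ge0//; lra.
lra.
Qed.

Lemma smooth_step_taylor2 : taylor2 2 smooth_step.
Proof.
exists (fun a => - third_diff (fun y => pos_part y ^+ 2) a / 2),
       (fun a => - third_diff pos_part a / 2); split.
  move=> a; rewrite /third_diff !pos_partE; split.
    rewrite ler_norml.
    case: (lerP 0 a) => ?; case: (lerP 0 (a - 1)) => ?; case: (lerP 0 (a - 2)) => ?;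
    case: (lerP 0 (a - 3)) => ?; rewrite ?expr0n /=; try lra; apply/andP; split; nra.
  rewrite ler_norml.
  by case: (lerP 0 a) => ?; case: (lerP 0 (a - 1)) => ?; case: (lerP 0 (a - 2)) => ?;
    case: (lerP 0 (a - 3)) => ?; lra.
move=> a b.
have e0 := cube_pos_part_taylor a b.
have e1 := cube_pos_part_taylor (a - 1) b.
have e2 := cube_pos_part_taylor (a - 2) b.
have e3 := cube_pos_part_taylor (a - 3) b.
rewrite (addrAC a _ b) in e1; rewrite (addrAC a _ b) in e2.
rewrite (addrAC a _ b) in e3.
rewrite /smooth_step /third_diff.
set B := `|b| ^+ 3 in e0 e1 e2 e3 *.
have B0 : 0 <= B by rewrite exprn_ge0.
rewrite ler_norml; rewrite !ler_norml in e0 e1 e2 e3.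
move: e0 e1 e2 e3 => /andP[? ?] /andP[? ?] /andP[? ?] /andP[? ?].
apply/andP; split; lra.
Qed.

Lemma taylor2_affine M h c f : 0 <= h -> taylor2 M f ->
  taylor2 (M * (h + h ^+ 2 + h ^+ 3)) (fun x => f (h * x + c)).
Proof.
move=> h0 fT; have M0 := taylor2_ge0 fT; have [D1 [D2 [DM fE]]] := fT.
exists (fun a => h * D1 (h * a + c)), (fun a => h ^+ 2 * D2 (h * a + c)).
have h2 : 0 <= h ^+ 2 by rewrite exprn_ge0.
have h3 : 0 <= h ^+ 3 by rewrite exprn_ge0.
split => [a|a b].
  have [d1 d2] := DM (h * a + c).
  rewrite normrM (ger0_norm h0) [X in _ /\ X <= _]normrM (ger0_norm h2).
  have := mulr_ge0 M0 h0; have := mulr_ge0 M0 h2; have := mulr_ge0 M0 h3.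
  have := ler_wpM2l h0 d1; have := ler_wpM2l h2 d2; lra.
have := fE (h * a + c) (h * b); rewrite normrM (ger0_norm h0) [(h * `|b|) ^+ 3]exprMn.
move=> e; have -> : h * (a + b) + c = h * a + c + h * b by ring.
have -> : f (h * a + c) + h * D1 (h * a + c) * b + h ^+ 2 * D2 (h * a + c) * b ^+ 2
  = f (h * a + c) + D1 (h * a + c) * (h * b) + D2 (h * a + c) * (h * b) ^+ 2 by ring.
apply: (le_trans e); rewrite mulrA ler_wpM2r ?exprn_ge0// ler_wpM2l//; lra.
Qed.

End smooth_step.

Section half_lines.
Context {R : realType}.
Implicit Types (t : R) (g f : R -> R).

Definition scaled_walk_mean n g : R :=
  iter n walk_avg (fun x => g ((Num.sqrt n%:R)^-1 * x)) 0.

Definition gauss_cdf t : R := fine (normal_prob (0 : R) 1 `]-oo, t]).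

Lemma gauss_mean_indic (A : set R) : measurable A ->
  gauss_mean 1 (\1_A) = fine (normal_prob (0 : R) 1 A).
Proof.
move=> mA; rewrite /gauss_mean /Rintegral /normal_prob [in RHS]integral_mkcond.
congr fine; apply: eq_integral => y _; rewrite patchE indicE.
by case: (y \in A); rewrite ?mul1r ?mul0r.
Qed.

Lemma gauss_integrable_indic (A : set R) : measurable A ->
  gauss_integrable (1 : R) (\1_A).
Proof.
move=> mA; apply: (@gauss_integrable_bounded _ _ _ 1) => //.
by move=> y; rewrite indicE; case: (y \in A); rewrite ?normr1// normr0.
Qed.

(** The density is bounded by its peak. *)
Lemma gauss_cdf_increment t (d : R) : 0 <= d ->
  gauss_cdf (t + d) <= gauss_cdf t + normal_peak 1 * d.
Proof.
move=> d0; rewrite /gauss_cdf.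
have -> : `]-oo, (t + d)]%classic = `]-oo, t]%classic `|` `]t, (t + d)]%classic.
  by rewrite -itv_bndbnd_setU// bnd_simp lerDl.
have fin A : measurable A -> normal_prob (0 : R) 1 A \is a fin_num.
  by move=> mA; exact: fin_num_measure.
rewrite measureU//; last first.
  apply/seteqP; split => y //= [].
  by rewrite !in_itv/= => yt /andP[ty _]; rewrite ltNge yt in ty.
rewrite fineD ?fin// lerD2l -lee_fin fineK ?fin//.
rewrite /normal_prob.
apply: (@le_trans _ _ (\int[lebesgue_measure]_(y in `]t, (t + d)%R]) (normal_peak (1 : R))%:E)%E).
  apply: ge0_le_integral => //.
  - by move=> y _; rewrite lee_fin normal_pdf_ge0.
  - by apply/measurable_funTS/measurable_EFinP; exact: measurable_normal_pdf.
  - by move=> y _; rewrite lee_fin normal_pdf_ub// oner_neq0.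
rewrite integral_cst//= lebesgue_measure_itv/= lte_fin.
case: ifP => _; first by rewrite -EFinB addrAC subrr add0r -EFinM.
by rewrite mule0 lee_fin mulr_ge0 ?normal_peak_ge0.
Qed.

Lemma scaled_walk_mean_le n g f : (forall x, g x <= f x) ->
  scaled_walk_mean n g <= scaled_walk_mean n f.
Proof. by move=> gf; apply: iter_avg_le => // x; exact: coin_ge0. Qed.

Lemma scaled_walk_mean_cvg f M : (forall y, 0 <= f y <= 1) -> taylor2 M f ->
  scaled_walk_mean n f @[n --> \oo] --> gauss_mean 1 f.
Proof.
move=> f01 fM; rewrite -cvg_shiftS.
apply/cvgrPdist_le => e e0.
set C := 2 * M * third_moment_bound.
have M0 := taylor2_ge0 fM.
have C0 : 0 <= C by rewrite /C mulr_ge0 ?third_moment_bound_ge0// mulr_ge0.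
near=> n; rewrite distrC (le_trans (rademacher_clt n f01 fM))// -/C.
have sn0 : 0 < Num.sqrt n.+1%:R :> R by rewrite sqrtr_gt0.
rewrite ler_pdivrMr// -ler_pdivrMl//.
have ce0 : 0 <= e^-1 * C by rewrite mulr_ge0// invr_ge0 ltW.
rewrite -[leLHS]ger0_norm// -sqrtr_sqr ler_wsqrtr//.
rewrite (@le_trans _ _ n%:R)// ?ler_nat//.
by near: n; exact: nbhs_infty_ger.
Unshelve. all: by end_near. Qed.

(** The smooth step, rescaled to fall from 1 to 0 on an interval of length [d],
    squeezes the indicator of a half-line between two test functions whose
    Gaussian means differ little. *)
Lemma scaled_walk_half_line t g :
  (forall x : R, (x < t)%R%:R <= g x <= (x <= t)%R%:R) ->
  scaled_walk_mean n g @[n --> \oo] --> gauss_cdf t.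
Proof.
move=> gt; apply/cvgrPdist_le => e e0.
(* the transition of the step, of length [3 * d], has Gaussian mass at most
   [3 * d * normal_peak 1], to be made smaller than [e / 2] *)
pose K : R := 3 * normal_peak 1 + 1.
have K0 : 0 < K by rewrite ltr_wpDl// mulr_ge0// normal_peak_ge0.
pose d : R := e / (2 * K).
have d0 : 0 < d by rewrite divr_gt0// mulr_gt0.
have dn0 : d != 0 by rewrite gt_eqF.
pose up x := smooth_step (d^-1 * x + - (t / d)).
pose lo x := smooth_step (d^-1 * x + (3 - t / d)).
have upE x : d^-1 * x + - (t / d) = (x - t) / d by rewrite mulrBl mulrC.
have loE x : d^-1 * x + (3 - t / d) = (x - (t - 3 * d)) / d by field.
have up1 x : (x <= t)%R%:R <= up x.
  rewrite /up upE; case: (lerP x t) => xt; last by case/andP: (smooth_step_bounds ((x - t) / d)).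
  by rewrite smooth_step_le0// pmulr_lle0 ?invr_gt0// subr_le0.
have up2 x : up x <= (x <= t + 3 * d)%R%:R.
  rewrite /up upE; case: (lerP x (t + 3 * d)) => xt.
    by case/andP: (smooth_step_bounds ((x - t) / d)).
  by rewrite smooth_step_ge3// ler_pdivlMr// lerBrDl ltW.
have lo1 x : (x <= t - 3 * d)%R%:R <= lo x.
  rewrite /lo loE; case: (lerP x (t - 3 * d)) => xt; last first.
    by case/andP: (smooth_step_bounds ((x - (t - 3 * d)) / d)).
  by rewrite smooth_step_le0// pmulr_lle0 ?invr_gt0// subr_le0.
have lo2 x : lo x <= (x < t)%R%:R.
  rewrite /lo loE; case: (ltrP x t) => xt.
    by case/andP: (smooth_step_bounds ((x - (t - 3 * d)) / d)).
  by rewrite smooth_step_ge3// ler_pdivlMr//; lra.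
have b01 c x : 0 <= smooth_step (d^-1 * x + c) <= 1 by exact: smooth_step_bounds.
have dV0 : 0 <= d^-1 by rewrite invr_ge0 ltW.
have T c := taylor2_affine c dV0 (@smooth_step_taylor2 R).
have cont c : continuous (fun x => smooth_step (d^-1 * x + c)).
  exact: lipschitz_continuous (taylor2_lipschitz (b01 c) (T c)).
have I c : gauss_integrable 1 (fun x => smooth_step (d^-1 * x + c)).
  exact: gauss_integrable_continuous.
have indE (s x : R) : (x <= s)%R%:R = \1_(`]-oo, s]) x :> R.
  by rewrite indicE mem_setE in_itv.
have meanE s : gauss_mean 1 (fun x : R => (x <= s)%R%:R) = gauss_cdf s.
  rewrite /gauss_cdf -gauss_mean_indic//.
  by congr (gauss_mean 1 _); apply/funext => x; rewrite indE.
have Ii s : gauss_integrable 1 (fun x : R => (x <= s)%R%:R).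
  by rewrite (_ : (fun x => _) = \1_(`]-oo, s])); [exact: gauss_integrable_indic|apply/funext => x].
have incr c : gauss_cdf (c + 3 * d) <= gauss_cdf c + e / 2.
  apply: (le_trans (gauss_cdf_increment _ _)); first by rewrite mulr_ge0// ltW.
  rewrite lerD2l.
  have -> : e / 2 = K * d by rewrite /d; field; rewrite gt_eqF.
  rewrite mulrA [_ * 3]mulrC ler_wpM2r ?ltW// /K ltrDl//.
have gup : gauss_mean 1 up <= gauss_cdf t + e / 2.
  apply: (@le_trans _ _ (gauss_cdf (t + 3 * d))).
    by rewrite -meanE; apply: gauss_mean_le => //; exact: I.
  exact: incr.
have glo : gauss_cdf t - e / 2 <= gauss_mean 1 lo.
  apply: (@le_trans _ _ (gauss_cdf (t - 3 * d))); last first.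
    by rewrite -meanE; apply: gauss_mean_le => //; exact: I.
  by rewrite lerBlDr -{1}(subrK (3 * d) t); exact: incr.
have /cvgrPdist_le/(_ _ (divr_gt0 e0 (ltr0n R 2))) cu :=
  scaled_walk_mean_cvg (b01 _) (T (- (t / d))).
have /cvgrPdist_le/(_ _ (divr_gt0 e0 (ltr0n R 2))) cl :=
  scaled_walk_mean_cvg (b01 _) (T (3 - t / d)).
near=> n.
have hu : `|gauss_mean 1 up - scaled_walk_mean n up| <= e / 2 by near: n.
have hl : `|gauss_mean 1 lo - scaled_walk_mean n lo| <= e / 2 by near: n.
have gu : scaled_walk_mean n g <= scaled_walk_mean n up.
  by apply: scaled_walk_mean_le => x; rewrite (le_trans _ (up1 x))//; case/andP: (gt x).
have gl : scaled_walk_mean n lo <= scaled_walk_mean n g.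
  by apply: scaled_walk_mean_le => x; rewrite (le_trans (lo2 x))//; case/andP: (gt x).
move: hu hl; rewrite !ler_norml => /andP[? ?] /andP[? ?]; apply/andP; split; lra.
Unshelve. all: by end_near. Qed.

Lemma sqr_gt_sqrt (s y : R) : 0 <= s ->
  (s < y ^+ 2) = ~~ ((- Num.sqrt s <= y) && (y <= Num.sqrt s)).
Proof.
move=> s0; rewrite -ler_norml -ltNge -[in LHS](sqr_sqrtr s0).
by rewrite -[y ^+ 2]real_normK ?num_real// ltr_sqr ?nnegrE ?sqrtr_ge0.
Qed.

Lemma normal_prob_sqr_gt (s : R) : 0 <= s ->
  fine (normal_prob (0 : R) 1 [set y | s < y ^+ 2]) =
  1 - gauss_cdf (Num.sqrt s) + gauss_cdf (- Num.sqrt s).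
Proof.
move=> s0; rewrite /gauss_cdf.
have fin A : measurable A -> normal_prob (0 : R) 1 A \is a fin_num.
  by move=> mA; exact: fin_num_measure.
have sE y := sqr_gt_sqrt y s0.
have -> : [set y | s < y ^+ 2] =
    `]-oo, (- Num.sqrt s)[%classic `|` `](Num.sqrt s), +oo[%classic.
  apply/seteqP; split => y /=; rewrite !in_itv/= andbT sE negb_and -!ltNge.
    by move/orP.
  by move=> h; apply/orP.
rewrite measureU//; last first.
  apply/seteqP; split => y //= []; rewrite !in_itv/= andbT => y1 y2.
  by have := lt_trans y2 y1; have := sqrtr_ge0 s; lra.
rewrite fineD ?fin// addrC; congr (_ + _).
  have -> : `](Num.sqrt s), +oo[%classic = ~` `]-oo, (Num.sqrt s)]%classic.
    by rewrite setCitvl.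
  by rewrite [LHS](congr1 fine (probability_setC (normal_prob (0 : R) 1)
    (measurable_itv `]-oo, Num.sqrt s]))) fineB// fin.
congr fine; apply: integral_itv_bndo_bndc.
by apply/measurable_funTS/measurable_EFinP; exact: measurable_normal_pdf.
Qed.

Lemma scaled_walk_sqr_gt (s : R) : 0 <= s ->
  scaled_walk_mean n (fun x => (s < x ^+ 2)%R%:R) @[n --> \oo] -->
  fine (normal_prob (0 : R) 1 [set y | s < y ^+ 2]).
Proof.
move=> s0; rewrite normal_prob_sqr_gt//.
pose g1 (x : R) : R := (x <= Num.sqrt s)%R%:R.
pose g2 (x : R) : R := (x < - Num.sqrt s)%R%:R.
have c1 : scaled_walk_mean n g1 @[n --> \oo] --> gauss_cdf (Num.sqrt s).
  apply: scaled_walk_half_line => x; rewrite lexx andbT /g1 ler_nat.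
  by case: ltrP => // /ltW ->.
have c2 : scaled_walk_mean n g2 @[n --> \oo] --> gauss_cdf (- Num.sqrt s).
  apply: scaled_walk_half_line => x; rewrite lexx /= /g2 ler_nat.
  by case: ltrP => // /ltW ->.
have gE : (fun x : R => (s < x ^+ 2)%R%:R) = ((fun=> 1) \- g1) \- (fun x => -1 * g2 x) :> (R -> R).
  apply/funext => x /=; rewrite /g1 /g2 mulN1r opprK.
  rewrite sqr_gt_sqrt//.
  rewrite negb_and -!ltNge; case: ltrP => xs /=.
    have -> : x <= Num.sqrt s by have := sqrtr_ge0 s; lra.
    by rewrite subrr add0r.
  by case: ltrP => _; rewrite ?subr0 ?subrr addr0.
have -> : (fun n => scaled_walk_mean n (fun x : R => (s < x ^+ 2)%R%:R)) =
  (fun n => 1 - scaled_walk_mean n g1 + scaled_walk_mean n g2).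
  apply/funext => n; rewrite gE /scaled_walk_mean.
  have -> : (fun x : R => (((fun=> 1) \- g1) \- (fun x => -1 * g2 x)) ((Num.sqrt n%:R)^-1 * x)) =
    ((fun=> 1) \- (fun x : R => g1 ((Num.sqrt n%:R)^-1 * x)))
    \- (fun x : R => -1 * g2 ((Num.sqrt n%:R)^-1 * x)) by [].
  rewrite /walk_avg !iter_avgB iter_avgZ iter_avg_cst; last exact: coin_sum.
  by rewrite /= mulN1r opprK.
by apply: cvgD => //; apply: cvgB => //; exact: cvg_cst.
Qed.

End half_lines.

(** * Lindeberg replacement for quadratic forms *)

Section quadratic_lindeberg.
Context {R : realType} {I : finType}.
Variables (J : pred I) (a : I -> R) (c0 : R).
Implicit Types (x y : {ffun I -> R}) (h K : R).

(** [J] is meant to be the set of the coordinates with a non-zero coefficient: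
    the steps of the walk will only be centred there. *)
Definition diag_form x : R := c0 + \sum_(k | J k) a k * x k ^+ 2.

Definition step (S : finType) h (xi : S -> I -> R) (z : S) : {ffun I -> R} :=
  [ffun k => h * xi z k].

(** The square of this norm is the weight of the replacement argument: it
    dominates the cubic remainder of a function of the form, and one step of
    size [h] increases its mean by a factor [1 + O(h^2)] only. *)
Definition sqnorm x : R := 1 + \sum_(k | J k) x k ^+ 2.
Let abssum x : R := \sum_(k | J k) `|x k|.
Local Notation d := (#|I|%:R : R).

Let d0 : 0 <= d. Proof. exact: ler0n. Qed.

Let sqnorm_ge1 x : 1 <= sqnorm x.
Proof. by rewrite lerDl sumr_ge0// => k _; exact: sqr_ge0. Qed.

Let abssum_ge0 x : 0 <= abssum x.
Proof. exact: sumr_ge0. Qed.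

Let sum_const_le (c : R) : 0 <= c -> \sum_(k | J k) c <= d * c.
Proof.
move=> c_ge0; rewrite sumr_const -[c *+ _]mulr_natl ler_wpM2r// ler_nat.
exact: max_card.
Qed.

Let abssum_sqr x : abssum x ^+ 2 <= d * \sum_(k | J k) x k ^+ 2.
Proof.
rewrite expr2 /abssum big_distrlr /=.
have s0 : 0 <= \sum_(k | J k) x k ^+ 2 by apply: sumr_ge0 => k _; exact: sqr_ge0.
have h k l : `|x k| * `|x l| <= (x k ^+ 2 + x l ^+ 2) / 2.
  have := sqr_ge0 (`|x k| - `|x l|).
  rewrite sqrrB -[x k ^+ 2]real_normK ?num_real// -[x l ^+ 2]real_normK ?num_real//.
  lra.
apply: (@le_trans _ _ (\sum_(k | J k) \sum_(l | J l) (x k ^+ 2 + x l ^+ 2) / 2)).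
  by apply: ler_sum => k _; apply: ler_sum => l _; exact: h.
have -> : \sum_(k | J k) \sum_(l | J l) (x k ^+ 2 + x l ^+ 2) / 2 =
  \sum_(k | J k) \sum_(l | J l) x k ^+ 2.
  under eq_bigr => k _ do under eq_bigr => l _ do rewrite mulrDl.
  under eq_bigr => k _ do rewrite big_split.
  rewrite big_split /= [X in _ + X]exchange_big /= -big_split /=.
  apply: eq_bigr => k _; rewrite -big_split /=.
  by apply: eq_bigr => l _; field.
apply: (@le_trans _ _ (\sum_(k | J k) d * x k ^+ 2)); last by rewrite mulr_sumr.
by apply: ler_sum => k _; apply: sum_const_le; exact: sqr_ge0.
Qed.

Definition form_cross x y : R := 2 * \sum_(k | J k) a k * x k * y k.
Definition form_diag y : R := \sum_(k | J k) a k * y k ^+ 2.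
Definition lyapunov_rate K : R := 10 * d * K ^+ 2 + 2 * d ^+ 2 * K ^+ 4.
Definition taylor_rate (A M K : R) : R :=
  let C1 := 2 * A * K + A * d * K ^+ 2 in
  M * (C1 ^+ 3 + 3 * C1 ^+ 2) * (2 + 2 * d) ^+ 2.

Definition dot x y : R := \sum_(k | J k) x k * y k.

Section one_step.
Variables (h K : R).
Hypotheses (h0 : 0 <= h) (h1 : h <= 1) (K0 : 0 <= K).
Variable y : {ffun I -> R}.
Hypothesis yK : forall k, `|y k| <= h * K.

Local Notation cross x := (dot x y).
Let sqy : R := \sum_(k | J k) y k ^+ 2.

Let sqy_le : 0 <= sqy <= d * K ^+ 2 * h ^+ 2.
Proof.
rewrite sumr_ge0 => [|k _]; last exact: sqr_ge0.
rewrite /= -mulrA; apply: le_trans (sum_const_le _); last by rewrite mulr_ge0 ?sqr_ge0.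
apply: ler_sum => k _; rewrite -[y k ^+ 2]real_normK ?num_real// -exprMn.
by rewrite ler_sqr ?nnegrE ?mulr_ge0// mulrC.
Qed.

Let cross_le x : `|cross x| <= h * K * abssum x.
Proof.
apply: le_trans (ler_norm_sum _ _ _) _; rewrite mulr_sumr; apply: ler_sum => k _.
by rewrite normrM mulrC ler_wpM2r.
Qed.

(** The term that is linear in the step is kept apart, since its mean is 0. *)
Lemma sqnorm_step x : sqnorm (x + y) ^+ 2 <=
  sqnorm x ^+ 2 + 4 * sqnorm x * cross x
  + lyapunov_rate K * h ^+ 2 * sqnorm x ^+ 2.
Proof.
have -> : sqnorm (x + y) = sqnorm x + 2 * cross x + sqy.
  rewrite /sqnorm /dot /sqy mulr_sumr -!addrA -!big_split /=; congr (_ + _).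
  by apply: eq_bigr => k _; rewrite !ffunE; ring.
have N1 := sqnorm_ge1 x.
set N := sqnorm x in N1 *; set D := cross x; set Y := sqy.
have /andP[Y0 Y1] := sqy_le; rewrite -/Y in Y0 Y1.
have D2 : D ^+ 2 <= K ^+ 2 * h ^+ 2 * (d * N).
  have : D ^+ 2 <= (h * K * abssum x) ^+ 2.
    rewrite -[D ^+ 2]real_normK ?num_real// ler_sqr ?nnegrE ?mulr_ge0//.
    exact: cross_le.
  move=> /le_trans; apply; rewrite exprMn exprMn [h ^+ 2 * _]mulrC.
  apply: ler_wpM2l; first by rewrite mulr_ge0 ?sqr_ge0.
  apply: (le_trans (abssum_sqr x)); apply: ler_wpM2l => //.
  by rewrite /N /sqnorm lerDr.
have NN : N <= N ^+ 2 by rewrite expr2 ler_peMl// (le_trans ler01).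
have hh : 0 <= h ^+ 2 by exact: sqr_ge0.
have Y2 : Y ^+ 2 <= d ^+ 2 * K ^+ 4 * h ^+ 2 * N ^+ 2.
  apply: (@le_trans _ _ ((d * K ^+ 2 * h ^+ 2) ^+ 2)).
    by rewrite ler_sqr ?nnegrE ?mulr_ge0 ?sqr_ge0.
  have -> : (d * K ^+ 2 * h ^+ 2) ^+ 2 = d ^+ 2 * K ^+ 4 * h ^+ 2 * h ^+ 2 by ring.
  apply: ler_wpM2l; first by rewrite !mulr_ge0 ?exprn_ge0.
  by rewrite (@le_trans _ _ 1) ?exprn_ile1 ?exprn_ege1.
have NY : N * Y <= d * K ^+ 2 * h ^+ 2 * N ^+ 2.
  have -> : d * K ^+ 2 * h ^+ 2 * N ^+ 2 = d * K ^+ 2 * h ^+ 2 * N * N by ring.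
  rewrite mulrC ler_wpM2r//; first exact: le_trans N1.
  by rewrite (le_trans Y1)// ler_peMr// mulr_ge0 ?mulr_ge0 ?sqr_ge0.
rewrite /lyapunov_rate.
have D2' : D ^+ 2 <= d * K ^+ 2 * h ^+ 2 * N ^+ 2.
  apply: (le_trans D2).
  have -> : K ^+ 2 * h ^+ 2 * (d * N) = d * K ^+ 2 * h ^+ 2 * N by ring.
  by rewrite ler_wpM2l// mulr_ge0 ?mulr_ge0 ?sqr_ge0.
have : (2 * D + Y) ^+ 2 <= 8 * D ^+ 2 + 2 * Y ^+ 2.
  have := sqr_ge0 (2 * D - Y); lra.
lra.
Qed.

(** In the second-order term the increment of the form is reduced to its part
    that is linear in the step: the rest is absorbed by the cubic remainder. *)
Lemma diag_form_step (A M : R) (f : R -> R) D1 D2 x : 0 <= A ->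
  (forall k, `|a k| <= A) -> 0 <= M ->
  (forall b, `|D2 b| <= M) ->
  (forall b e, `|f (b + e) - (f b + D1 b * e + D2 b * e ^+ 2)| <= M * `|e| ^+ 3) ->
  `|f (diag_form (x + y)) - (f (diag_form x)
      + D1 (diag_form x) * (form_cross x y + form_diag y)
      + D2 (diag_form x) * form_cross x y ^+ 2)|
  <= taylor_rate A M K * h ^+ 3 * sqnorm x ^+ 2.
Proof.
move=> A0 aA M0 D2M fT; rewrite /taylor_rate.
set l := form_cross x y; set q := form_diag y.
set C1 := 2 * A * K + A * d * K ^+ 2.
have -> : diag_form (x + y) = diag_form x + (l + q).
  rewrite /diag_form /l /q /form_cross /form_diag mulr_sumr -!addrA -!big_split /=; congr (_ + _).
  by apply: eq_bigr => k _; rewrite !ffunE; ring.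
set b := diag_form x.
(* [m] measures the size of [x]: the increment of the form is [O(h * m)] *)
pose m := 1 + abssum x.
have m1 : 1 <= m by rewrite lerDl.
have m0 : 0 <= m by exact: le_trans m1.
have C1E : 0 <= 2 * A * K /\ 0 <= A * d * K ^+ 2.
  by split; rewrite ?mulr_ge0 ?sqr_ge0.
have [C1a C1b] := C1E.
have C10 : 0 <= C1 by rewrite addr_ge0.
have lm : `|l| <= 2 * A * K * h * m.
  rewrite /l /form_cross normrM ger0_norm// -!mulrA ler_wpM2l//.
  apply: (le_trans (ler_norm_sum _ _ _)).
  apply: (@le_trans _ _ (\sum_(k | J k) (A * (K * h)) * `|x k|)).
    apply: ler_sum => k _; rewrite !normrM.
    have -> : A * (K * h) * `|x k| = A * `|x k| * (h * K) by ring.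
    by rewrite ler_pM ?mulr_ge0// ler_wpM2r.
  rewrite -mulr_sumr -!mulrA !ler_wpM2l//; by rewrite /m lerDr.
have qm : `|q| <= A * d * K ^+ 2 * h ^+ 2.
  apply: (le_trans (ler_norm_sum _ _ _)).
  apply: (@le_trans _ _ (\sum_(k | J k) A * y k ^+ 2)).
    apply: ler_sum => k _; rewrite normrM [X in _ * X]ger0_norm ?sqr_ge0//.
    by rewrite ler_wpM2r ?sqr_ge0.
  rewrite -mulr_sumr.
  have -> : A * d * K ^+ 2 * h ^+ 2 = A * (d * K ^+ 2 * h ^+ 2) by ring.
  by rewrite ler_wpM2l//; case/andP: sqy_le.
have lC : `|l| <= C1 * h * m.
  apply: (le_trans lm); rewrite ler_wpM2r// ler_wpM2r// /C1 lerDl//.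
have qC : `|q| <= C1 * h ^+ 2.
  by apply: (le_trans qm); rewrite ler_wpM2r ?sqr_ge0// /C1 lerDr.
have lqC : `|l + q| <= C1 * h * m.
  apply: (le_trans (ler_normD _ _)); apply: (le_trans (lerD lm qm)).
  have hm : h ^+ 2 <= h * m by rewrite expr2 ler_wpM2l// (le_trans h1).
  have := ler_wpM2l C1b hm; rewrite /C1; lra.
have mm : m ^+ 2 <= (2 + 2 * d) * sqnorm x.
  have := d0; have := abssum_sqr x; have := sqr_ge0 (1 - abssum x).
  have s0 : 0 <= \sum_(k | J k) x k ^+ 2 by apply: sumr_ge0 => k _; exact: sqr_ge0.
  rewrite /m /sqnorm; set S := \sum_(k | J k) x k ^+ 2 in s0 *; lra.
have m3 : m ^+ 3 <= (2 + 2 * d) ^+ 2 * sqnorm x ^+ 2.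
  apply: (@le_trans _ _ (m ^+ 4)); first by rewrite [leRHS]exprS ler_peMl ?exprn_ge0.
  rewrite -exprMn -[leLHS]/(m ^+ (2 * 2)) exprM ler_sqr ?nnegrE ?sqr_ge0//.
  have sn0 : 0 <= sqnorm x by exact: le_trans ler01 (sqnorm_ge1 x).
  by apply: mulr_ge0 => //; have := d0; lra.
have -> : f (b + (l + q)) - (f b + D1 b * (l + q) + D2 b * l ^+ 2) =
  (f (b + (l + q)) - (f b + D1 b * (l + q) + D2 b * (l + q) ^+ 2))
  + D2 b * (2 * l * q + q ^+ 2) by ring.
apply: (le_trans (ler_normD _ _)).
have h3 : h ^+ 4 <= h ^+ 3 by rewrite [leLHS]exprS ler_piMl// exprn_ge0.
have r1 : `|f (b + (l + q)) - (f b + D1 b * (l + q) + D2 b * (l + q) ^+ 2)|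
    <= M * (C1 ^+ 3 * h ^+ 3 * m ^+ 3).
  apply: (le_trans (fT _ _)); rewrite ler_wpM2l// -!exprMn.
  by rewrite lerXn2r ?nnegrE// !mulr_ge0.
have r2 : `|D2 b * (2 * l * q + q ^+ 2)| <= M * (3 * C1 ^+ 2 * h ^+ 3 * m ^+ 3).
  rewrite normrM ler_pM//.
  apply: (le_trans (ler_normD _ _)).
  have -> : 3 * C1 ^+ 2 * h ^+ 3 * m ^+ 3 =
      2 * (C1 ^+ 2 * h ^+ 3 * m ^+ 3) + C1 ^+ 2 * h ^+ 3 * m ^+ 3 by ring.
  have mm3 : m <= m ^+ 3 by rewrite exprS ler_peMr// exprn_ege1.
  apply: lerD.
    rewrite normrM [X in X * _]normrM (ger0_norm (ler0n _ 2)) -mulrA ler_wpM2l//.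
    apply: (@le_trans _ _ ((C1 * h * m) * (C1 * h ^+ 2))); first by rewrite ler_pM.
    have -> : C1 * h * m * (C1 * h ^+ 2) = C1 ^+ 2 * h ^+ 3 * m by ring.
    by rewrite ler_wpM2l// mulr_ge0 ?exprn_ge0.
  rewrite normrX; apply: (@le_trans _ _ ((C1 * h ^+ 2) ^+ 2)).
    by rewrite lerXn2r ?nnegrE// mulr_ge0 ?sqr_ge0.
  have -> : (C1 * h ^+ 2) ^+ 2 = C1 ^+ 2 * (h ^+ 4 * 1) by ring.
  rewrite -mulrA ler_wpM2l ?sqr_ge0// ler_pM ?exprn_ge0// exprn_ege1//.
apply: (le_trans (lerD r1 r2)).
have -> : M * (C1 ^+ 3 * h ^+ 3 * m ^+ 3) + M * (3 * C1 ^+ 2 * h ^+ 3 * m ^+ 3)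
  = M * (C1 ^+ 3 + 3 * C1 ^+ 2) * h ^+ 3 * m ^+ 3 by ring.
have -> : M * (C1 ^+ 3 + 3 * C1 ^+ 2) * (2 + 2 * d) ^+ 2 * h ^+ 3 * sqnorm x ^+ 2
  = M * (C1 ^+ 3 + 3 * C1 ^+ 2) * h ^+ 3 * ((2 + 2 * d) ^+ 2 * sqnorm x ^+ 2) by ring.
apply: ler_wpM2l => //.
by rewrite mulr_ge0 ?exprn_ge0// mulr_ge0// addr_ge0 ?mulr_ge0 ?exprn_ge0.
Qed.

End one_step.

Section average_step.
Variables (S : finType) (p : S -> R) (xi : S -> I -> R) (h K : R).
Hypotheses (p0 : forall z, 0 <= p z) (p1 : \sum_z p z = 1).
Hypotheses (h0 : 0 <= h) (h1 : h <= 1) (K0 : 0 <= K).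
Hypothesis xiK : forall z k, `|xi z k| <= K.
Hypothesis xi_centred : forall k, J k -> \sum_z p z * xi z k = 0.

Let stepK z k : `|step h xi z k| <= h * K.
Proof. by rewrite ffunE normrM (ger0_norm h0) ler_wpM2l. Qed.

Let avg_lin (b : I -> R) :
  \sum_z p z * (\sum_(k | J k) b k * step h xi z k) = 0.
Proof.
under eq_bigr do rewrite mulr_sumr.
rewrite exchange_big/= big1// => k Jk.
transitivity (\sum_z b k * h * (p z * xi z k)).
  by apply: eq_bigr => z _; rewrite ffunE; ring.
by rewrite -mulr_sumr xi_centred// mulr0.
Qed.

Lemma avg_sqnorm_le x : avg p (step h xi) (fun y => sqnorm y ^+ 2) x <=
  (1 + lyapunov_rate K * h ^+ 2) * sqnorm x ^+ 2.
Proof.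
apply: (@le_trans _ _ (\sum_z p z * (sqnorm x ^+ 2
   + 4 * sqnorm x * dot x (step h xi z)
   + lyapunov_rate K * h ^+ 2 * sqnorm x ^+ 2))).
  by apply: ler_sum => z _; rewrite ler_wpM2l// sqnorm_step.
under eq_bigr => z _ do rewrite addrAC mulrDr.
rewrite big_split/= -mulr_suml p1 mul1r.
under eq_bigr => z _ do rewrite mulrCA.
rewrite -mulr_sumr avg_lin mulr0 addr0 le_eqVlt; apply/orP; left.
by apply/eqP; ring.
Qed.

(** The second-order expansion of a function of the quadratic form only
    involves the mean and the covariances of the step. *)
Lemma avg_form_expansion (b1 b2 b3 : R) x (Sg : I -> I -> R) :
  (forall k l, J k -> J l -> \sum_z p z * (xi z k * xi z l) = Sg k l) ->
  \sum_z p z * (b1 + b2 * (form_cross x (step h xi z) + form_diag (step h xi z))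
                + b3 * form_cross x (step h xi z) ^+ 2) =
  b1 + b2 * (\sum_(k | J k) a k * (h ^+ 2 * Sg k k))
  + b3 * (4 * \sum_(k | J k) \sum_(l | J l) a k * x k * (a l * x l) * (h ^+ 2 * Sg k l)).
Proof.
move=> xiS.
have cov k l : J k -> J l ->
    \sum_z p z * (step h xi z k * step h xi z l) = h ^+ 2 * Sg k l.
  move=> Jk Jl; rewrite -(xiS _ _ Jk Jl) mulr_sumr; apply: eq_bigr => z _.
  by rewrite !ffunE; ring.
have e1 : \sum_z p z * form_cross x (step h xi z) = 0.
  under eq_bigr do rewrite /form_cross mulrCA.
  by rewrite -mulr_sumr avg_lin mulr0.
have e2 : \sum_z p z * form_diag (step h xi z) = \sum_(k | J k) a k * (h ^+ 2 * Sg k k).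
  under eq_bigr do rewrite /form_diag mulr_sumr.
  rewrite exchange_big/=; apply: eq_bigr => k Jk.
  by rewrite -cov// mulr_sumr; apply: eq_bigr => z _; rewrite expr2 mulrCA.
have e3 : \sum_z p z * form_cross x (step h xi z) ^+ 2 =
    4 * \sum_(k | J k) \sum_(l | J l) a k * x k * (a l * x l) * (h ^+ 2 * Sg k l).
  have -> : \sum_z p z * form_cross x (step h xi z) ^+ 2 =
    4 * \sum_z \sum_(k | J k) \sum_(l | J l)
      a k * x k * (a l * x l) * (p z * (step h xi z k * step h xi z l)).
    rewrite mulr_sumr; apply: eq_bigr => z _.
    rewrite /form_cross exprMn (_ : 2 ^+ 2 = 4 :> R); last by ring.
    rewrite (expr2 (\sum_(k | J k) _)) big_distrlr /=.
    rewrite mulrCA; congr (_ * _); rewrite mulr_sumr.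
    apply: eq_bigr => k _; rewrite mulr_sumr; apply: eq_bigr => l _; ring.
  congr (_ * _); rewrite exchange_big/=; apply: eq_bigr => k Jk.
  rewrite exchange_big/=; apply: eq_bigr => l Jl.
  by rewrite -mulr_sumr cov.
under eq_bigr => z _ do rewrite !mulrDr.
rewrite !big_split/= -mulr_suml p1 mul1r; congr (_ + _ + _).
  under [X in X + _]eq_bigr => z _ do rewrite mulrCA.
  under [X in _ + X]eq_bigr => z _ do rewrite mulrCA.
  by rewrite -!mulr_sumr e1 mulr0 add0r e2.
under eq_bigr => z _ do rewrite mulrCA.
by rewrite -mulr_sumr e3.
Qed.

Lemma avg_form_approx (A M : R) (f : R -> R) D1 D2 x : 0 <= A ->
  (forall k, `|a k| <= A) -> 0 <= M ->
  (forall b, `|D2 b| <= M) ->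
  (forall b e, `|f (b + e) - (f b + D1 b * e + D2 b * e ^+ 2)| <= M * `|e| ^+ 3) ->
  `|avg p (step h xi) (f \o diag_form) x -
    \sum_z p z * (f (diag_form x)
      + D1 (diag_form x) * (form_cross x (step h xi z) + form_diag (step h xi z))
      + D2 (diag_form x) * form_cross x (step h xi z) ^+ 2)|
  <= taylor_rate A M K * h ^+ 3 * sqnorm x ^+ 2.
Proof.
move=> A0 aA M0 D2M fT; rewrite /avg -sumrB.
apply: (le_trans (ler_norm_sum _ _ _)).
rewrite -[leRHS]mul1r -p1 mulr_suml; apply: ler_sum => z _.
rewrite -mulrBr normrM (ger0_norm (p0 z)) ler_wpM2l//.
exact: (@diag_form_step h K h0 h1 K0 _ (stepK z)).
Qed.

End average_step.

(** Two random steps with mean zero and the same covariances give, after [n]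
    steps scaled by [1 / sqrt n], nearly the same law of the quadratic form. *)
Lemma quadratic_lindeberg (S S' : finType) (p : S -> R) (q : S' -> R)
    (xi : S -> I -> R) (eta : S' -> I -> R) (Sg : I -> I -> R) (M : R) (f : R -> R) :
  (forall z, 0 <= p z) -> \sum_z p z = 1 ->
  (forall z, 0 <= q z) -> \sum_z q z = 1 ->
  (forall k, J k -> \sum_z p z * xi z k = 0) ->
  (forall k, J k -> \sum_z q z * eta z k = 0) ->
  (forall k l, J k -> J l -> \sum_z p z * (xi z k * xi z l) = Sg k l) ->
  (forall k l, J k -> J l -> \sum_z q z * (eta z k * eta z l) = Sg k l) ->
  taylor2 M f ->
  exists C : R, forall n,
    `|iter n.+1 (avg p (step (Num.sqrt n.+1%:R)^-1 xi)) (f \o diag_form) 0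
      - iter n.+1 (avg q (step (Num.sqrt n.+1%:R)^-1 eta)) (f \o diag_form) 0|
    <= C / Num.sqrt n.+1%:R.
Proof.
move=> p0 p1 q0 q1 xi0 eta0 xiS etaS fT.
have M0 := taylor2_ge0 fT; have [D1 [D2 [DM fE]]] := fT.
(* crude bounds for the steps and for the coefficients *)
pose K : R := \sum_z \sum_k `|xi z k| + \sum_z \sum_k `|eta z k|.
pose A : R := \sum_k `|a k|.
have nn (U : finType) (g : U -> I -> R) : 0 <= \sum_z \sum_k `|g z k|.
  by apply: sumr_ge0 => z _; apply: sumr_ge0.
have bound (U : finType) (g : U -> I -> R) z k : `|g z k| <= \sum_z \sum_k `|g z k|.
  rewrite (bigD1 z)//= (bigD1 k)//= -addrA lerDl addr_ge0// sumr_ge0// => i _.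
  exact: sumr_ge0.
have K0 : 0 <= K by rewrite addr_ge0.
have xiK z k : `|xi z k| <= K by rewrite (le_trans (bound _ xi z k))// lerDl.
have etaK z k : `|eta z k| <= K by rewrite (le_trans (bound _ eta z k))// lerDr.
have A0 : 0 <= A by apply: sumr_ge0.
have aA k : `|a k| <= A by rewrite /A (bigD1 k)//= lerDl sumr_ge0.
have D2M b : `|D2 b| <= M by case: (DM b).
pose T := taylor_rate A M K; pose L := lyapunov_rate K.
have T0 : 0 <= T.
  rewrite /T /taylor_rate; set c := 2 * A * K + _.
  have c_ge0 : 0 <= c by rewrite addr_ge0 ?mulr_ge0 ?sqr_ge0.
  by rewrite mulr_ge0 ?sqr_ge0// mulr_ge0// addr_ge0 ?exprn_ge0// mulr_ge0 ?sqr_ge0.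
have L0 : 0 <= L by rewrite addr_ge0 ?mulr_ge0 ?exprn_ge0.
exists (2 * T * expR L) => n; set h := (Num.sqrt n.+1%:R)^-1.
have s0 : 0 < Num.sqrt n.+1%:R :> R by rewrite sqrtr_gt0.
have h0 : 0 <= h by rewrite invr_ge0 ltW.
have h1 : h <= 1.
  by rewrite invf_le1// -[leLHS]sqrtr1 ler_wsqrtr// ler1n.
have nh : n.+1%:R * h ^+ 2 = 1.
  by rewrite exprVn sqr_sqrtr// mulfV.
pose w y := sqnorm y ^+ 2.
have := @lindeberg_swap R S S' _ p (step h xi) q (step h eta) n.+1
  (f \o diag_form) w (2 * T * h ^+ 3) (1 + L * h ^+ 2) p0 q0.
move=> /(_ _ _ _ _ _ _ 0) /=.
have -> : w 0 = 1.
  by rewrite /w /sqnorm big1 ?addr0 ?expr1n// => k _; rewrite ffunE expr0n.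
rewrite mulr1 => swap; apply: le_trans (swap _ _ _ _ _ _) _.
- by rewrite mulr_ge0 ?exprn_ge0// mulr_ge0.
- by rewrite lerDl mulr_ge0 ?exprn_ge0.
- by move=> y; exact: sqr_ge0.
- by move=> y; apply: avg_sqnorm_le.
- by move=> y; apply: avg_sqnorm_le.
- move=> y.
  have e1 := avg_form_approx p0 p1 h0 h1 K0 xiK y A0 aA M0 D2M fE.
  have e2 := avg_form_approx q0 q1 h0 h1 K0 etaK y A0 aA M0 D2M fE.
  rewrite (avg_form_expansion h p1 xi0 _ _ _ y xiS) in e1.
  rewrite (avg_form_expansion h q1 eta0 _ _ _ y etaS) in e2.
  rewrite distrC in e2.
  apply: le_trans (ler_distD _ _ _) _; apply: le_trans (lerD e1 e2) _.
  rewrite -/T /w; lra.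
(* the weight grows by a bounded factor over the [n + 1] steps *)
have rho : (1 + L * h ^+ 2) ^+ n.+1 <= expR L.
  have -> : expR L = expR (L * h ^+ 2) ^+ n.+1.
    by rewrite -expRM_natl; congr expR; rewrite mulrCA nh mulr1.
  rewrite lerXn2r ?nnegrE ?expR_ge0 ?expR_ge1Dx//.
  by rewrite addr_ge0// mulr_ge0 ?exprn_ge0.
have -> : n.+1%:R * (2 * T * h ^+ 3) = 2 * T * h * (n.+1%:R * h ^+ 2) by ring.
by rewrite nh mulr1 mulrAC ler_wpM2r// ler_wpM2l// mulr_ge0.
Qed.

End quadratic_lindeberg.

(** * Independent squared walks against chi-square variables *)

Lemma iter_avg_morph (R : realType) (S : finType) (V V' : zmodType) (p : S -> R)
    (xi : S -> V) (phi : V -> V') (g : V' -> R) n x :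
  (forall x y, phi (x + y) = phi x + phi y) ->
  iter n (avg p xi) (g \o phi) x = iter n (avg p (phi \o xi)) g (phi x).
Proof.
move=> phiD; elim: n x => // n ih x; rewrite !iterS /avg.
by apply: eq_bigr => z _; rewrite ih phiD.
Qed.

Lemma iter_avg_sum (R : realType) (S : finType) (V : zmodType) (p : S -> R)
    (xi : S -> V) (L : finType) (P : pred L) (F : L -> V -> R) n x :
  iter n (avg p xi) (fun y => \sum_(l | P l) F l y) x =
  \sum_(l | P l) iter n (avg p xi) (F l) x.
Proof.
elim: n x => // n ih x; rewrite iterS /avg.
under eq_bigr do rewrite ih mulr_sumr.
by rewrite exchange_big.
Qed.

Section cells.
Context {R : realType}.
Implicit Types (d c : R) (K : nat).

(** The index of the cell of mesh [d] that contains [c], cells beyond [K] being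
    merged: counting thresholds makes it total and measurable. *)
Definition cell d K c : nat := (\sum_(j < K) (j.+1%:R * d < c)%R)%N.

Lemma cellS d K c : cell d K.+1 c = (cell d K c + (K.+1%:R * d < c)%R)%N.
Proof. by rewrite /cell big_ord_recr. Qed.

Lemma cell_le d K c : (cell d K c <= K)%N.
Proof.
rewrite /cell -[leqRHS](card_ord K) -sum1_card.
by apply: leq_sum => j _; exact: leq_b1.
Qed.

Lemma lt_cell d K c j : 0 <= d -> (j < K)%N ->
  (j < cell d K c)%N = (j.+1%:R * d < c).
Proof.
move=> d0; elim: K => // K ih; rewrite ltnS cellS leq_eqVlt.
case: (ltP (K.+1%:R * d) c) => dc.
  have full m : (m <= K)%N -> cell d m c = m.
    elim: m => [|m ihm] mK; first by rewrite /cell big_ord0.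
    rewrite cellS; have -> : m.+1%:R * d < c.
      by rewrite (le_lt_trans _ dc)// ler_wpM2r// ler_nat ltnW.
    by rewrite ihm ?(ltnW mK)// addn1.
  rewrite full// addn1 => jK.
  have jK' : (j <= K)%N by case/orP: jK => [/eqP->|/ltnW].
  by rewrite ltnS jK' (le_lt_trans _ dc)// ler_wpM2r// ler_nat.
rewrite addn0 => /orP[/eqP->|]; last exact: ih.
by rewrite ltnNge cell_le ltNge dc.
Qed.

Lemma cell_approx d K c : 0 < d -> 0 <= c <= K.+1%:R * d ->
  `|c - (cell d K c)%:R * d| <= d.
Proof.
move=> d0 /andP[c0 cK]; set m := cell d K c.
have mc : m%:R * d <= c.
  have [->|m0] := posnP m; first by rewrite mul0r.
  rewrite -(prednK m0) ltW// -(@lt_cell d K) ?(ltW d0)// ?prednK//.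
  exact: leq_trans (cell_le d K c).
have cm : c <= m.+1%:R * d.
  rewrite leNgt; apply/negP => mc'.
  have [mK|mK] := ltnP m K.
    by rewrite -(@lt_cell d K) ?(ltW d0)// ltnn in mc'.
  have mKE : m = K by apply/eqP; rewrite eqn_leq mK cell_le.
  by rewrite mKE ltNge cK in mc'.
rewrite ler_norml; rewrite -natr1 mulrDl mul1r in cm; apply/andP; split; lra.
Qed.

End cells.

Section independent_walks.
Context {R : realType} {I : finType}.

Definition signs_weight (s : {ffun I -> bool}) : R := \prod_k coin (s k).
Definition signs (s : {ffun I -> bool}) (k : I) : R := sign_step (s k).

Definition walks_mean n (g : {ffun I -> R} -> R) : R :=
  iter n (avg signs_weight (step (Num.sqrt n%:R)^-1 signs)) g 0.

Lemma signs_weight_ge0 s : 0 <= signs_weight s.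
Proof. by apply: prodr_ge0 => k _; exact: coin_ge0. Qed.

(** The signs of the coordinates are independent. *)
Lemma signs_sum (F : I -> bool -> R) :
  \sum_s signs_weight s * \prod_k F k (s k) = \prod_k \sum_b coin b * F k b.
Proof.
rewrite bigA_distr_bigA /=; apply: eq_bigr => s _.
by rewrite -big_split.
Qed.

Lemma signs_weight_sum : \sum_s signs_weight s = 1.
Proof.
transitivity (\sum_s signs_weight s * \prod_(k : I) (1 : R)).
  by apply: eq_bigr => s _; rewrite big1_eq mulr1.
rewrite (signs_sum (fun _ _ => 1)) big1// => k _.
by under eq_bigr do rewrite mulr1; exact: coin_sum.
Qed.

Lemma signs_centred k : \sum_s signs_weight s * signs s k = 0.
Proof.
transitivity (\sum_s signs_weight s *
    \prod_l (if l == k then sign_step (s l) else 1)).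
  apply: eq_bigr => s _; congr (_ * _).
  by rewrite (bigD1 k)//= eqxx big1 ?mulr1// => l /negbTE ->.
rewrite (signs_sum (fun l b => if l == k then sign_step b else 1)) (bigD1 k)//= eqxx.
rewrite big_bool /= /coin /sign_step expr1 expr0 mulrN1 mulr1 addNr mul0r.
by [].
Qed.

Lemma signs_cov k l :
  \sum_s signs_weight s * (signs s k * signs s l) = (k == l)%:R.
Proof.
have [->|kl] := eqVneq k l.
  under eq_bigr do rewrite /signs /sign_step -expr2 sqrr_sign mulr1.
  exact: signs_weight_sum.
transitivity (\sum_s signs_weight s *
    \prod_m ((if m == k then sign_step (s m) else 1) * (if m == l then sign_step (s m) else 1))).
  apply: eq_bigr => s _; congr (_ * _); rewrite big_split /=.
  rewrite (bigD1 k)//= eqxx big1 ?mulr1; last by move=> m /negbTE ->.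
  by rewrite [X in _ = _ * X](bigD1 l)//= eqxx big1 ?mulr1// => m /negbTE ->.
rewrite (signs_sum (fun m b => (if m == k then sign_step b else 1) *
  (if m == l then sign_step b else 1))).
rewrite (bigD1 k)//= eqxx (negbTE kl).
by rewrite big_bool /= /coin /sign_step expr1 expr0 !mulr1 mulrN1 addNr mul0r.
Qed.

Lemma walks_mean_le n g f : (forall x, g x <= f x) -> walks_mean n g <= walks_mean n f.
Proof. by move=> gf; apply: iter_avg_le => // s; exact: signs_weight_ge0. Qed.

Lemma walks_meanD n g f :
  walks_mean n (fun x => g x + f x) = walks_mean n g + walks_mean n f.
Proof.
have -> : (fun x => g x + f x) = g \- (fun x => -1 * f x).
  by apply/funext => x /=; rewrite mulN1r opprK.
by rewrite /walks_mean iter_avgB iter_avgZ /= mulN1r opprK.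
Qed.

Lemma walks_mean_sum n (L : finType) (P : pred L) (F : L -> {ffun I -> R} -> R) :
  walks_mean n (fun x => \sum_(l | P l) F l x) = \sum_(l | P l) walks_mean n (F l).
Proof. exact: iter_avg_sum. Qed.

(** Independence of the coordinates: averaging over the signs acts on a product
    function factor by factor. *)
Lemma walks_mean_prod n (g : I -> R -> R) :
  walks_mean n (fun x => \prod_k g k (x k)) = \prod_k scaled_walk_mean n (g k).
Proof.
rewrite /walks_mean; set h := (Num.sqrt n%:R)^-1.
have key m x : iter m (avg signs_weight (step h signs)) (fun x => \prod_k g k (x k)) x
   = \prod_k iter m (avg coin (fun b => h * sign_step b)) (g k) (x k).
  elim: m x => // m ih x; rewrite iterS /avg.
  apply: etrans (eq_bigr _ (fun s _ => congr1 ( *%R (signs_weight s)) (ih _))) _.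
  under [RHS]eq_bigr do rewrite iterS /avg.
  rewrite -(signs_sum (fun k b => iter m (avg coin (fun b => h * sign_step b)) (g k)
    (x k + h * sign_step b))).
  by apply: eq_bigr => s _; congr (_ * _); apply: eq_bigr => k _; rewrite !ffunE.
rewrite key; apply: eq_bigr => k _; rewrite /scaled_walk_mean -/h ffunE.
have := @iter_avg_morph R bool R R coin sign_step ( *%R h) (g k) n 0 (mulrDr h).
by rewrite mulr0 => ->.
Qed.

Lemma walks_mean1 n (g : R -> R) k :
  walks_mean n (fun x => g (x k)) = scaled_walk_mean n g.
Proof.
have := walks_mean_prod n (fun l => if l == k then g else fun=> 1).
rewrite (bigD1 k)//= eqxx big1 ?mulr1; last first.
  move=> l /negbTE ->; rewrite /scaled_walk_mean iter_avg_cst//; exact: coin_sum.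
move=> <-; congr walks_mean; apply/funext => x.
by rewrite (bigD1 k)//= eqxx big1 ?mulr1// => l /negbTE ->.
Qed.

End independent_walks.

Section finite_events.
Context d (T : measurableType d) (R : realType) (P : probability T R).

Lemma fine_probability_sum (L : finType) (B : pred L) (E : L -> set T) :
  (forall l, measurable (E l)) -> trivIset setT E ->
  fine (P (\bigcup_(l in [set l | B l]) E l)) = \sum_(l | B l) fine (P (E l)).
Proof.
move=> mE tE.
rewrite measure_fin_bigcup//; last 2 first.
- exact: finite_finset.
- by apply: sub_trivIset tE.
rewrite -(@bigfs _ _ _ _ (index_enum L) B) ?index_enum_uniq//; last first.
  by move=> l _; rewrite mem_index_enum.
have fP A : measurable A -> P A \is a fin_num by move=> mA; exact: fin_num_measure.
rewrite -[RHS]/(fine (\sum_(l | B l) fine (P (E l)))%:E) -sumEFin; congr fine.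
by apply: eq_bigr => l _; rewrite fineK// fP.
Qed.

Lemma fine_probability_le (A B : set T) : measurable A -> measurable B ->
  A `<=` B -> fine (P A) <= fine (P B).
Proof.
move=> mA mB AB; apply: fine_le; rewrite ?fin_num_measure//.
by apply: le_measure => //; rewrite inE.
Qed.

Lemma fine_probability_subadd (A B D : set T) :
  measurable A -> measurable B -> measurable D ->
  A `<=` B `|` D -> fine (P A) <= fine (P B) + fine (P D).
Proof.
move=> mA mB mD AB; rewrite -fineD ?fin_num_measure//.
apply: fine_le; rewrite ?fin_numD ?fin_num_measure//.
apply: le_trans (measureU2 _ mB mD).
by apply: le_measure => //; rewrite ?inE//; exact: measurableU.
Qed.

Lemma mutually_independent_finType d' (U : measurableType d') (I : finType)
    (Z : I -> {RV P >-> U}) (A : I -> set U) :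
  mutually_independent P Z -> (forall i, measurable (A i)) ->
  fine (P (\bigcap_i (Z i @^-1` A i))) = \prod_i fine (P (Z i @^-1` A i)).
Proof.
move=> indZ mA; pose J := [fset i in enum I]%fset.
have JT : [set` J] = [set: I].
  by apply/seteqP; split => // i _ /=; rewrite inE mem_enum.
have := indZ J A mA; rewrite JT => ->.
have -> : (\prod_(i <- J) P (Z i @^-1` A i) = \prod_i P (Z i @^-1` A i))%E.
  apply: perm_big; apply: uniq_perm; rewrite ?index_enum_uniq ?fset_uniq// => i.
  by rewrite mem_index_enum inE mem_enum.
have fP i : P (Z i @^-1` A i) = (fine (P (Z i @^-1` A i)))%:E.
  by rewrite fineK// fin_num_measure//; apply: measurable_funPTI.
by rewrite (eq_bigr _ (fun i _ => fP i)) -(big_morph EFin (@EFinM R) erefl).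
Qed.

End finite_events.

Section chi_square.
Context d' (T' : measurableType d') (R : realType) (P' : probability T' R).
Context (I : finType) (C : I -> {RV P' >-> R}).
Hypothesis C_indep : mutually_independent P' C.
Hypothesis C_law : forall i (A : set R), measurable A ->
  distribution P' (C i) A = chi_square1 A.

Lemma measurable_gt (t : R) : measurable [set c : R | t < c].
Proof. by rewrite -[X in measurable X]set_itv_o_infty. Qed.

Lemma chi_square_tail i (t : R) :
  fine (P' (C i @^-1` [set c | t < c])) =
  fine (normal_prob (0 : R) 1 [set y | t < y ^+ 2]).
Proof. by rewrite -[P' _]/(distribution P' (C i) _) C_law//; exact: measurable_gt. Qed.

Lemma scaled_walk_chi_square_tail i (t : R) : 0 <= t ->
  scaled_walk_mean n (fun x => (t < x ^+ 2)%R%:R) @[n --> \oo] -->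
  fine (P' (C i @^-1` [set c | t < c])).
Proof. by move=> t0; rewrite chi_square_tail; exact: scaled_walk_sqr_gt. Qed.

Lemma chi_square_ge0 i : fine (P' (C i @^-1` [set c | c < 0])) = 0.
Proof.
rewrite -[P' _]/(distribution P' (C i) _) C_law; last first.
  by rewrite -[X in measurable X]set_itv_infty_o.
rewrite /chi_square1 /pushforward (_ : _ @^-1` _ = set0) ?measure0//.
by apply/seteqP; split => // y /=; rewrite ltNge sqr_ge0.
Qed.

(** Markov's inequality for the square of a Gaussian variable. *)
Lemma chi_square_tail_le i (t : R) : 0 < t ->
  fine (P' (C i @^-1` [set c | t < c])) <= t^-1.
Proof.
move=> t0; rewrite chi_square_tail.
have mA : measurable [set y : R | t < y ^+ 2].
  have mf : measurable_fun setT (fun y : R => y ^+ 2) by exact: measurable_funX.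
  by have := mf measurableT _ (measurable_gt t); rewrite setTI.
have -> : t^-1 = gauss_mean 1 (fun y : R => t^-1 * y ^+ 2).
  by rewrite gauss_meanZ ?gauss_mean_sqr ?mulr1//; exact: gauss_integrable_sqr.
rewrite -gauss_mean_indic//.
apply: gauss_mean_le.
- exact: gauss_integrable_indic.
- by apply: gauss_integrableZ; exact: gauss_integrable_sqr.
move=> y; rewrite indicE; case: (boolP (_ \in _)) => [|_]; last first.
  by rewrite mulr_ge0 ?sqr_ge0// invr_ge0 ltW.
by rewrite inE /= => ty; rewrite ler_pdivlMl// mulr1 ltW.
Qed.

End chi_square.

Lemma fine_probability_subadd_sum d (T : measurableType d) (R : realType)
    (P : probability T R) (L : finType) (A B : set T) (D : L -> set T) :
  measurable A -> measurable B -> (forall l, measurable (D l)) ->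
  A `<=` B `|` \bigcup_l D l -> fine (P A) <= fine (P B) + \sum_l fine (P (D l)).
Proof.
move=> mA mB mD AB.
pose U := \big[setU/set0]_l D l.
have UE : \bigcup_l D l = U.
  rewrite /U -bigcup_seq; congr bigcup.
  by apply/seteqP; split => l //= _; rewrite mem_index_enum.
have mU : measurable U by exact: bigsetU_measurable.
rewrite UE in AB; apply: le_trans (fine_probability_subadd P mA mB mU AB) _.
rewrite lerD2l /U.
have : measurable (\big[setU/set0]_l D l) /\
   fine (P (\big[setU/set0]_l D l)) <= \sum_l fine (P (D l)).
  apply: (@big_rec2 _ _ (fun x y => measurable x /\ fine (P x) <= y)).
    by split => //; rewrite measure0.
  move=> l x V _ [mV Vx]; split; first exact: measurableU.
  apply: le_trans (fine_probability_subadd P _ (mD l) mV (@subset_refl _ _)) _.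
    exact: measurableU.
  by rewrite lerD2l.
by case.
Qed.

Section chi_square_cells.
Context d' (T' : measurableType d') (R : realType) (P' : probability T' R).
Context (I : finType) (C : I -> {RV P' >-> R}).
Hypothesis C_indep : mutually_independent P' C.
Hypothesis C_law : forall i (A : set R), measurable A ->
  distribution P' (C i) A = chi_square1 A.
Variables (mesh : R) (K : nat).
Hypothesis mesh_gt0 : 0 < mesh.

Local Notation kappa := (cell mesh K).
(* these sets are half-lines, or empty, or full, so that convergence is known for
   them; the cells are their differences *)
Let above j : set R := [set c | (j <= kappa c)%N].

Let aboveE j : above j = if j is j'.+1 then
    if (j' < K)%N then [set c | j'.+1%:R * mesh < c] else set0 else setT.
Proof.
rewrite /above; case: j => [|j]; first by apply/seteqP.
have m0 := ltW mesh_gt0.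
case: ltnP => jK; first by apply/seteqP; split => c /=; rewrite lt_cell.
by apply/seteqP; split => c //=; rewrite ltnNge (leq_trans (cell_le _ _ _) jK).
Qed.

Let measurable_above j : measurable (above j).
Proof.
rewrite aboveE; case: j => // j; case: ifP => // _; exact: measurable_gt.
Qed.

Let cvg_above i j :
  scaled_walk_mean n (fun x => (j <= kappa (x ^+ 2))%N%:R) @[n --> \oo] -->
  fine (P' (C i @^-1` above j)).
Proof.
have cst c : (fun n => scaled_walk_mean n (fun=> c)) = fun=> c :> R.
  by apply/funext => n; rewrite /scaled_walk_mean iter_avg_cst//; exact: coin_sum.
rewrite aboveE; case: j => [|j].
  by rewrite cst preimage_setT probability_setT; exact: cvg_cst.
case: ltnP => jK.
  under eq_fun do under eq_fun do rewrite lt_cell ?(ltW mesh_gt0)//.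
  by apply: scaled_walk_chi_square_tail => //; rewrite mulr_ge0// ltW.
under eq_fun do under eq_fun do rewrite ltnNge (leq_trans (cell_le _ _ _) jK).
by rewrite cst preimage_set0 measure0; exact: cvg_cst.
Qed.

Let at_cell m : set R := [set c | kappa c = m].

Let at_cellE m : at_cell m = above m `\` above m.+1.
Proof.
apply/seteqP; split => c /=; rewrite /above/=.
  by move=> ->; split => //; rewrite ltnn.
by move=> [mk /negP]; rewrite -leqNgt => km; apply/eqP; rewrite eqn_leq km mk.
Qed.

Let measurable_at_cell m : measurable (at_cell m).
Proof. by rewrite at_cellE; exact: measurableD. Qed.

Let cvg_at_cell i m :
  scaled_walk_mean n (fun x => (kappa (x ^+ 2) == m)%:R) @[n --> \oo] -->
  fine (P' (C i @^-1` at_cell m)).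
Proof.
have -> : fine (P' (C i @^-1` at_cell m)) =
   fine (P' (C i @^-1` above m)) - fine (P' (C i @^-1` above m.+1)).
  have mC j : measurable (C i @^-1` above j) by exact: measurable_funPTI.
  rewrite at_cellE -[C i @^-1` (above m `\` _)]/(C i @^-1` above m `\` C i @^-1` above m.+1).
  rewrite measureD//; last by rewrite -ge0_fin_numE// fin_num_measure.
  rewrite setIidr; last by move=> w /=; rewrite /above/=; exact: ltnW.
  by rewrite fineB// fin_num_measure.
have -> : (fun n => scaled_walk_mean n (fun x : R => (kappa (x ^+ 2) == m)%:R)) =
    (fun n => scaled_walk_mean n (fun x : R => (m <= kappa (x ^+ 2))%N%:R) -
              scaled_walk_mean n (fun x : R => (m.+1 <= kappa (x ^+ 2))%N%:R)).
  apply/funext => n; rewrite /scaled_walk_mean /walk_avg.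
  rewrite (_ : (fun x => _) = (fun x : R => (m <= kappa (((Num.sqrt n%:R)^-1 * x) ^+ 2))%N%:R)
      \- (fun x : R => (m.+1 <= kappa (((Num.sqrt n%:R)^-1 * x) ^+ 2))%N%:R)); last first.
    by apply/funext => x /=; case: ltngtP; rewrite ?subrr ?subr0.
  by rewrite iter_avgB.
by apply: cvgB; exact: cvg_above.
Qed.

Definition cells (c : I -> R) : {ffun I -> 'I_K.+1} := [ffun i => inord (kappa (c i))].

Lemma cells_eqE c (f : {ffun I -> 'I_K.+1}) :
  (cells c == f) = [forall i, kappa (c i) == f i].
Proof.
apply/eqP/forallP => [<- i|h].
  by rewrite ffunE inordK// ltnS cell_le.
apply/ffunP => i; rewrite ffunE; apply: val_inj; rewrite /= inordK ?ltnS ?cell_le//.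
exact/eqP.
Qed.

Let event (f : {ffun I -> 'I_K.+1}) : set T' := \bigcap_i (C i @^-1` at_cell (f i)).

Let eventE f : event f = [set w | cells (C ^~ w) = f].
Proof.
apply/seteqP; split => w /=; rewrite /event /=.
  by move=> h; apply/eqP; rewrite cells_eqE; apply/forallP => i; apply/eqP; exact: h.
by move=> /eqP; rewrite cells_eqE => /forallP h i _; exact/eqP.
Qed.

Let measurable_event f : measurable (event f).
Proof.
apply: fin_bigcap_measurable; first exact: finite_finset.
by move=> i _; exact: measurable_funPTI.
Qed.

Let cells_events (B : pred {ffun I -> 'I_K.+1}) :
  [set w | B (cells (C ^~ w))] = \bigcup_(f in [set f | B f]) event f.
Proof.
apply/seteqP; split => w /=.
  by move=> Bw; exists (cells (C ^~ w)) => //; rewrite eventE.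
by move=> [f Bf]; rewrite eventE /= => ->.
Qed.

Lemma measurable_cells (B : pred {ffun I -> 'I_K.+1}) :
  measurable [set w | B (cells (C ^~ w))].
Proof.
rewrite cells_events; apply: fin_bigcup_measurable => //; exact: finite_finset.
Qed.

(** The cell of each coordinate is a finitely valued variable, so convergence
    of the joint law of the cells amounts to that of each marginal. *)
Lemma walks_mean_cells (B : pred {ffun I -> 'I_K.+1}) :
  walks_mean n (fun x => (B (cells (fun i => x i ^+ 2)))%:R) @[n --> \oo] -->
  fine (P' [set w | B (cells (C ^~ w))]).
Proof.
rewrite cells_events fine_probability_sum//; last first.
  by move=> f g _ _ [w []]; rewrite !eventE /= => -> ->.
have -> : (fun n => walks_mean n (fun x => (B (cells (fun i => x i ^+ 2)))%:R)) =
  (fun n => \sum_(f | B f) \prod_i scaled_walk_mean n (fun x => (kappa (x ^+ 2) == f i)%:R)).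
  apply/funext => n; under [RHS]eq_bigr do rewrite -walks_mean_prod.
  rewrite -walks_mean_sum; congr walks_mean; apply/funext => x.
  rewrite (bigID (pred1 (cells (fun i => x i ^+ 2))))/=.
  rewrite [X in _ + X]big1 ?addr0; last first.
    move=> f /andP[_]; rewrite eq_sym cells_eqE negb_forall => /existsP[i fi].
    by rewrite (bigD1 i)//= (negbTE fi) mul0r.
  rewrite big_mkcondl /= big_pred1_eq; case: ifP => //= _.
  rewrite big1// => i _; have := eqxx (cells (fun i => x i ^+ 2)).
  by rewrite {1}cells_eqE => /forallP/(_ i) ->.
apply: cvg_big => [|f _]; first exact: add_continuous.
rewrite mutually_independent_finType//.
by apply: cvg_big => [|i _]; [exact: mul_continuous|exact: cvg_at_cell].
Qed.

End chi_square_cells.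

Section chi_square_form.
Context d' (T' : measurableType d') (R : realType) (P' : probability T' R).
Context (I : finType) (C : I -> {RV P' >-> R}).
Hypothesis C_indep : mutually_independent P' C.
Hypothesis C_law : forall i (A : set R), measurable A ->
  distribution P' (C i) A = chi_square1 A.
Variables (J : pred I) (a : I -> R) (c0 : R).

Definition lin_form (c : I -> R) : R := c0 + \sum_(k | J k) a k * c k.

Lemma measurable_lin_form_le (t : R) :
  measurable [set w | lin_form (C ^~ w) <= t].
Proof.
have mf : measurable_fun setT (fun w => lin_form (C ^~ w)).
  apply: measurable_funD => //; rewrite /lin_form.
  rewrite (_ : (fun w => _) = fun w => \sum_k if J k then a k * C k w else 0).
    apply: measurable_sum => k; case: (J k) => //.
    exact: measurable_funM.
  by apply/funext => w; rewrite big_mkcond.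
have := mf measurableT _ (measurable_itv `]-oo, t]); rewrite setTI.
by congr measurable; apply/seteqP; split => w /=; rewrite in_itv.
Qed.

Variables t1 t2 : R.
Hypothesis t12 : t1 < t2.
Let A : R := \sum_k `|a k|.
(* rounding all coordinates within [mesh] moves the form by at most
   [(t2 - t1) / 2]; adding 1 keeps the denominator positive *)
Let mesh : R := (t2 - t1) / (2 * (A + 1)).
Variable K : nat.
(* beyond [top] the cells are merged *)
Let top : R := K.+1%:R * mesh.
Let mid : R := (t1 + t2) / 2.

Let A0 : 0 <= A. Proof. exact: sumr_ge0. Qed.

Let mesh0 : 0 < mesh.
Proof. by rewrite divr_gt0 ?subr_gt0// mulr_gt0// ltr_wpDl. Qed.

Let round (c : I -> R) : {ffun I -> 'I_K.+1} := cells mesh K c.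
Let below_mid (f : {ffun I -> 'I_K.+1}) : bool :=
  lin_form (fun k => (f k)%:R * mesh) <= mid.

Let lin_form_round c : (forall k, 0 <= c k <= top) ->
  `|lin_form c - lin_form (fun k => (round c k)%:R * mesh)| <= (t2 - t1) / 2.
Proof.
move=> ct; rewrite /lin_form opprD addrACA subrr add0r -sumrB.
apply: (le_trans (ler_norm_sum _ _ _)).
apply: (@le_trans _ _ (\sum_(k | J k) `|a k| * mesh)).
  apply: ler_sum => k _; rewrite -mulrBr normrM ler_wpM2l//.
  by rewrite ffunE inordK ?ltnS ?cell_le// cell_approx.
rewrite -mulr_suml; apply: (@le_trans _ _ (A * mesh)).
  rewrite ler_wpM2r ?(ltW mesh0)// /A [leLHS]big_mkcond; apply: ler_sum => k _.
  by case: ifP.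
have -> : (t2 - t1) / 2 = (A + 1) * mesh.
  by rewrite /mesh; field; rewrite gt_eqF// ltr_wpDl.
by rewrite ler_wpM2r ?(ltW mesh0)// lerDl.
Qed.

Let round_upper c : (forall k, 0 <= c k <= top) -> lin_form c <= t1 ->
  below_mid (round c).
Proof.
move=> /lin_form_round; rewrite ler_norml => /andP[h1 h2] ct; rewrite /below_mid /mid.
lra.
Qed.

Let round_lower c : (forall k, 0 <= c k <= top) -> below_mid (round c) ->
  lin_form c <= t2.
Proof.
move=> /lin_form_round; rewrite ler_norml => /andP[h1 h2]; rewrite /below_mid /mid.
lra.
Qed.

Let top0 : 0 < top. Proof. by rewrite mulr_gt0. Qed.

Let tailP (k : I) : fine (P' (C k @^-1` [set c | top < c])) <= top^-1.
Proof. exact: chi_square_tail_le. Qed.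

Let out (k : I * bool) : set T' :=
  if k.2 then C k.1 @^-1` [set c | top < c] else C k.1 @^-1` [set c | c < 0].

Let measurable_out k : measurable (out k).
Proof.
case: k => k [] /=; apply: measurable_funPTI; first exact: measurable_gt.
by rewrite -[X in measurable X]set_itv_infty_o.
Qed.

Let out_sum : \sum_k fine (P' (out k)) <= #|I|%:R / top.
Proof.
rewrite -(pair_bigA _ (fun k b => fine (P' (out (k, b)))))/=.
apply: (@le_trans _ _ (\sum_(k : I) top^-1)); last by rewrite sumr_const mulr_natl.
apply: ler_sum => k _; rewrite big_bool /= /out /= (chi_square_ge0 C_law) addr0.
exact: tailP.
Qed.

Let in_box w : ~ (\bigcup_k out k) w -> forall k, 0 <= C k w <= top.
Proof.
move=> nout k; apply/andP; split; rewrite leNgt; apply/negP => h; apply: nout.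
  by exists (k, false).
by exists (k, true).
Qed.

(** Rounding carries the threshold [mid] at most to [t2], and [t1] at most to
    [mid], unless a coordinate leaves the range of the cells. *)
Lemma chi_square_mid_le :
  fine (P' [set w | below_mid (round (C ^~ w))]) <=
  fine (P' [set w | lin_form (C ^~ w) <= t2]) + #|I|%:R / top.
Proof.
apply: (@le_trans _ _ (fine (P' [set w | lin_form (C ^~ w) <= t2]) + \sum_k fine (P' (out k)))).
  apply: fine_probability_subadd_sum => //.
  - exact: measurable_cells.
  - exact: measurable_lin_form_le.
  - move=> w /= Bw; have [?|/in_box bw] := pselect ((\bigcup_k out k) w); first by right.
    by left; apply: round_lower Bw.
by rewrite lerD2l out_sum.
Qed.

Lemma chi_square_mid_ge :
  fine (P' [set w | lin_form (C ^~ w) <= t1]) <=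
  fine (P' [set w | below_mid (round (C ^~ w))]) + #|I|%:R / top.
Proof.
apply: (@le_trans _ _ (fine (P' [set w | below_mid (round (C ^~ w))]) + \sum_k fine (P' (out k)))).
  apply: fine_probability_subadd_sum => //.
  - exact: measurable_lin_form_le.
  - exact: measurable_cells.
  - move=> w /= Bw; have [?|/in_box bw] := pselect ((\bigcup_k out k) w); first by right.
    by left; apply: round_upper Bw.
by rewrite lerD2l out_sum.
Qed.

Let walk_tail n : R := \sum_k walks_mean n (fun x : {ffun I -> R} => (top < x k ^+ 2)%R%:R).

Let walk_tail_cvg : exists2 l, walk_tail n @[n --> \oo] --> l & l <= #|I|%:R / top.
Proof.
exists (\sum_k fine (P' (C k @^-1` [set c | top < c]))).
  apply: cvg_big => [|k _]; first exact: add_continuous.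
  have -> : (fun n => walks_mean n (fun x : {ffun I -> R} => (top < x k ^+ 2)%R%:R)) =
    (fun n => scaled_walk_mean n (fun x : R => (top < x ^+ 2)%R%:R)) :> (nat -> R).
    by apply/funext => n; rewrite -(walks_mean1 _ _ k).
  by apply: scaled_walk_chi_square_tail => //; exact: ltW.
apply: (@le_trans _ _ (\sum_(k : I) top^-1)); last by rewrite sumr_const mulr_natl.
by apply: ler_sum => k _; exact: tailP.
Qed.

Let walk_below_mid (x : {ffun I -> R}) : bool := below_mid (round (fun i => x i ^+ 2)).

Let indicator_le (b1 b2 : bool) (x : {ffun I -> R}) :
  ((forall k, 0 <= x k ^+ 2 <= top) -> b1 -> b2) ->
  b1%:R <= b2%:R + \sum_k (top < x k ^+ 2)%R%:R :> R.
Proof.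
move=> h; have s0 : 0 <= \sum_k (top < x k ^+ 2)%R%:R :> R by apply: sumr_ge0.
case: b1 h => h; last by rewrite addr_ge0.
have [/forallP all|] := boolP [forall k, x k ^+ 2 <= top].
  by rewrite h ?lerDl// => k; rewrite sqr_ge0 all.
rewrite negb_forall => /existsP[k kt]; rewrite (bigD1 k)//= ltNge kt /=.
by rewrite addrCA lerDl addr_ge0// sumr_ge0.
Qed.

Let walks_sum n (b1 b2 : {ffun I -> R} -> bool) :
  (forall x, (b1 x)%:R <= (b2 x)%:R + \sum_k (top < x k ^+ 2)%R%:R :> R) ->
  walks_mean n (fun x => (b1 x)%:R) <= walks_mean n (fun x => (b2 x)%:R) + walk_tail n.
Proof.
move=> h; rewrite /walk_tail -walks_mean_sum -walks_meanD.
exact: walks_mean_le.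
Qed.

(** The rounded variables take finitely many values, so that their laws
    converge; rounding costs a shift of the threshold and two tails, one for the
    walks and one for the limit. *)
Lemma walks_form_le (e : R) : 0 < e -> \forall n \near \oo,
  walks_mean n (fun x => (diag_form J a c0 x <= t1)%R%:R) <=
  fine (P' [set w | lin_form (C ^~ w) <= t2]) + 2 * (#|I|%:R / top) + e.
Proof.
move=> e0; have [l /cvgrPdist_le/(_ _ (divr_gt0 e0 (ltr0n R 2))) cl lt] := walk_tail_cvg.
have /cvgrPdist_le/(_ _ (divr_gt0 e0 (ltr0n R 2))) cm :=
  @walks_mean_cells _ _ _ _ _ _ C_indep C_law _ K mesh0 below_mid.
near=> n.
have h1 : `|l - walk_tail n| <= e / 2 by near: n.
have h2 : `|fine (P' [set w | below_mid (round (C ^~ w))]) -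
   walks_mean n (fun x => (walk_below_mid x)%:R)| <= e / 2 by near: n.
have h3 := @walks_sum n (fun x => diag_form J a c0 x <= t1)
  walk_below_mid
  (fun x => @indicator_le _ _ x (@round_upper (fun k => x k ^+ 2))).
have h4 := chi_square_mid_le.
move: h1 h2; rewrite !ler_norml => /andP[? ?] /andP[? ?].
lra.
Unshelve. all: by end_near. Qed.

Lemma walks_form_ge (e : R) : 0 < e -> \forall n \near \oo,
  fine (P' [set w | lin_form (C ^~ w) <= t1]) - 2 * (#|I|%:R / top) - e <=
  walks_mean n (fun x => (diag_form J a c0 x <= t2)%R%:R).
Proof.
move=> e0; have [l /cvgrPdist_le/(_ _ (divr_gt0 e0 (ltr0n R 2))) cl lt] := walk_tail_cvg.
have /cvgrPdist_le/(_ _ (divr_gt0 e0 (ltr0n R 2))) cm :=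
  @walks_mean_cells _ _ _ _ _ _ C_indep C_law _ K mesh0 below_mid.
near=> n.
have h1 : `|l - walk_tail n| <= e / 2 by near: n.
have h2 : `|fine (P' [set w | below_mid (round (C ^~ w))]) -
   walks_mean n (fun x => (walk_below_mid x)%:R)| <= e / 2 by near: n.
have h3 := @walks_sum n walk_below_mid
  (fun x => diag_form J a c0 x <= t2)
  (fun x => @indicator_le _ _ x (@round_lower (fun k => x k ^+ 2))).
have h4 := chi_square_mid_ge.
move: h1 h2; rewrite !ler_norml => /andP[? ?] /andP[? ?].
lra.
Unshelve. all: by end_near. Qed.

End chi_square_form.

Section chi_square_limit.
Context d' (T' : measurableType d') (R : realType) (P' : probability T' R).
Context (I : finType) (C : I -> {RV P' >-> R}).
Hypothesis C_indep : mutually_independent P' C.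
Hypothesis C_law : forall i (A : set R), measurable A ->
  distribution P' (C i) A = chi_square1 A.
Variables (J : pred I) (a : I -> R) (c0 t1 t2 : R).
Hypothesis t12 : t1 < t2.

Let small_tail (e : R) : 0 < e -> exists K : nat,
  2 * (#|I|%:R / (K.+1%:R * ((t2 - t1) / (2 * (\sum_k `|a k| + 1))))) <= e.
Proof.
move=> e0; set m := _ / (2 * _).
have m0 : 0 < m.
  by rewrite divr_gt0 ?subr_gt0// mulr_gt0// ltr_wpDl// sumr_ge0.
pose x := 2 * #|I|%:R / (e * m) : R.
have em0 : 0 < e * m by exact: mulr_gt0.
have x0 : 0 <= x by rewrite divr_ge0 ?(ltW em0)// mulr_ge0.
exists (Num.bound x); clearbody m; rewrite mulrA ler_pdivrMr; last exact: mulr_gt0.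
have -> : 2 * #|I|%:R = x * (e * m).
  by rewrite /x divfK// gt_eqF.
rewrite mulrCA ler_wpM2l ?(ltW e0)// ler_wpM2r ?(ltW m0)//.
rewrite (le_trans (ltW (archi_boundP x0)))// ler_nat.
by [].
Qed.

(** Independent Rademacher walks, squared, against independent chi-square
    variables: laws of linear forms, up to an arbitrarily small shift. *)
Lemma walks_chi_square_le (e : R) : 0 < e -> \forall n \near \oo,
  walks_mean n (fun x => (diag_form J a c0 x <= t1)%R%:R) <=
  fine (P' [set w | lin_form J a c0 (C ^~ w) <= t2]) + e.
Proof.
move=> e0; have e2 : 0 < e / 2 by rewrite divr_gt0.
have [K hK] := small_tail e2.
near=> n.
have : walks_mean n (fun x => (diag_form J a c0 x <= t1)%R%:R) <=
  fine (P' [set w | lin_form J a c0 (C ^~ w) <= t2]) +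
  2 * (#|I|%:R / (K.+1%:R * ((t2 - t1) / (2 * (\sum_k `|a k| + 1))))) + e / 2.
  by near: n; exact: walks_form_le.
move/le_trans; apply.
by rewrite -addrA lerD2l [leRHS](splitr e) lerD2r.
Unshelve. all: by end_near. Qed.

Lemma walks_chi_square_ge (e : R) : 0 < e -> \forall n \near \oo,
  fine (P' [set w | lin_form J a c0 (C ^~ w) <= t1]) - e <=
  walks_mean n (fun x => (diag_form J a c0 x <= t2)%R%:R).
Proof.
move=> e0; have e2 : 0 < e / 2 by rewrite divr_gt0.
have [K hK] := small_tail e2.
near=> n.
have : fine (P' [set w | lin_form J a c0 (C ^~ w) <= t1]) -
  2 * (#|I|%:R / (K.+1%:R * ((t2 - t1) / (2 * (\sum_k `|a k| + 1))))) - e / 2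
  <= walks_mean n (fun x => (diag_form J a c0 x <= t2)%R%:R).
  by near: n; exact: walks_form_ge.
apply: le_trans.
by rewrite -addrA lerD2l -opprD lerN2 [leRHS](splitr e) lerD2r.
Unshelve. all: by end_near. Qed.

End chi_square_limit.

(** * Degenerate U-statistics of order four *)

Section u_statistics.
Context {R : realType} {S : finType}.
Variable (p : S -> R).
Hypotheses (p0 : forall z, 0 <= p z) (p1 : \sum_z p z = 1).

Definition subsample n (om : {ffun 'I_n -> S}) (i : {ffun 'I_4 -> 'I_n}) :
  {ffun 'I_4 -> S} := [ffun a => om (i a)].

(** A kernel whose mean vanishes as soon as two of its arguments are averaged,
    the others being fixed: only the projections of order 3 and 4 of its
    Hoeffding decomposition survive. *)
Definition degenerate2 (k : {ffun 'I_4 -> S} -> R) : Prop :=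
  forall (a b : 'I_4) (z : {ffun 'I_4 -> S}), a != b ->
    \sum_s \sum_t p s * p t * k (resample (resample z b t) a s) = 0.

Lemma subsample_resample n (om : {ffun 'I_n -> S}) (i : {ffun 'I_4 -> 'I_n}) a s :
  injective i -> subsample (resample om (i a) s) i = resample (subsample om i) a s.
Proof. by move=> inj; apply/ffunP => b; rewrite !ffunE (inj_eq inj). Qed.

Lemma subsample_resample_notin n (om : {ffun 'I_n -> S}) (j : {ffun 'I_4 -> 'I_n}) m s :
  m \notin codom j -> subsample (resample om m s) j = subsample om j.
Proof.
move=> mj; apply/ffunP => b; rewrite !ffunE.
by case: eqP => // jm; rewrite -jm codom_f in mj.
Qed.

(** Two arguments of the first factor can be resampled without changing the
    second one. *)
Lemma degenerate2_uncorrelated n (k : {ffun 'I_4 -> S} -> R)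
    (i j : {ffun 'I_4 -> 'I_n}) a b : degenerate2 k -> injective i -> a != b ->
  i a \notin codom j -> i b \notin codom j ->
  sample_mean p (fun om : {ffun 'I_n -> S} => k (subsample om i) * k (subsample om j)) = 0.
Proof.
move=> dk inj ab ia ib.
rewrite (sample_mean_resample p1 (i b)).
under eq_sample_mean => om do under eq_bigr => t _ do
  rewrite subsample_resample// subsample_resample_notin// mulrA.
rewrite (sample_mean_resample p1 (i a)) -[RHS](sample_mean_cst p1 n).
apply: eq_sample_mean => om.
transitivity (k (subsample om j) * \sum_s \sum_t p s * p t *
    k (resample (resample (subsample om i) b t) a s)).
  rewrite mulr_sumr; apply: eq_bigr => s _; rewrite mulr_sumr mulr_sumr.
  apply: eq_bigr => t _; rewrite subsample_resample// subsample_resample_notin//.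
  have -> : resample (resample (subsample om i) a s) b t =
     resample (resample (subsample om i) b t) a s.
    apply/ffunP => c; rewrite !ffunE.
    by case: eqP => [->|//]; rewrite eq_sym (negbTE ab).
  by ring.
by rewrite dk// mulr0.
Qed.

Definition overlap n (i j : {ffun 'I_4 -> 'I_n}) : bool :=
  [forall a, forall b, (a != b) ==> (i a \in codom j) || (i b \in codom j)].

(** An overlapping tuple has at most one entry that is not among the four entries
    of [j]: there are four places for it, [n] choices of it, and [4 ^ 3] choices
    of the other entries. *)
Lemma overlap_count n (j : {ffun 'I_4 -> 'I_n}) :
  \sum_(i : {ffun 'I_4 -> 'I_n}) (overlap i j)%:R <= 256 * n%:R :> R.
Proof.
pose F (c : 'I_4) (a : 'I_4) (m : 'I_n) : R := if a == c then 1 else (m \in codom j)%:R.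
have F0 c a m : 0 <= F c a m by rewrite /F; case: eqP.
apply: (@le_trans _ _ (\sum_(i : {ffun 'I_4 -> 'I_n}) \sum_c \prod_a F c a (i a))).
  apply: ler_sum => i _; case: (boolP (overlap i j)) => [/forallP ov|_]; last first.
    by apply: sumr_ge0 => c _; apply: prodr_ge0 => a _.
  have [c cP] : exists c, forall a, a != c -> i a \in codom j.
    have [/forallP al|] := boolP [forall a, i a \in codom j]; first by exists ord0 => a _.
    rewrite negb_forall => /existsP[c cn]; exists c => a ac.
    by have /forallP/(_ c)/implyP/(_ ac) := ov a; rewrite (negbTE cn) orbF.
  rewrite (bigD1 c)//= (_ : \prod_a _ = 1) ?lerDl; last first.
    by apply: big1 => a _; rewrite /F; case: eqP => // /eqP/cP ->.
  by apply: sumr_ge0 => b _; apply: prodr_ge0 => a _.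
rewrite exchange_big /=.
apply: (@le_trans _ _ (\sum_(c < 4) (4 ^+ 3 * n%:R))); last first.
  rewrite sumr_const card_ord -mulr_natl le_eqVlt; apply/orP; left.
  by apply/eqP; ring.
apply: ler_sum => c _.
rewrite -(bigA_distr_bigA (F c)) (bigD1 c)//=.
have -> : \sum_m F c c m = n%:R by rewrite /F eqxx sumr_const card_ord.
rewrite mulrC ler_wpM2r//.
apply: (@le_trans _ _ (\prod_(a < 4 | a != c) 4)).
  apply: ler_prod => a ac; rewrite sumr_ge0//=.
  rewrite /F (negbTE ac).
  have -> : \sum_m (m \in codom j)%:R = \sum_(m in codom j) 1 :> R.
    by rewrite [RHS]big_mkcond; apply: eq_bigr => m _; case: ifP.
  rewrite sumr_const ler_nat (leq_trans (card_size _))// size_codom card_ord.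
  by [].
by rewrite prodr_const cardC1 card_ord.
Qed.

Definition u_sum n (k : {ffun 'I_4 -> S} -> R) (om : {ffun 'I_n -> S}) : R :=
  \sum_(i : {ffun 'I_4 -> 'I_n} | injectiveb i) k (subsample om i).

(** Only the overlapping pairs of tuples contribute, and these are [O(n^5)] out
    of [n^8]. *)
Lemma u_sum_sqr_mean n (k : {ffun 'I_4 -> S} -> R) H : degenerate2 k ->
  (forall z, `|k z| <= H) ->
  sample_mean p (fun om : {ffun 'I_n -> S} => u_sum k om ^+ 2)
  <= 256 * H ^+ 2 * n%:R ^+ 5.
Proof.
move=> dk kH.
have -> : (fun om : {ffun 'I_n -> S} => u_sum k om ^+ 2) =
    fun om => \sum_(i : {ffun 'I_4 -> 'I_n} | injectiveb i)
      \sum_(j : {ffun 'I_4 -> 'I_n} | injectiveb j)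
        k (subsample om i) * k (subsample om j).
  by apply/funext => om; rewrite expr2 /u_sum big_distrlr.
rewrite sample_mean_sum.
under eq_bigr do rewrite sample_mean_sum.
rewrite exchange_big/=.
have H2 : 0 <= H ^+ 2 by exact: sqr_ge0.
apply: (@le_trans _ _ (\sum_(j : {ffun 'I_4 -> 'I_n}) H ^+ 2 * (256 * n%:R))); last first.
  rewrite sumr_const card_ffun !card_ord -[_ *+ (n ^ 4)]mulr_natl natrX.
  by rewrite le_eqVlt; apply/orP; left; apply/eqP; ring.
rewrite big_mkcond /=; apply: ler_sum => j _.
have r0 : 0 <= H ^+ 2 * (256 * n%:R) by rewrite mulr_ge0// mulr_ge0.
case: ifP => // injj.
apply: (@le_trans _ _ (\sum_(i : {ffun 'I_4 -> 'I_n}) H ^+ 2 * (overlap i j)%:R)); last first.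
  by rewrite -mulr_sumr ler_wpM2l// overlap_count.
rewrite big_mkcond /=; apply: ler_sum => i _.
case: ifP => [/injectiveP inji|_]; last by rewrite mulr_ge0.
case: (boolP (overlap i j)) => [_|].
  rewrite mulr1 -[leRHS](sample_mean_cst p1 n); apply: sample_mean_le => // om.
  by rewrite (le_trans (ler_norm _))// normrM expr2 ler_pM.
rewrite negb_forall => /existsP[a]; rewrite negb_forall => /existsP[b].
rewrite negb_imply negb_or => /and3P[ab ia ib].
by rewrite (degenerate2_uncorrelated dk inji ab ia ib) mulr0.
Qed.

End u_statistics.

Local Notation i0 := (@Ordinal 4 0 isT).
Local Notation i1 := (@Ordinal 4 1 isT).
Local Notation i2 := (@Ordinal 4 2 isT).
Local Notation i3 := (@Ordinal 4 3 isT).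

Lemma enum_I4 : enum 'I_4 = [:: i0; i1; i2; i3].
Proof.
apply: (inj_map val_inj); rewrite val_enum_ord.
by [].
Qed.

Lemma I4P (a : 'I_4) : [\/ a = i0, a = i1, a = i2 | a = i3].
Proof.
have : a \in [:: i0; i1; i2; i3] by rewrite -enum_I4 mem_enum.
rewrite !inE => /or4P[] /eqP ->; by [constructor 1|constructor 2|constructor 3|constructor 4].
Qed.

Section distinct_sums.
Context {R : realType} {n : nat}.

Definition sum_distinct4 (F : 'I_n -> 'I_n -> 'I_n -> 'I_n -> R) : R :=
  \sum_i \sum_j \sum_k \sum_(l | uniq [:: i; j; k; l]) F i j k l.

(** Nested sums suit the statistic, injective tuples suit the second moments. *)
Lemma sum_distinct4_ffun F : sum_distinct4 F =
  \sum_(i : {ffun 'I_4 -> 'I_n} | injectiveb i) F (i i0) (i i1) (i i2) (i i3).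
Proof.
pose t (u : 'I_n * 'I_n * 'I_n * 'I_n) : {ffun 'I_4 -> 'I_n} :=
  [ffun a : 'I_4 => nth u.1.1.1 [:: u.1.1.1; u.1.1.2; u.1.2; u.2] a].
pose s (i : {ffun 'I_4 -> 'I_n}) := (i i0, i i1, i i2, i i3).
have ts : cancel s t.
  by move=> i; apply/ffunP => a; rewrite ffunE; case: (I4P a) => ->.
have st : cancel t s by move=> [[[i j] k] l]; rewrite /s !ffunE.
rewrite [RHS](reindex t); last by exists s => u _; [exact: st|exact: ts].
rewrite [RHS]big_mkcond /=.
rewrite -(pair_bigA _ (fun u l => if injectiveb (t (u, l)) then
   F (t (u, l) i0) (t (u, l) i1) (t (u, l) i2) (t (u, l) i3) else 0))/=.
rewrite -(pair_bigA _ (fun u k => \sum_l if injectiveb (t (u, k, l)) then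
   F (t (u, k, l) i0) (t (u, k, l) i1) (t (u, k, l) i2) (t (u, k, l) i3) else 0))/=.
rewrite -(pair_bigA _ (fun i j => \sum_k \sum_l if injectiveb (t (i, j, k, l)) then
   F (t (i, j, k, l) i0) (t (i, j, k, l) i1) (t (i, j, k, l) i2) (t (i, j, k, l) i3) else 0))/=.
apply: eq_bigr => i _; apply: eq_bigr => j _; apply: eq_bigr => k _.
rewrite big_mkcond; apply: eq_bigr => l _.
by rewrite /injectiveb /dinjectiveb enum_I4 /= !ffunE.
Qed.

Lemma sum_notin (s : seq 'I_n) : uniq s ->
  \sum_l (l \notin s)%:R = n%:R - (size s)%:R :> R.
Proof.
move=> us; have <- : \sum_(l : 'I_n) (1 : R) = n%:R by rewrite sumr_const card_ord.
have -> : (size s)%:R = \sum_l (l \in s)%:R :> R.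
  have -> : \sum_l (l \in s)%:R = \sum_(l in s) 1 :> R.
    by rewrite [RHS]big_mkcond; apply: eq_bigr => l _; case: ifP.
  by rewrite sumr_const (card_uniqP us).
by rewrite -sumrB; apply: eq_bigr => l _; case: (l \in s); rewrite ?subrr ?subr0.
Qed.

(** Once [i] and [j] are chosen, there remain [n - 2] choices for the third index
    and [n - 3] for the last one. *)
Lemma sum_distinct4_pair (phi : 'I_n -> 'I_n -> R) (F : 'I_n -> 'I_n -> 'I_n -> 'I_n -> R) :
  (forall i j k l, F i j k l = (uniq [:: i; j; k; l])%:R * phi i j) ->
  \sum_i \sum_j \sum_k \sum_l F i j k l =
  (n%:R - 2) * (n%:R - 3) * \sum_i \sum_(j | i != j) phi i j.
Proof.
move=> FE; rewrite mulr_sumr; apply: eq_bigr => i _.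
rewrite [in RHS]big_mkcond mulr_sumr; apply: eq_bigr => j _.
under eq_bigr => k _ do under eq_bigr => l _ do rewrite FE.
have uE k l : (uniq [:: i; j; k; l])%:R =
    (i != j)%:R * ((k \notin [:: i; j])%:R * (l \notin [:: i; j; k])%:R) :> R.
  rewrite -!natrM !mulnb /= !inE !negb_or !andbT.
  rewrite (eq_sym k i) (eq_sym k j) (eq_sym l i) (eq_sym l j) (eq_sym l k).
  by do !case: (_ == _).
have [ij|ij] := eqVneq i j.
  by rewrite mulr0 big1// => k _; rewrite big1// => l _; rewrite uE ij eqxx !mul0r.
transitivity (\sum_k (k \notin [:: i; j])%:R * ((n%:R - 3) * phi i j)).
  apply: eq_bigr => k _.
  under eq_bigr => l _ do rewrite uE ij mul1r -mulrA.
  rewrite -mulr_sumr; case: (boolP (k \in _)) => [|kn]; first by rewrite !mul0r.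
  rewrite -mulr_suml sum_notin//.
  by rewrite -[uniq _]/(uniq (rcons [:: i; j] k)) rcons_uniq kn /= inE ij.
by rewrite -mulr_suml sum_notin /= ?inE ?ij// mulrA.
Qed.

Lemma sum_distinct4E F : sum_distinct4 F =
  \sum_i \sum_j \sum_k \sum_l (uniq [:: i; j; k; l])%:R * F i j k l.
Proof.
apply: eq_bigr => i _; apply: eq_bigr => j _; apply: eq_bigr => k _.
rewrite big_mkcond; apply: eq_bigr => l _.
by case: ifP; rewrite ?mul1r ?mul0r.
Qed.

Lemma sum_distinct4D F F' : sum_distinct4 (fun i j k l => F i j k l + F' i j k l)
  = sum_distinct4 F + sum_distinct4 F'.
Proof.
rewrite !sum_distinct4E -big_split; apply: eq_bigr => i _.
rewrite -big_split; apply: eq_bigr => j _; rewrite -big_split.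
apply: eq_bigr => k _; rewrite -big_split; apply: eq_bigr => l _.
by rewrite mulrDr.
Qed.

Variable phi : 'I_n -> 'I_n -> R.
Local Notation target :=
  ((n%:R - 2) * (n%:R - 3) * \sum_i \sum_(j | i != j) phi i j).

Lemma sum_distinct4_01 : sum_distinct4 (fun i j k l => phi i j) = target.
Proof. by rewrite sum_distinct4E; apply: sum_distinct4_pair. Qed.

Lemma sum_distinct4_02 : sum_distinct4 (fun i j k l => phi i k) = target.
Proof.
rewrite sum_distinct4E.
under eq_bigr => i _ do rewrite exchange_big.
apply: sum_distinct4_pair => i j k l; congr ((nat_of_bool _)%:R * _).
by apply: perm_uniq; apply/permP => P /=; lia.
Qed.

Lemma sum_distinct4_31 : sum_distinct4 (fun i j k l => phi l j) = target.
Proof.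
rewrite sum_distinct4E.
under eq_bigr => i _ do under eq_bigr => j _ do rewrite exchange_big.
under eq_bigr => i _ do rewrite exchange_big.
rewrite exchange_big.
under eq_bigr => l _ do rewrite exchange_big.
apply: sum_distinct4_pair => i j k l; congr ((nat_of_bool _)%:R * _).
by apply: perm_uniq; apply/permP => P /=; lia.
Qed.

Lemma sum_distinct4_32 : sum_distinct4 (fun i j k l => phi l k) = target.
Proof.
rewrite sum_distinct4E.
under eq_bigr => i _ do under eq_bigr => j _ do rewrite exchange_big.
under eq_bigr => i _ do rewrite exchange_big.
rewrite exchange_big.
under eq_bigr => l _ do under eq_bigr => i _ do rewrite exchange_big.
under eq_bigr => l _ do rewrite exchange_big.
apply: sum_distinct4_pair => i j k l; congr ((nat_of_bool _)%:R * _).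
by apply: perm_uniq; apply/permP => P /=; lia.
Qed.

End distinct_sums.

(** * The limit law from a spectral expansion *)

Section degenerate_u_statistic.
Context {R : realType} {S I : finType}.
Variables (p : S -> R) (w : I -> R) (xi : S -> I -> R).
Variable h : S -> S -> S -> S -> R.
Hypotheses (p0 : forall z, 0 <= p z) (p1 : \sum_z p z = 1).
Hypothesis xi_orth : forall k l, \sum_z p z * (xi z k * xi z l) = (k == l)%:R.
Hypothesis xi_centred : forall k, w k != 0 -> \sum_z p z * xi z k = 0.

Definition spectral_kernel (z z' : S) : R := \sum_k w k * (xi z k * xi z' k).

(** The second-order projection of [h] is supported by the four pairs of
    positions made of one outer and one middle argument, as is the case for the
    sign function. *)
Definition residual_kernel (z : {ffun 'I_4 -> S}) : R :=
  h (z i0) (z i1) (z i2) (z i3)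
  - (spectral_kernel (z i0) (z i1) + spectral_kernel (z i0) (z i2)
     + spectral_kernel (z i3) (z i1) + spectral_kernel (z i3) (z i2)).

Hypothesis residual_degenerate : degenerate2 p residual_kernel.

Definition scaled_u_statistic n (om : {ffun 'I_n -> S}) : R :=
  n%:R * ((n - 4)`!%:R / n`!%:R *
    sum_distinct4 (fun i j k l => h (om i) (om j) (om k) (om l))).

Local Notation E n := (@sample_mean R S p n).

Let sumxi n (om : {ffun 'I_n -> S}) k : R := \sum_i xi (om i) k.
Let active (k : I) := w k != 0.
Let form (x : {ffun I -> R}) : R :=
  diag_form active (fun k => 4 * w k) (- (4 * \sum_k w k)) x.
(* the walk of the vectors [xi], started at 0 and rescaled *)
Let main n (om : {ffun 'I_n -> S}) : R :=
  form (0 + \sum_i step (Num.sqrt n%:R)^-1 xi (om i)).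
Let excess (z : S) : R := \sum_k w k * (xi z k ^+ 2 - 1).
(* the factor [n / (n - 1)] instead of 1 in front of the main term gives [rem1],
   the diagonal terms of the squares give [rem2], and the projections of order 3
   and 4 give [rem3] *)
Let rem1 n (om : {ffun 'I_n -> S}) : R :=
  4 / (n%:R - 1) * \sum_k w k * (sumxi om k ^+ 2 / n%:R - 1).
Let rem2 n (om : {ffun 'I_n -> S}) : R :=
  - (4 / (n%:R - 1)) * \sum_i excess (om i).
Let rem3 n (om : {ffun 'I_n -> S}) : R :=
  u_sum residual_kernel om / ((n%:R - 1) * (n%:R - 2) * (n%:R - 3)).

Let mainE n (om : {ffun 'I_n -> S}) : (0 < n)%N ->
  main om = 4 * \sum_k w k * (sumxi om k ^+ 2 / n%:R - 1).
Proof.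
move=> n0; rewrite /main /form /diag_form add0r.
have -> : \sum_(k | active k) 4 * w k * (\sum_i step (Num.sqrt n%:R)^-1 xi (om i)) k ^+ 2
    = \sum_k 4 * w k * (sumxi om k ^+ 2 / n%:R).
  rewrite big_mkcond; apply: eq_bigr => k _; case: ifPn => [_|]; last first.
    by rewrite negbK => /eqP ->; rewrite mulr0 mul0r.
  congr (_ * _); rewrite sum_ffunE.
  under eq_bigr do rewrite ffunE.
  rewrite -mulr_sumr exprMn exprVn sqr_sqrtr// mulrC.
  by [].
rewrite !mulr_sumr -sumrN -big_split; apply: eq_bigr => k _ /=.
by ring.
Qed.

Let sum_offdiag n (om : {ffun 'I_n -> S}) :
  \sum_i \sum_(j | i != j) spectral_kernel (om i) (om j) =
  \sum_k w k * (sumxi om k ^+ 2 - \sum_i xi (om i) k ^+ 2).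
Proof.
transitivity (\sum_i \sum_j spectral_kernel (om i) (om j)
   - \sum_i spectral_kernel (om i) (om i)).
  rewrite -sumrB; apply: eq_bigr => i _; rewrite [in RHS](bigD1 i)//= [RHS]addrAC subrr add0r.
  by apply: eq_bigl => j; rewrite eq_sym.
rewrite /spectral_kernel [X in X - _](_ : _ = \sum_k w k * sumxi om k ^+ 2).
  rewrite [X in _ - X](_ : _ = \sum_k w k * \sum_i xi (om i) k ^+ 2).
    by rewrite -sumrB; apply: eq_bigr => k _; rewrite mulrBr.
  rewrite exchange_big; apply: eq_bigr => k _; rewrite mulr_sumr.
  by apply: eq_bigr => i _; rewrite expr2.
under eq_bigr => i _ do rewrite exchange_big.
rewrite exchange_big; apply: eq_bigr => k _ /=.
rewrite expr2 /sumxi big_distrlr /= mulr_sumr; apply: eq_bigr => i _.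
by rewrite mulr_sumr.
Qed.

Let u_sumE n (om : {ffun 'I_n -> S}) :
  sum_distinct4 (fun i j k l => h (om i) (om j) (om k) (om l)) =
  u_sum residual_kernel om +
  4 * ((n%:R - 2) * (n%:R - 3) * \sum_i \sum_(j | i != j) spectral_kernel (om i) (om j)).
Proof.
pose G i j := spectral_kernel (om i) (om j).
rewrite (_ : sum_distinct4 _ = sum_distinct4 (fun i j k l =>
  (h (om i) (om j) (om k) (om l) - (G i j + G i k + G l j + G l k))
  + (G i j + G i k + G l j + G l k))); last first.
  congr sum_distinct4; apply/funext => i; apply/funext => j; apply/funext => k.
  by apply/funext => l; rewrite subrK.
rewrite sum_distinct4D; congr (_ + _).
  rewrite sum_distinct4_ffun; apply: eq_bigr => i _.
  by rewrite /residual_kernel !ffunE.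
rewrite !sum_distinct4D sum_distinct4_01 sum_distinct4_02 sum_distinct4_31 sum_distinct4_32.
by ring.
Qed.

Let nat4 n : (4 <= n)%N -> 4 <= n%:R :> R.
Proof. by move=> n4; rewrite ler_nat. Qed.

Let decomposition n (om : {ffun 'I_n -> S}) : (4 <= n)%N ->
  scaled_u_statistic om = main om + (rem1 om + rem2 om + rem3 om).
Proof.
move=> n4; have n4' := nat4 n4.
rewrite mainE; last exact: leq_trans n4.
rewrite /scaled_u_statistic u_sumE sum_offdiag.
have -> : (n - 4)`!%:R / n`!%:R = (n%:R * (n%:R - 1) * (n%:R - 2) * (n%:R - 3))^-1 :> R.
  have [m nE] : exists m, n = m.+4 by exists (n - 4)%N; lia.
  rewrite nE (_ : (m.+4 - 4 = m)%N); last by lia.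
  have e j : (m + j)%:R = m%:R + j%:R :> R by rewrite natrD.
  rewrite !factS !natrM -[m.+4]addn4 -[m.+3]addn3 -[m.+2]addn2 -[m.+1]addn1 !e.
  have m0 : 0 <= m%:R :> R by [].
  have f0 : m`!%:R != 0 :> R by rewrite pnatr_eq0 -lt0n fact_gt0.
  field; rewrite f0 /=; repeat (apply/andP; split); rewrite ?gt_eqF//; lra.
have -> : rem2 om = - (4 / (n%:R - 1)) * \sum_k w k * (\sum_i xi (om i) k ^+ 2 - n%:R).
  rewrite /rem2; congr (_ * _); rewrite /excess exchange_big; apply: eq_bigr => k _ /=.
  rewrite -mulr_sumr sumrB; congr (_ * (_ - _)).
  by rewrite sumr_const card_ord.
rewrite /rem1 /rem3.
have split3 : \sum_k w k * (sumxi om k ^+ 2 - \sum_i xi (om i) k ^+ 2) =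
   n%:R * (\sum_k w k * (sumxi om k ^+ 2 / n%:R - 1))
   - \sum_k w k * (\sum_i xi (om i) k ^+ 2 - n%:R).
  rewrite mulr_sumr -sumrB; apply: eq_bigr => k _; field.
  by rewrite gt_eqF//; lra.
rewrite split3; set X := \sum_k w k * (_ / _ - 1); set Y := \sum_k w k * (_ - n%:R).
field.
rewrite !gt_eqF//=; lra.
Qed.

Let pred_n_bounds n : (4 <= n)%N ->
  [/\ 0 < n%:R :> R, n%:R / 4 <= n%:R - 3 :> R & (n%:R - 1)^-1 <= 2 / n%:R :> R].
Proof.
move=> n4; have n4' := nat4 n4; have n0 : 0 < n%:R :> R by lra.
split => //; first lra.
rewrite ler_pdivlMr// mulrC ler_pdivrMr; lra.
Qed.

Let rem1_mean n : (4 <= n)%N ->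
  E n (fun om => `|rem1 om|) <=
  (16 * \sum_k `|w k|) / n%:R.
Proof.
move=> n4; have [n0 _ nV] := pred_n_bounds n4; have n4' := nat4 n4.
have W0 : 0 <= \sum_k `|w k| by apply: sumr_ge0.
have c0 : 0 <= 4 / (n%:R - 1) :> R by rewrite divr_ge0//; lra.
apply: (@le_trans _ _ (sample_mean p (fun om : {ffun 'I_n -> S} =>
   4 / (n%:R - 1) * \sum_k `|w k| * (n%:R^-1 * sumxi om k ^+ 2 + 1)))).
  apply: sample_mean_le => // om; rewrite /rem1 normrM (ger0_norm c0) ler_wpM2l//.
  apply: (le_trans (ler_norm_sum _ _ _)); apply: ler_sum => k _.
  rewrite normrM ler_wpM2l// (le_trans (ler_normB _ _))// normr1 lerD2r.
  by rewrite ger0_norm ?divr_ge0 ?sqr_ge0 ?(ltW n0)// mulrC.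
rewrite sample_meanZ sample_mean_sum.
have -> : \sum_k sample_mean p (fun om : {ffun 'I_n -> S} =>
    `|w k| * (n%:R^-1 * sumxi om k ^+ 2 + 1)) = \sum_k `|w k| * 2.
  apply: eq_bigr => k _; rewrite sample_meanZ.
  have [wk0|wk0] := eqVneq (w k) 0; first by rewrite wk0 normr0 !mul0r.
  congr (_ * _); rewrite sample_meanD sample_meanZ sample_mean_cst//.
  rewrite (sample_mean_sum_sqr p1 n (xi_centred wk0)).
  have -> : \sum_z p z * xi z k ^+ 2 = 1.
    have e1 : \sum_z p z * (xi z k * xi z k) = 1 by rewrite xi_orth eqxx.
    by rewrite -[RHS]e1; apply: eq_bigr => z _; rewrite expr2.
  by rewrite mulr1 mulVf ?gt_eqF//.
rewrite -mulr_suml; have := ler_wpM2l W0 nV; lra.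
Qed.

Let excess_centred : \sum_z p z * excess z = 0.
Proof.
rewrite /excess; under eq_bigr do rewrite mulr_sumr.
rewrite exchange_big big1// => k _ /=.
transitivity (w k * (\sum_z p z * (xi z k * xi z k) - \sum_z p z)).
  by rewrite -sumrB mulr_sumr; apply: eq_bigr => z _; ring.
by rewrite xi_orth eqxx p1 subrr mulr0.
Qed.

Let rem2_mean n : (4 <= n)%N ->
  E n (fun om => rem2 om ^+ 2) <=
  (64 * \sum_z p z * excess z ^+ 2) / n%:R.
Proof.
move=> n4; have [n0 _ nV] := pred_n_bounds n4; have n4' := nat4 n4.
rewrite (_ : (fun om => _) = fun om : {ffun 'I_n -> S} =>
    (16 * ((n%:R - 1)^-1) ^+ 2) * (\sum_i excess (om i)) ^+ 2); last first.
  by apply/funext => om; rewrite /rem2; ring.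
rewrite sample_meanZ (sample_mean_sum_sqr p1 n excess_centred).
set Z := \sum_z _; have Z0 : 0 <= Z.
  by apply: sumr_ge0 => z _; rewrite mulr_ge0 ?sqr_ge0.
have sq : (n%:R - 1)^-1 ^+ 2 <= (2 / n%:R) ^+ 2 :> R.
  by rewrite ler_sqr ?nnegrE ?invr_ge0 ?divr_ge0 ?(ltW n0)//; lra.
have -> : 64 * Z / n%:R = 16 * (2 / n%:R) ^+ 2 * (n%:R * Z).
  by field; rewrite gt_eqF.
by rewrite ler_wpM2r ?mulr_ge0 ?(ltW n0)// ler_wpM2l.
Qed.

Let rem3_mean n : (4 <= n)%N ->
  E n (fun om => rem3 om ^+ 2) <=
  (256 * 4 ^+ 6 * (\sum_z `|residual_kernel z|) ^+ 2) / n%:R.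
Proof.
move=> n4; have [n0 nq _] := pred_n_bounds n4; have n4' := nat4 n4.
set H := \sum_z _.
pose D : R := (n%:R - 1) * (n%:R - 2) * (n%:R - 3).
have q0 : 0 < n%:R / 4 :> R by rewrite divr_gt0.
have D1 : (n%:R / 4) ^+ 3 <= D.
  have -> : D = (n%:R - 1) * ((n%:R - 2) * (n%:R - 3)) by rewrite /D mulrA.
  rewrite !exprS expr0 mulr1.
  have q0' := ltW q0; have a1 : n%:R / 4 <= n%:R - 1 :> R by lra.
  have a2 : n%:R / 4 <= n%:R - 2 :> R by lra.
  exact: ler_pM q0' (mulr_ge0 q0' q0') a1 (ler_pM q0' q0' a2 nq).
have q3 : 0 < (n%:R / 4) ^+ 3 :> R by rewrite exprn_gt0.
have D0 : 0 < D by exact: lt_le_trans D1.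
rewrite (_ : (fun om => _) = fun om : {ffun 'I_n -> S} =>
    D^-1 ^+ 2 * u_sum residual_kernel om ^+ 2); last first.
  by apply/funext => om; rewrite /rem3 -/D exprMn mulrC.
rewrite sample_meanZ.
have kH z : `|residual_kernel z| <= H.
  by rewrite /H (bigD1 z)//= lerDl sumr_ge0.
have U := u_sum_sqr_mean p0 p1 n residual_degenerate kH.
have DV : D^-1 ^+ 2 <= ((n%:R / 4) ^+ 3)^-1 ^+ 2.
  by rewrite ler_sqr ?nnegrE ?invr_ge0 ?(ltW D0) ?(ltW q3)// lef_pV2 ?posrE.
apply: (@le_trans _ _ (((n%:R / 4) ^+ 3)^-1 ^+ 2 * (256 * H ^+ 2 * n%:R ^+ 5))).
  apply: ler_pM => //; first exact: sqr_ge0.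
  apply: sumr_ge0 => om _; rewrite mulr_ge0 ?sqr_ge0//.
  exact: prodr_ge0.
rewrite le_eqVlt; apply/orP; left; apply/eqP; field.
by rewrite gt_eqF.
Qed.

(* Markov's inequality for [rem1], Chebyshev's inequality for the other two *)
Let remainder_mean (s : R) : 0 < s -> exists Cst : R, forall n, (4 <= n)%N ->
  E n (fun om => (s < `|rem1 om + rem2 om + rem3 om|)%R%:R)
  <= Cst / n%:R.
Proof.
move=> s0; pose e := s / 3; have e0 : 0 < e by rewrite divr_gt0.
have [B1 h1] : exists B, forall n, (4 <= n)%N ->
    E n (fun om => `|rem1 om|) <= B / n%:R.
  by exists (16 * \sum_k `|w k|) => n; exact: rem1_mean.
have [B2 h2] : exists B, forall n, (4 <= n)%N ->
    E n (fun om => rem2 om ^+ 2) <= B / n%:R.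
  by eexists => n; exact: rem2_mean.
have [B3 h3] : exists B, forall n, (4 <= n)%N ->
    E n (fun om => rem3 om ^+ 2) <= B / n%:R.
  by eexists => n; exact: rem3_mean.
exists (e^-1 * B1 + e^-1 ^+ 2 * B2 + e^-1 ^+ 2 * B3) => n n4.
have eV0 : 0 <= e^-1 by rewrite invr_ge0 ltW.
have eV20 : 0 <= e^-1 ^+ 2 by rewrite exprn_ge0.
have -> : (e^-1 * B1 + e^-1 ^+ 2 * B2 + e^-1 ^+ 2 * B3) / n%:R =
  e^-1 * (B1 / n%:R) + e^-1 ^+ 2 * (B2 / n%:R) + e^-1 ^+ 2 * (B3 / n%:R) by ring.
apply: le_trans (lerD (lerD (ler_wpM2l eV0 (h1 n n4)) (ler_wpM2l eV20 (h2 n n4)))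
  (ler_wpM2l eV20 (h3 n n4))).
rewrite -!sample_meanZ -!sample_meanD; apply: sample_mean_le => // om.
have r1 : 0 <= e^-1 * `|rem1 om| by rewrite mulr_ge0.
have r2 : 0 <= e^-1 ^+ 2 * rem2 om ^+ 2 by rewrite mulr_ge0 ?sqr_ge0.
have r3 : 0 <= e^-1 ^+ 2 * rem3 om ^+ 2 by rewrite mulr_ge0 ?sqr_ge0.
case: ltrP => hs; last by rewrite !addr_ge0.
have big r : e <= `|r| -> 1 <= e^-1 ^+ 2 * r ^+ 2.
  move=> er; rewrite -exprMn -[_ ^+ 2]real_normK ?num_real// exprn_ege1//.
  by rewrite normrM (ger0_norm eV0) ler_pdivlMl// mulr1.
have [b1|b1] := lerP e `|rem1 om|.
  have : 1 <= e^-1 * `|rem1 om| by rewrite ler_pdivlMl// mulr1.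
  by move/le_trans; apply; rewrite -addrA lerDl addr_ge0.
have [b2|b2] := lerP e `|rem2 om|.
  by apply: le_trans (big _ b2) _; rewrite addrAC lerDr addr_ge0.
have [b3|b3] := lerP e `|rem3 om|.
  by apply: le_trans (big _ b3) _; rewrite lerDr addr_ge0.
have := ler_normD (rem1 om + rem2 om) (rem3 om); have := ler_normD (rem1 om) (rem2 om).
move: hs b1 b2 b3; rewrite /e; lra.
Qed.

Let inv_sqrt_small (Cst e : R) : 0 < e -> \forall n \near \oo,
  Cst / Num.sqrt n.+1%:R <= e.
Proof.
move=> e0; near=> n.
have sn0 : 0 < Num.sqrt n.+1%:R :> R by rewrite sqrtr_gt0.
rewrite ler_pdivrMr// -ler_pdivrMl// (le_trans (ler_norm _))// -sqrtr_sqr ler_wsqrtr//.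
rewrite (@le_trans _ _ n%:R)// ?ler_nat//.
by near: n; exact: nbhs_infty_ger.
Unshelve. all: by end_near. Qed.

Let inv_small (Cst e : R) : 0 < e -> \forall n \near \oo, Cst / n%:R <= e.
Proof.
move=> e0; near=> n.
have n0 : 0 < n%:R :> R by rewrite ltr0n; near: n; exact: nbhs_infty_gt.
rewrite ler_pdivrMr// -ler_pdivrMl//.
by near: n; exact: nbhs_infty_ger.
Unshelve. all: by end_near. Qed.

Section limit_law.
Context d' (T' : measurableType d') (P' : probability T' R).
Variable C : I -> {RV P' >-> R}.
Hypothesis C_indep : mutually_independent P' C.
Hypothesis C_law : forall i (A : set R), measurable A ->
  distribution P' (C i) A = chi_square1 A.

Definition limit_form (t : T') : R := 4 * \sum_k w k * (C k t - 1).

Let limit_formE t : limit_form t =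
  lin_form active (fun k => 4 * w k) (- (4 * \sum_k w k)) (C ^~ t).
Proof.
rewrite /limit_form /lin_form.
have -> : \sum_(k | active k) 4 * w k * C k t = \sum_k 4 * w k * C k t.
  rewrite big_mkcond; apply: eq_bigr => k _; case: ifPn => //.
  by rewrite negbK => /eqP ->; rewrite mulr0 mul0r.
rewrite !mulr_sumr -sumrN -big_split; apply: eq_bigr => k _ /=.
by ring.
Qed.

Let lin_set t : set T' := [set y | lin_form active
  (fun k => 4 * w k) (- (4 * \sum_k w k)) (C ^~ y) <= t].

Let limit_setE t : [set y | limit_form y <= t] = lin_set t.
Proof. by apply/seteqP; split => y /=; rewrite /lin_set /= limit_formE. Qed.

Variables t1 t2 : R.
Hypothesis t12 : t1 < t2.
Let s : R := (t2 - t1) / 3.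
Let s0 : 0 < s. Proof. by rewrite divr_gt0// subr_gt0. Qed.
(* [f] falls from 1 to 0 between [t1 + s] and [t1 + 2 * s], which leaves a room
   of [s] on both sides for the remainders *)
Let f (y : R) : R := smooth_step ((s / 3)^-1 * y + - ((s / 3)^-1 * (t1 + s))).

Let f_bounds y : 0 <= f y <= 1. Proof. exact: smooth_step_bounds. Qed.

Let f_ge y : (y <= t1 + s)%R%:R <= f y.
Proof.
case: (lerP y (t1 + s)) => ys; last by case/andP: (f_bounds y).
rewrite /f smooth_step_le0// -mulrBr pmulr_rle0 ?subr_le0//.
by rewrite invr_gt0 divr_gt0.
Qed.

Let f_le y : f y <= (y <= t1 + 2 * s)%R%:R.
Proof.
case: (lerP y (t1 + 2 * s)) => ys; first by case/andP: (f_bounds y).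
have s30 : 0 < s / 3 by rewrite divr_gt0.
by rewrite /f smooth_step_ge3// -mulrBr ler_pdivlMl//; lra.
Qed.

Let f_taylor : exists M, taylor2 M f.
Proof.
eexists; apply: taylor2_affine; last exact: smooth_step_taylor2.
by rewrite invr_ge0 divr_ge0// ltW.
Qed.

Let main_mean n : E n (fun om => f (main om)) =
  iter n (avg p (step (Num.sqrt n%:R)^-1 xi)) (f \o form) 0.
Proof. by rewrite sample_mean_iter_avg. Qed.

Let main_walks (e : R) : 0 < e -> \forall n \near \oo,
  `|E n (fun om => f (main om)) - walks_mean n (f \o form)| <= e.
Proof.
move=> e0; have [M fM] := f_taylor.
have [Cst CstP] := @quadratic_lindeberg R I active (fun k => 4 * w k)
  (- (4 * \sum_k w k)) S _ p signs_weight xi signs (fun k l => (k == l)%:R) M f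
  p0 p1 signs_weight_ge0 signs_weight_sum xi_centred (fun k _ => signs_centred k)
  (fun k l _ _ => xi_orth k l) (fun k l _ _ => signs_cov k l) fM.
have [N _ NP] := inv_sqrt_small Cst e0.
exists N.+1 => // -[//|n] /= nN.
rewrite main_mean; apply: le_trans (CstP n) _; exact: NP.
Qed.

(** The statistic is compared to its main term up to the remainders, the main
    term to Rademacher walks through the test function, and the walks to the
    chi-square variables: each comparison moves the threshold a little. *)
Lemma u_statistic_limit_le (e : R) : 0 < e -> \forall n \near \oo,
  E n (fun om => (scaled_u_statistic om <= t1)%R%:R) <=
  fine (P' [set t | limit_form t <= t2]) + e.
Proof.
move=> e0; have e3 : 0 < e / 3 by rewrite divr_gt0.
have [Cst CstP] := remainder_mean s0.
have st2 : t1 + 2 * s < t2 by have := t12; rewrite /s; lra.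
rewrite limit_setE.
near=> n.
have n4 : (4 <= n)%N by near: n; exact: nbhs_infty_ge.
have h1 : E n (fun om => (scaled_u_statistic om <= t1)%R%:R) <=
  E n (fun om => f (main om))
  + E n (fun om => (s < `|rem1 om + rem2 om + rem3 om|)%R%:R).
  rewrite -sample_meanD; apply: sample_mean_le => // om.
  have fb := f_bounds (main om); have fg := f_ge (main om).
  rewrite decomposition//; set r := rem1 om + _ + _.
  case: (ltrP s `|r|) => sr /=; first by case: (_ <= t1) => /=; lra.
  rewrite addr0; case: (lerP (main om + r) t1) => mt; last by case/andP: fb.
  rewrite (le_trans _ fg)//.
  have -> // : main om <= t1 + s.
  by move: sr; rewrite ler_norml => /andP[]; lra.
have h2 : E n (fun om => (s < `|rem1 om + rem2 om + rem3 om|)%R%:R) <= e / 3.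
  by apply: le_trans (CstP _ n4) _; near: n; exact: inv_small.
have h3 : `|E n (fun om => f (main om)) - walks_mean n (f \o form)| <= e / 3.
  by near: n; exact: main_walks.
have h4 : walks_mean n (f \o form) <= walks_mean n (fun x => (form x <= t1 + 2 * s)%R%:R).
  by apply: walks_mean_le => x; exact: f_le.
have h5 : walks_mean n (fun x => (form x <= t1 + 2 * s)%R%:R) <=
   fine (P' (lin_set t2)) + e / 3.
  by near: n; exact: walks_chi_square_le.
move: h3; rewrite ler_norml => /andP[_ h3].
apply: (le_trans h1); move: h2 h3 h4 h5; lra.
Unshelve. all: by end_near. Qed.

Lemma u_statistic_limit_ge (e : R) : 0 < e -> \forall n \near \oo,
  fine (P' [set t | limit_form t <= t1]) - e <=
  E n (fun om => (scaled_u_statistic om <= t2)%R%:R).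
Proof.
move=> e0; have e3 : 0 < e / 3 by rewrite divr_gt0.
have [Cst CstP] := remainder_mean s0.
have st2 : t1 < t1 + s by rewrite ltrDl.
rewrite limit_setE.
near=> n.
have n4 : (4 <= n)%N by near: n; exact: nbhs_infty_ge.
have h1 : E n (fun om => f (main om)) <=
  E n (fun om => (scaled_u_statistic om <= t2)%R%:R)
  + E n (fun om => (s < `|rem1 om + rem2 om + rem3 om|)%R%:R).
  rewrite -sample_meanD; apply: sample_mean_le => // om.
  have fb := f_bounds (main om); have fl := f_le (main om).
  rewrite decomposition//; set r := rem1 om + _ + _.
  case: (ltrP s `|r|) => sr /=; first by case: (_ <= t2) => /=; lra.
  rewrite addr0; apply: (le_trans fl).
  case: (lerP (main om) (t1 + 2 * s)) => // mt.
  have -> // : main om + r <= t2.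
  by move: sr; rewrite ler_norml => /andP[]; rewrite /s in mt *; lra.
have h2 : E n (fun om => (s < `|rem1 om + rem2 om + rem3 om|)%R%:R) <= e / 3.
  by apply: le_trans (CstP _ n4) _; near: n; exact: inv_small.
have h3 : `|E n (fun om => f (main om)) - walks_mean n (f \o form)| <= e / 3.
  by near: n; exact: main_walks.
have h4 : walks_mean n (fun x => (form x <= t1 + s)%R%:R) <= walks_mean n (f \o form).
  by apply: walks_mean_le => x; exact: f_ge.
have h5 : fine (P' (lin_set t1)) - e / 3 <=
   walks_mean n (fun x => (form x <= t1 + s)%R%:R).
  by near: n; exact: walks_chi_square_ge.
move: h3; rewrite ler_norml => /andP[h3 _].
move: h1 h2 h3 h4 h5; lra.
Unshelve. all: by end_near. Qed.

End limit_law.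

End degenerate_u_statistic.

(** * Diagonalisation of real symmetric matrices *)

Section symmetric_diagonalisation.
Variable R : rcfType.

Lemma row_sqnorm_gt0 n (v : 'rV[R]_n) : v != 0 -> 0 < (v *m v^T) 0 0.
Proof.
move=> v0; have e : (v *m v^T) 0 0 = \sum_j v 0 j ^+ 2.
  by rewrite mxE; apply: eq_bigr => j _; rewrite mxE expr2.
rewrite e lt_neqAle sumr_ge0 ?andbT => [|j _]; last exact: sqr_ge0.
apply: contra_neq v0 => /esym/eqP; rewrite psumr_eq0 => [/allP s0|j _]; last exact: sqr_ge0.
apply/rowP => j; rewrite mxE; apply/eqP; rewrite -(sqrf_eq0 (v 0 j)).
exact: s0 (mem_index_enum j).
Qed.

(** A Householder reflection carries any unit vector to any other one, and is
    its own inverse and its own transpose. *)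
Lemma householder n (e u : 'rV[R]_n) : e *m e^T = 1%:M -> u *m u^T = 1%:M ->
  exists H : 'M[R]_n, [/\ H^T = H, H *m H = 1%:M & e *m H = u].
Proof.
move=> ee uu; have [->|neq] := eqVneq e u.
  by exists 1%:M; rewrite trmx1 mulmx1 mulmx1.
have [w wE] : exists w, w = e - u by exists (e - u).
have w0 : w != 0 by rewrite wE subr_eq0.
pose c := (w *m w^T) 0 0; have c0 : c != 0 by rewrite gt_eqF// row_sqnorm_gt0.
pose s := (e *m u^T) 0 0.
have eu : e *m u^T = s%:M by exact: mx11_scalar.
have ue : u *m e^T = s%:M by rewrite -[LHS]trmxK trmx_mul trmxK eu tr_scalar_mx.
have ww : w *m w^T = c%:M by exact: mx11_scalar.
have cE : c = 2 - 2 * s.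
  rewrite /c wE linearB /= mulmxBl !mulmxBr ee uu eu ue !mxE eqxx /= !mulr1n.
  by ring.
have ew : e *m w^T = (1 - s)%:M.
  by rewrite wE linearB /= mulmxBr ee eu -raddfB.
exists (1%:M - (2 / c) *: (w^T *m w)); split.
- by rewrite linearB /= trmx1 linearZ /= trmx_mul trmxK.
- rewrite mulmxBl mul1mx mulmxBr mulmx1 -scalemxAl -scalemxAr.
  have -> : w^T *m w *m (w^T *m w) = c *: (w^T *m w).
    by rewrite mulmxA -(mulmxA w^T) ww mul_mx_scalar -scalemxAl.
  rewrite !scalerA (_ : 2 / c * (2 / c) * c = 2 / c + 2 / c); last by field.
  rewrite scalerDl; move: (_ *: _) => Y.
  by rewrite [in X in _ - X]opprD addrA subrr sub0r opprK subrK.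
- rewrite mulmxBr mulmx1 -scalemxAr mulmxA ew mul_scalar_mx scalerA.
  rewrite (_ : 2 / c * (1 - s) = 1) ?scale1r; last by rewrite cE; field; rewrite -cE.
  by rewrite wE opprB addrCA subrr addr0.
Qed.

Lemma char_poly_conj n (A H : 'M[R]_n) : H *m H = 1%:M ->
  char_poly (H *m A *m H) = char_poly A.
Proof.
move=> HH; rewrite /char_poly.
have HHp : map_mx polyC H *m map_mx polyC H = 1%:M.
  by rewrite -map_mxM HH map_mx1.
have -> : char_poly_mx (H *m A *m H) =
    map_mx polyC H *m char_poly_mx A *m map_mx polyC H.
  rewrite /char_poly_mx !map_mxM mulmxBr mulmxBl; congr (_ - _).
  by rewrite mul_mx_scalar -scalemxAl HHp scalemx1.
rewrite !det_mulmx mulrAC -det_mulmx HHp det1 mul1r.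
by [].
Qed.

(** By induction: a reflection carries a unit eigenvector onto the first axis, and
    the matrix then splits off this axis. Removing the factor of the first
    eigenvalue from the characteristic polynomial keeps the order of the list. *)
Lemma symmetric_orthogonal_diagonalisation n (A : 'M[R]_n) (l : 'I_n -> R) :
  A^T = A -> char_poly A = \prod_(i < n) ('X - (l i)%:P) ->
  exists2 Q : 'M[R]_n, Q *m Q^T = 1%:M
    & A = Q^T *m diag_mx (\row_i l i) *m Q.
Proof.
elim: n A l => [|n ih] A l AT Al.
  by exists 1%:M; [rewrite mul1mx trmx1|apply/matrixP => -[]].
have : eigenvalue A (l ord0).
  rewrite eigenvalue_root_char Al big_ord_recl rootM root_XsubC eqxx.
  by [].
move=> /eigenvalueP[v vA v0].
have vv := row_sqnorm_gt0 v0.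
pose c := (v *m v^T) 0 0; have c0 : 0 < c by [].
pose u := (Num.sqrt c)^-1 *: v.
have uu : u *m u^T = 1%:M.
  rewrite /u linearZ /= -scalemxAl -scalemxAr [v *m _]mx11_scalar -/c scalerA.
  by rewrite -invfM -expr2 sqr_sqrtr ?ltW// scale_scalar_mx mulVf ?gt_eqF.
have uA : u *m A = l ord0 *: u.
  by rewrite /u -scalemxAl vA scalerA mulrC -scalerA.
pose e : 'rV[R]_(1 + n) := row_mx 1%:M 0.
have ee : e *m e^T = 1%:M.
  by rewrite /e tr_row_mx mul_row_col trmx1 mulmx1 mul0mx addr0.
have [H [HT HH eH]] := householder ee uu.
pose B : 'M[R]_(1 + n) := H *m A *m H.
have BT : B^T = B by rewrite /B !trmx_mul HT AT mulmxA.
have uH : u *m H = e by rewrite -eH -mulmxA HH mulmx1.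
have eB : e *m B = l ord0 *: e.
  by rewrite /B !mulmxA eH uA -scalemxAl uH.
pose B' := drsubmx B.
have BE : B = block_mx (l ord0)%:M 0 0 B'.
  have ur : row_mx (ulsubmx B) (ursubmx B) = row_mx (l ord0)%:M 0.
    move: eB; rewrite -{1}[B]submxK /e mul_row_block !mul1mx !mul0mx !addr0.
    by rewrite scale_row_mx scaler0 scalemx1.
  have [ul ur0] := eq_row_mx ur.
  have dl : dlsubmx B = 0.
    by rewrite -[dlsubmx B]trmxK trmx_dlsub BT ur0 trmx0.
  by rewrite -[LHS]submxK ul ur0 dl.
have B'T : B'^T = B' by rewrite /B' trmx_drsub BT.
have B'l : char_poly B' = \prod_(i < n) ('X - (l (lift ord0 i))%:P).
  have : char_poly B = ('X - (l ord0)%:P) * char_poly B'.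
    rewrite BE /char_poly /char_poly_mx.
    rewrite map_block_mx !map_mx0 map_scalar_mx scalar_mx_block opp_block_mx add_block_mx.
    rewrite !oppr0 !addr0 det_ublock; congr (_ * _).
    by rewrite -raddfB det_scalar1.
  rewrite char_poly_conj// Al big_ord_recl => /mulfI -> //.
  by rewrite polyXsubC_eq0.
have [Q0 Q0Q0 B'E] := ih B' _ B'T B'l.
pose Q1 : 'M[R]_(1 + n) := block_mx 1%:M 0 0 Q0.
have Q1Q1 : Q1 *m Q1^T = 1%:M.
  rewrite /Q1 tr_block_mx mulmx_block !trmx0 !mulmx0 !mul0mx !addr0 !add0r trmx1.
  by rewrite mulmx1 Q0Q0 -scalar_mx_block.
exists (Q1 *m H).
  by rewrite trmx_mul HT mulmxA -(mulmxA Q1) HH mulmx1.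
have AE : A = H *m B *m H.
  by rewrite /B !mulmxA HH mul1mx -mulmxA HH mulmx1.
pose D1 : 'M[R]_(1 + n) :=
  block_mx (l ord0)%:M 0 0 (diag_mx (\row_i l (lift ord0 i))).
have D1E : @diag_mx R (1 + n) (\row_i l i) = D1.
  have -> : (\row_i l i : 'rV[R]_(1 + n)) =
      row_mx (l ord0)%:M (\row_i l (lift ord0 i)) :> 'rV[R]_(1 + n).
    apply/rowP => i; rewrite !mxE; case: splitP => j ij; rewrite !mxE.
      by rewrite !ord1 eqxx mulr1n; congr l; apply: val_inj; rewrite /= ij ord1.
    by congr l; apply: val_inj; rewrite /= ij.
  rewrite diag_mx_row; congr block_mx.
  by apply/matrixP => i j; rewrite !mxE !ord1 eqxx.
have BQ : B = Q1^T *m D1 *m Q1.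
  rewrite BE B'E /Q1 /D1 tr_block_mx !mulmx_block !trmx0 !mulmx0 !mul0mx.
  by rewrite !addr0 !add0r trmx1 !mulmx1 !mul1mx !mul0mx.
rewrite -[diag_mx (\row_i l i)]/(@diag_mx R (1 + n) (\row_i l i)) D1E.
by rewrite trmx_mul HT [LHS]AE BQ !mulmxA.
Qed.

End symmetric_diagonalisation.

(** * The sign function and its second-order projection *)

Section sign_kernel.
Context {R : realType}.

Lemma gt22E (x y z t : R) : gt22 x y z t = lt22 z t x y. Proof. by []. Qed.

Lemma lt22_sym (x y z t : R) : lt22 x y z t = lt22 y x t z.
Proof. by rewrite /lt22 maxC minC. Qed.

Lemma sign_a_swap12 (x y z t : R) : sign_a x z y t = - sign_a x y z t.
Proof. by rewrite /sign_a !gt22E; ring. Qed.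

Lemma sign_a_swap03 (x y z t : R) : sign_a t y z x = - sign_a x y z t.
Proof.
rewrite /sign_a !gt22E (lt22_sym t z) (lt22_sym y x) (lt22_sym t y) (lt22_sym z x).
by ring.
Qed.

Variables (r : nat) (p : 'I_r -> R) (u : 'I_r -> R).
Hypothesis p1 : \sum_i p i = 1.

(** The second-order projection of the sign function, its first two arguments
    being fixed. *)
Definition sign_kernel (i j : 'I_r) : R :=
  \sum_k \sum_l p k * p l * sign_a (u i) (u j) (u k) (u l).

Definition mean2 (F : 'I_r -> 'I_r -> R) : R := \sum_k \sum_l p k * p l * F k l.

Lemma mean2C F : mean2 F = mean2 (fun k l => F l k).
Proof.
rewrite /mean2 exchange_big; apply: eq_bigr => k _; apply: eq_bigr => l _.
by rewrite [p l * _]mulrC.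
Qed.

Lemma mean2N F : mean2 (fun k l => - F k l) = - mean2 F.
Proof.
rewrite /mean2 -sumrN; apply: eq_bigr => k _; rewrite -sumrN.
by apply: eq_bigr => l _; rewrite mulrN.
Qed.

Lemma eq_mean2 F G : (forall k l, F k l = G k l) -> mean2 F = mean2 G.
Proof. by move=> FG; apply: eq_bigr => k _; apply: eq_bigr => l _; rewrite FG. Qed.

Lemma mean2_antisym F : (forall k l, F l k = - F k l) -> mean2 F = 0.
Proof.
move=> FN; have : mean2 F = - mean2 F by rewrite {1}mean2C (eq_mean2 FN) mean2N.
lra.
Qed.

(** The six averages of the sign function over two of its arguments, named by the
    positions that are averaged, counted from 0. The pairs exchanged by one of the two
    antisymmetries give 0, the four others give the kernel up to sign. *)
Lemma sign_mean23 i j : mean2 (fun k l => sign_a (u i) (u j) (u k) (u l)) = sign_kernel i j.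
Proof. by []. Qed.

Lemma sign_mean13 i j : mean2 (fun k l => sign_a (u i) (u k) (u j) (u l)) = - sign_kernel i j.
Proof. by rewrite -sign_mean23 -mean2N; apply: eq_mean2 => k l; rewrite sign_a_swap12. Qed.

Lemma sign_mean12 i j : mean2 (fun k l => sign_a (u i) (u k) (u l) (u j)) = 0.
Proof. by apply: mean2_antisym => k l; rewrite sign_a_swap12. Qed.

Lemma sign_mean03 i j : mean2 (fun k l => sign_a (u k) (u i) (u j) (u l)) = 0.
Proof. by apply: mean2_antisym => k l; rewrite sign_a_swap03. Qed.

Lemma sign_mean02 i j : mean2 (fun k l => sign_a (u k) (u i) (u l) (u j)) = - sign_kernel j i.
Proof.
rewrite -sign_mean23 -mean2N mean2C; apply: eq_mean2 => k l.
by rewrite sign_a_swap03.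
Qed.

Lemma sign_mean01 i j : mean2 (fun k l => sign_a (u k) (u l) (u i) (u j)) = sign_kernel j i.
Proof.
rewrite -sign_mean23 mean2C; apply: eq_mean2 => k l.
by rewrite sign_a_swap03 sign_a_swap12 opprK.
Qed.

(** The average over [j] and [k] comes first: these are the two middle arguments. *)
Lemma sign_kernel_degenerate i : \sum_j p j * sign_kernel i j = 0.
Proof.
have -> : \sum_j p j * sign_kernel i j =
   \sum_l p l * mean2 (fun j k => sign_a (u i) (u j) (u k) (u l)).
  rewrite /sign_kernel /mean2.
  under eq_bigr => j _ do rewrite mulr_sumr.
  under [RHS]eq_bigr => l _ do rewrite mulr_sumr.
  under eq_bigr => j _ do under eq_bigr => k _ do rewrite mulr_sumr.
  under [RHS]eq_bigr => l _ do under eq_bigr => j _ do rewrite mulr_sumr.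
  under eq_bigr => j _ do rewrite exchange_big.
  rewrite exchange_big; apply: eq_bigr => l _; apply: eq_bigr => j _.
  by apply: eq_bigr => k _; ring.
by rewrite big1// => l _; rewrite sign_mean12 mulr0.
Qed.

End sign_kernel.

Section product_kernel.
Context {R : realType} {r s : nat}.
Variables (pX : 'I_r -> R) (u : 'I_r -> R) (pY : 'I_s -> R) (v : 'I_s -> R).
Hypotheses (pX1 : \sum_i pX i = 1) (pY1 : \sum_j pY j = 1).
Variables (I : finType) (w : I -> R) (xi : 'I_r * 'I_s -> I -> R).

Local Notation S := ('I_r * 'I_s)%type.
Definition joint_pmf (z : S) : R := pX z.1 * pY z.2.
Definition joint_sign (z0 z1 z2 z3 : S) : R :=
  sign_a (u z0.1) (u z1.1) (u z2.1) (u z3.1) *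
  sign_a (v z0.2) (v z1.2) (v z2.2) (v z3.2).
Local Notation p := joint_pmf.
Local Notation gX := (sign_kernel pX u).
Local Notation gY := (sign_kernel pY v).
Local Notation G := (spectral_kernel w xi).

Hypothesis GE : forall z z', G z z' = gX z.1 z'.1 * gY z.2 z'.2.

Lemma joint_pmf_sum : \sum_z p z = 1.
Proof.
rewrite -(pair_bigA _ (fun i j => pX i * pY j))/= -pX1; apply: eq_bigr => i _.
by rewrite -mulr_sumr pY1 mulr1.
Qed.

Let GC z z' : G z z' = G z' z.
Proof. by apply: eq_bigr => k _; rewrite [xi z k * _]mulrC. Qed.

Lemma joint_kernel_degenerate z : \sum_z' p z' * G z z' = 0.
Proof.
under eq_bigr do rewrite GE.
rewrite -(pair_bigA _ (fun i j => pX i * pY j * (gX z.1 i * gY z.2 j)))/=.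
transitivity (\sum_i (pX i * gX z.1 i) * \sum_j pY j * gY z.2 j).
  by apply: eq_bigr => i _; rewrite mulr_sumr; apply: eq_bigr => j _; ring.
by rewrite -mulr_suml sign_kernel_degenerate// mul0r.
Qed.

Let E2 (F : S -> S -> R) : R := \sum_s \sum_t p s * p t * F s t.

Let eq_E2 F F' : (forall s t, F s t = F' s t) -> E2 F = E2 F'.
Proof. by move=> FF; apply: eq_bigr => z _; apply: eq_bigr => t _; rewrite FF. Qed.

Let E2D F F' : E2 (fun s t => F s t + F' s t) = E2 F + E2 F'.
Proof.
rewrite /E2 -big_split; apply: eq_bigr => z _; rewrite -big_split.
by apply: eq_bigr => t _; rewrite mulrDr.
Qed.

Let E2N F : E2 (fun s t => - F s t) = - E2 F.
Proof.
rewrite /E2 -sumrN; apply: eq_bigr => z _; rewrite -sumrN.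
by apply: eq_bigr => t _; rewrite mulrN.
Qed.

Let E2l (f : S -> R) : E2 (fun s _ => f s) = \sum_s p s * f s.
Proof.
apply: eq_bigr => z _; rewrite -[RHS]mulr1 -joint_pmf_sum mulr_sumr.
by apply: eq_bigr => t _; ring.
Qed.

Let E2r (f : S -> R) : E2 (fun _ t => f t) = \sum_s p s * f s.
Proof. by rewrite /E2 exchange_big -E2l; apply: eq_bigr => z _; apply: eq_bigr => t _; ring. Qed.

Let E2c c : E2 (fun _ _ => c) = c.
Proof. by rewrite E2l -mulr_suml joint_pmf_sum mul1r. Qed.

Let E2Gl z : E2 (fun s _ => G s z) = 0.
Proof. by rewrite E2l; under eq_bigr do rewrite GC; exact: joint_kernel_degenerate. Qed.
Let E2Glr z : E2 (fun s _ => G z s) = 0.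
Proof. by rewrite E2l; exact: joint_kernel_degenerate. Qed.
Let E2Gr z : E2 (fun _ t => G t z) = 0.
Proof. by rewrite E2r; under eq_bigr do rewrite GC; exact: joint_kernel_degenerate. Qed.
Let E2Grr z : E2 (fun _ t => G z t) = 0.
Proof. by rewrite E2r; exact: joint_kernel_degenerate. Qed.
Let E2G : E2 (fun s t => G s t) = 0.
Proof.
rewrite /E2 big1// => z _; under eq_bigr do rewrite -mulrA.
by rewrite -mulr_sumr joint_kernel_degenerate mulr0.
Qed.
Let E2Gt : E2 (fun s t => G t s) = 0.
Proof. by rewrite -E2G; apply: eq_bigr => z _; apply: eq_bigr => t _; rewrite GC. Qed.

Let E2prod (FX : 'I_r -> 'I_r -> R) (FY : 'I_s -> 'I_s -> R) :
  E2 (fun s t => FX s.1 t.1 * FY s.2 t.2) = mean2 pX FX * mean2 pY FY.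
Proof.
rewrite /E2 -(pair_bigA _ (fun i j => \sum_t p (i, j) * p t * (FX i t.1 * FY j t.2)))/=.
rewrite /mean2 mulr_suml; apply: eq_bigr => i _.
rewrite [RHS]mulrC mulr_suml; apply: eq_bigr => j _.
rewrite -(pair_bigA _ (fun k l => p (i, j) * p (k, l) * (FX i k * FY j l)))/=.
rewrite mulrC mulr_suml; apply: eq_bigr => k _; rewrite mulr_sumr.
by apply: eq_bigr => l _; rewrite /p /=; ring.
Qed.

Let E2res A B1 B2 B3 B4 :
  E2 (fun s t => A s t - (B1 s t + B2 s t + B3 s t + B4 s t)) =
  E2 A - (E2 B1 + E2 B2 + E2 B3 + E2 B4).
Proof. by rewrite E2D E2N !E2D. Qed.

(** Averages of the product kernel are products of averages: for a pair of
    positions with one outer and one middle argument the signs cancel and [G] at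
    the two other positions comes out, which is the only one of the four
    subtracted terms that survives the averaging. For the other two pairs both
    sides are 0. *)
Lemma joint_sign_degenerate :
  degenerate2 p (residual_kernel w xi joint_sign).
Proof.
have E2_simp := (E2G, E2Gt, E2Gl, E2Glr, E2Gr, E2Grr, E2c).
pose av a b z := E2 (fun s t =>
  residual_kernel w xi joint_sign (resample (resample z b t) a s)).
have sym (a b : 'I_4) : a != b -> (forall z, av a b z = 0) -> forall z, av b a z = 0.
  move=> ab H z; rewrite /av /E2 exchange_big -[RHS](H z).
  apply: eq_bigr => s0 _; apply: eq_bigr => t0 _; rewrite [p t0 * _]mulrC.
  congr (_ * _ * residual_kernel _ _ _ _); apply/ffunP => c; rewrite !ffunE.
  by case: (eqVneq c b) => [->|//]; rewrite eq_sym (negbTE ab).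
have c01 z : av i0 i1 z = 0.
  transitivity (E2 (fun s t => joint_sign s t (z i2) (z i3)
    - (G s t + G s (z i2) + G (z i3) t + G (z i3) (z i2)))).
    by apply: eq_E2 => x y; rewrite /residual_kernel !ffunE.
  rewrite E2res (E2prod (fun k l => sign_a (u k) (u l) (u (z i2).1) (u (z i3).1))
    (fun k l => sign_a (v k) (v l) (v (z i2).2) (v (z i3).2))).
  by rewrite !sign_mean01 ?E2_simp ?GE; ring.
have c02 z : av i0 i2 z = 0.
  transitivity (E2 (fun s t => joint_sign s (z i1) t (z i3)
    - (G s (z i1) + G s t + G (z i3) (z i1) + G (z i3) t))).
    by apply: eq_E2 => x y; rewrite /residual_kernel !ffunE.
  rewrite E2res (E2prod (fun k l => sign_a (u k) (u (z i1).1) (u l) (u (z i3).1))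
    (fun k l => sign_a (v k) (v (z i1).2) (v l) (v (z i3).2))).
  by rewrite !sign_mean02 ?E2_simp ?GE; ring.
have c03 z : av i0 i3 z = 0.
  transitivity (E2 (fun s t => joint_sign s (z i1) (z i2) t
    - (G s (z i1) + G s (z i2) + G t (z i1) + G t (z i2)))).
    by apply: eq_E2 => x y; rewrite /residual_kernel !ffunE.
  rewrite E2res (E2prod (fun k l => sign_a (u k) (u (z i1).1) (u (z i2).1) (u l))
    (fun k l => sign_a (v k) (v (z i1).2) (v (z i2).2) (v l))).
  by rewrite !sign_mean03 ?E2_simp ?GE; ring.
have c12 z : av i1 i2 z = 0.
  transitivity (E2 (fun s t => joint_sign (z i0) s t (z i3)
    - (G (z i0) s + G (z i0) t + G (z i3) s + G (z i3) t))).
    by apply: eq_E2 => x y; rewrite /residual_kernel !ffunE.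
  rewrite E2res (E2prod (fun k l => sign_a (u (z i0).1) (u k) (u l) (u (z i3).1))
    (fun k l => sign_a (v (z i0).2) (v k) (v l) (v (z i3).2))).
  by rewrite !sign_mean12 ?E2_simp ?GE; ring.
have c13 z : av i1 i3 z = 0.
  transitivity (E2 (fun s t => joint_sign (z i0) s (z i2) t
    - (G (z i0) s + G (z i0) (z i2) + G t s + G t (z i2)))).
    by apply: eq_E2 => x y; rewrite /residual_kernel !ffunE.
  rewrite E2res (E2prod (fun k l => sign_a (u (z i0).1) (u k) (u (z i2).1) (u l))
    (fun k l => sign_a (v (z i0).2) (v k) (v (z i2).2) (v l))).
  by rewrite !sign_mean13 ?E2_simp ?GE; ring.
have c23 z : av i2 i3 z = 0.
  transitivity (E2 (fun s t => joint_sign (z i0) (z i1) s t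
    - (G (z i0) (z i1) + G (z i0) s + G t (z i1) + G t s))).
    by apply: eq_E2 => x y; rewrite /residual_kernel !ffunE.
  rewrite E2res (E2prod (fun k l => sign_a (u (z i0).1) (u (z i1).1) (u k) (u l))
    (fun k l => sign_a (v (z i0).2) (v (z i1).2) (v k) (v l))).
  by rewrite !sign_mean23 ?E2_simp ?GE; ring.
move=> a b z.
case: (I4P a) => ->.
- case: (I4P b) => ->;
    [by rewrite eqxx
    |by move=> _; exact: c01
    |by move=> _; exact: c02
    |by move=> _; exact: c03].
- case: (I4P b) => ->;
    [by move=> ab; exact: (sym i0 i1 isT c01)
    |by rewrite eqxx
    |by move=> _; exact: c12
    |by move=> _; exact: c13].
- case: (I4P b) => ->;
    [by move=> ab; exact: (sym i0 i2 isT c02)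
    |by move=> ab; exact: (sym i1 i2 isT c12)
    |by rewrite eqxx
    |by move=> _; exact: c23].
- case: (I4P b) => ->;
    [by move=> ab; exact: (sym i0 i3 isT c03)
    |by move=> ab; exact: (sym i1 i3 isT c13)
    |by move=> ab; exact: (sym i2 i3 isT c23)
    |by rewrite eqxx].
Qed.

End product_kernel.

(** * The matrix of a finitely supported variable *)

Section discrete_law.
Context d (T : measurableType d) (R : realType) (P : probability T R).
Variables (U : {RV P >-> R}) (r : nat) (u : 'I_r -> R).
Hypothesis supp : enumerates_support P U u.

Local Notation p i := (pmf U (u i)).

Let u_inj : injective u. Proof. by case: supp. Qed.

Lemma pmf_support_gt0 i : 0 < p i.
Proof.
case: supp => _ E _.
have : [set x | 0 < pmf U x] (u i) by rewrite E; exists i.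
by [].
Qed.

Let atom i : set T := U @^-1` [set u i].

Let measurable_atom i : measurable (atom i).
Proof. by apply: measurable_funPTI; exact: measurable_set1. Qed.

Let atoms_disjoint : trivIset setT atom.
Proof. by move=> i j _ _ [w [/= a b]]; apply: u_inj; rewrite -a -b. Qed.

Let atoms_full : P (\bigcup_i atom i) = 1%E.
Proof.
case: supp => _ _ <-; congr (P _); apply/seteqP; split => w /=.
  by move=> [i _ Ui]; exists i => //; rewrite Ui.
by move=> [i _ ui]; exists i => //; exact: esym.
Qed.

Let support_sum (B : pred 'I_r) :
  fine (P (\bigcup_(i in [set i | B i]) atom i)) = \sum_(i | B i) p i.
Proof. by rewrite fine_probability_sum. Qed.

Lemma pmf_support_sum : \sum_i p i = 1.
Proof.
rewrite -(support_sum xpredT) (_ : [set i | true] = setT).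
  by rewrite atoms_full.
by apply/seteqP.
Qed.

(** Outside of the atoms the variable only takes values on a null event. *)
Lemma cdf_support x : fine (cdf U x) = \sum_i p i * (u i <= x)%R%:R.
Proof.
have mA : measurable (U @^-1` `]-oo, x]) by exact: measurable_funPTI.
have mB (B : pred 'I_r) : measurable (\bigcup_(i in [set i | B i]) atom i).
  by apply: fin_bigcup_measurable => //; exact: finite_finset.
transitivity (fine (P (\bigcup_(i in [set i | u i <= x]) atom i))); last first.
  rewrite (support_sum (fun i => u i <= x)) big_mkcond; apply: eq_bigr => i _.
  by case: ifP; rewrite ?mulr1 ?mulr0.
rewrite -[cdf U x]/(P (U @^-1` `]-oo, x])); apply/eqP; rewrite eq_le; apply/andP; split.
  have mT : measurable (\bigcup_i atom i).
    by have := mB xpredT; rewrite (_ : [set i | true] = setT)//; apply/seteqP.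
  have null : fine (P (~` \bigcup_i atom i)) = 0.
    by rewrite probability_setC// atoms_full subee.
  rewrite -[leRHS]addr0 -null; apply: fine_probability_subadd => //.
    exact: measurableC.
  move=> w /=; rewrite in_itv/= => Ux.
  have [[i _ /= ui]|] := pselect ((\bigcup_i atom i) w); last by right.
  by left; exists i => //=; rewrite -ui.
apply: fine_probability_le => // w [i /= ui Ui].
by rewrite /= in_itv /= Ui.
Qed.

Local Notation F x := (fine (cdf U x)).

Let tail x : \sum_i p i * (x < u i)%R%:R = 1 - F x.
Proof.
rewrite -[X in _ = X - _]pmf_support_sum cdf_support -sumrB; apply: eq_bigr => i _.
by case: ltrP => _; rewrite /= ?mulr1 ?mulr0 ?subrr ?subr0.
Qed.

Let below i : \sum_j p j * (u j < u i)%R%:R = F (u i) - p i.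
Proof.
rewrite cdf_support [in RHS](bigD1 i)//= lexx mulr1 addrAC subrr add0r.
rewrite (bigD1 i)//= ltxx mulr0 add0r; apply: eq_bigr => j ji.
by rewrite lt_neqAle (inj_eq u_inj) ji.
Qed.

Local Notation g := (sign_kernel (fun i => p i) u).

Let between i j : u i < u j ->
  \sum_k \sum_l p k * p l * (lt22 (u i) (u k) (u j) (u l))%:R =
  F (u i) * (1 - F (u i)) + \sum_(l < r | u i < u l < u j) p l * (1 - F (u l)).
Proof.
move=> ij.
transitivity (\sum_k p k * (u k < u j)%R%:R * (1 - F (Num.max (u i) (u k)))).
  apply: eq_bigr => k _; rewrite -tail mulr_sumr; apply: eq_bigr => l _.
  rewrite /lt22 lt_min !gt_max ij /=.
  by case: (u k < u j); rewrite /= ?andbF ?mulr0 ?mul0r ?mulr1//= !mulrA.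
rewrite cdf_support [X in X * _](eq_bigr (fun k => if u k <= u i then p k else 0)); last first.
  by move=> k _; case: ifP; rewrite ?mulr1 ?mulr0.
rewrite mulr_suml [X in _ + X]big_mkcond -big_split; apply: eq_bigr => k _ /=.
case: (lerP (u k) (u i)) => ki.
  by rewrite (le_lt_trans ki ij) mulr1 /= addr0 -cdf_support.
rewrite mul0r add0r /=.
by case: (u k < u j); rewrite ?mulr1 ?mulr0 ?mul0r.
Qed.

Let lt22_tail a b : \sum_k \sum_l p k * p l * (lt22 a b (u k) (u l))%:R =
  (1 - F (Num.max a b)) ^+ 2.
Proof.
rewrite -tail expr2 big_distrlr /=; apply: eq_bigr => k _; apply: eq_bigr => l _.
rewrite /lt22 lt_min.
by case: (_ < u k); case: (_ < u l); rewrite /= ?mulr0 ?mul0r ?mulr1.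
Qed.

Let lt22_below i j : \sum_k \sum_l p k * p l * (lt22 (u k) (u l) (u i) (u j))%:R =
  (F (Num.min (u i) (u j)) - pmf U (Num.min (u i) (u j))) ^+ 2.
Proof.
have [m mE] : exists m, Num.min (u i) (u j) = u m.
  by rewrite /Num.min; case: ifP => _; [exists i|exists j].
rewrite mE -below expr2 big_distrlr /=; apply: eq_bigr => k _; apply: eq_bigr => l _.
rewrite /lt22 mE gt_max.
by case: (u k < _); case: (u l < _); rewrite /= ?mulr0 ?mul0r ?mulr1.
Qed.

Let lt22_ge i j k l : u j <= u i -> lt22 (u i) (u k) (u j) (u l) = false.
Proof. by move=> ji; rewrite /lt22 lt_min !gt_max ltNge ji. Qed.

Let sum2C (f : 'I_r -> 'I_r -> R) :
  \sum_k \sum_l p k * p l * f l k = \sum_k \sum_l p k * p l * f k l.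
Proof.
rewrite exchange_big; apply: eq_bigr => k _; apply: eq_bigr => l _.
by rewrite [p l * _]mulrC.
Qed.

(** Up to the weights and the sign, the matrix is the second-order projection
    of the sign function read on the atoms. *)
Lemma R_mx_sign_kernel i j :
  R_mx P U u i j = - (Num.sqrt (p i * p j) * g i j).
Proof.
rewrite mxE -mulrN; congr (_ * _).
have gE : g i j = \sum_k \sum_l p k * p l * (lt22 (u i) (u k) (u j) (u l))%:R
    + \sum_k \sum_l p k * p l * (lt22 (u j) (u k) (u i) (u l))%:R
    - (1 - F (Num.max (u i) (u j))) ^+ 2
    - (F (Num.min (u i) (u j)) - pmf U (Num.min (u i) (u j))) ^+ 2.
  rewrite -lt22_tail -lt22_below -(sum2C (fun k l => (lt22 (u j) (u k) (u i) (u l))%:R)).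
  rewrite /sign_kernel -big_split -!sumrB; apply: eq_bigr => k _ /=.
  rewrite -big_split -!sumrB; apply: eq_bigr => l _ /=.
  by rewrite /sign_a !gt22E; ring.
have zero a b : u b <= u a ->
    \sum_k \sum_l p k * p l * (lt22 (u a) (u k) (u b) (u l))%:R = 0 :> R.
  move=> ba; rewrite big1// => k _; rewrite big1// => l _.
  by rewrite lt22_ge// mulr0.
rewrite gE; case: (ltgtP (u i) (u j)) => ij.
- rewrite (between ij) (zero j i (ltW ij)).
  by rewrite /=; ring.
- rewrite (between ij) (zero i j (ltW ij)).
  by rewrite /=; ring.
- rewrite !zero ?ij//=.
  by ring.
Qed.

Lemma R_mx_sym : (R_mx P U u)^T = R_mx P U u.
Proof.
apply/matrixP => i j; rewrite !mxE [u j == u i]eq_sym.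
by rewrite [p j * _]mulrC (minC (u j)) (maxC (u j)).
Qed.

(** Dividing the coordinates of orthonormal eigenvectors by the square roots of
    the weights gives functions that are orthonormal for the law, and that
    diagonalise the kernel. Those with a non-zero eigenvalue are orthogonal to
    the constants, which the kernel annihilates. *)
Lemma sign_kernel_spectral (l : 'I_r -> R) : eigenvalues_of (R_mx P U u) l ->
  exists phi : 'I_r -> 'I_r -> R,
  [/\ forall k k', \sum_i p i * (phi i k * phi i k') = (k == k')%:R,
      forall i j, g i j = - \sum_k l k * (phi i k * phi j k)
    & forall k, l k != 0 -> \sum_i p i * phi i k = 0].
Proof.
case/(symmetric_orthogonal_diagonalisation R_mx_sym) => Q QQ RE.
pose q i : R := Num.sqrt (p i).
have q0 i : 0 < q i by rewrite sqrtr_gt0 pmf_support_gt0.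
have qq i : q i ^+ 2 = p i by rewrite sqr_sqrtr// ltW// pmf_support_gt0.
pose phi i k := Q k i / q i.
have orth k k' : \sum_i p i * (phi i k * phi i k') = (k == k')%:R.
  have := congr1 (fun M : 'M[R]_r => M k k') QQ; rewrite !mxE => <-.
  apply: eq_bigr => i _; rewrite mxE /phi -qq.
  by field; rewrite gt_eqF.
have spec i j : g i j = - \sum_k l k * (phi i k * phi j k).
  have := R_mx_sign_kernel i j; rewrite RE sqrtrM ?(ltW (pmf_support_gt0 i))// -/(q i) -/(q j).
  rewrite mxE => e.
  have -> : g i j = - (- (q i * q j * g i j) / (q i * q j)).
    by field; rewrite !gt_eqF.
  rewrite -e mulr_suml; congr (- _); apply: eq_bigr => k _.
  rewrite mul_mx_diag !mxE /phi.
  by field; rewrite !gt_eqF.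
exists phi; split => // k lk.
have step j : l k * phi j k = - \sum_i p i * phi i k * g i j.
  under eq_bigr do rewrite spec mulrN mulr_sumr.
  rewrite sumrN opprK exchange_big /=.
  transitivity (\sum_k' l k' * phi j k' * (k == k')%:R).
    rewrite (bigD1 k)//= eqxx mulr1 big1 ?addr0// => k' /negbTE.
    by rewrite eq_sym => ->; rewrite mulr0.
  apply: eq_bigr => k' _; rewrite -orth mulr_sumr; apply: eq_bigr => i _.
  by ring.
apply: (mulfI lk); rewrite mulr0 mulr_sumr.
transitivity (- \sum_i p i * phi i k * \sum_j p j * g i j).
  rewrite -sumrN; under [RHS]eq_bigr do rewrite mulr_sumr -sumrN.
  rewrite exchange_big; apply: eq_bigr => j _ /=.
  rewrite mulrCA step mulrN mulr_sumr -sumrN; apply: eq_bigr => i _.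
  by ring.
rewrite big1 ?oppr0// => i _.
by rewrite sign_kernel_degenerate ?mulr0// pmf_support_sum.
Qed.

End discrete_law.

(** * The statistic of an independent sample *)

Section sampling.
Context (R : realType) d0 (T0 : measurableType d0) (P0 : probability T0 R).
Variables (X Y : {RV P0 >-> R}) (r s : nat) (u : 'I_r -> R) (v : 'I_s -> R).
Hypothesis XY_indep : independent_RV P0 X Y.
Hypotheses (X_supp : enumerates_support P0 X u) (Y_supp : enumerates_support P0 Y v).
Context d (T : measurableType d) (P : probability T R).
Variables (X_ Y_ : nat -> {RV P >-> R}).
Hypothesis sample_indep :
  mutually_independent P (fun n => pair_RV (X_ n) (Y_ n)).
Hypothesis sample_law : forall n,
  same_distribution P P0 (pair_RV (X_ n) (Y_ n)) (pair_RV X Y).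

Local Notation S := ('I_r * 'I_s)%type.
Local Notation p := (joint_pmf (fun i => pmf X (u i)) (fun j => pmf Y (v j))).

Let point (z : S) : set (R * R) := [set (u z.1, v z.2)].

Let measurable_point z : measurable (point z).
Proof.
rewrite /point (_ : [set _] = [set u z.1] `*` [set v z.2]).
  by apply: measurableX; exact: measurable_set1.
by apply/seteqP; split => [[a b] [-> ->]|[a b] /= [-> ->]].
Qed.

Let point_law n z : fine (P (pair_RV (X_ n) (Y_ n) @^-1` point z)) = p z.
Proof.
rewrite -[P _]/(distribution P (pair_RV (X_ n) (Y_ n)) (point z)) sample_law//.
rewrite /distribution /pushforward.
have -> : pair_RV X Y @^-1` point z = X @^-1` [set u z.1] `&` Y @^-1` [set v z.2].
  apply/seteqP; split => w; first by case.
  by rewrite /point /pair_RV /= => -[-> ->].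
rewrite XY_indep; [|exact: measurable_set1|exact: measurable_set1].
by rewrite fineM ?fin_num_measure.
Qed.

Let observed n (om : {ffun 'I_n -> S}) : set T :=
  \bigcap_(i in [set: 'I_n]) (pair_RV (X_ i) (Y_ i) @^-1` point (om i)).

Let measurable_observed n (om : {ffun 'I_n -> S}) : measurable (observed om).
Proof.
apply: fin_bigcap_measurable; first exact: finite_finset.
by move=> i _; exact: measurable_funPTI.
Qed.

Let observed_prob n (om : {ffun 'I_n -> S}) :
  fine (P (observed om)) = \prod_i p (om i).
Proof.
(* independence is stated for families of events indexed by all of [nat] *)
pose A (i : nat) : set (R * R) := if insub i is Some i' then point (om i') else setT.
have mA i : measurable (A i) by rewrite /A; case: insubP.
pose J := [fset i in iota 0 n]%fset.
have AE (i : 'I_n) : A i = point (om i) by rewrite /A valK.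
have JE : \bigcap_(i in [set` J]) (pair_RV (X_ i) (Y_ i) @^-1` A i) = observed om.
  apply/seteqP; split => w h i.
    move=> _; have := h (val i); rewrite /= AE; apply.
    by rewrite /= inE mem_iota /=.
  rewrite /= inE mem_iota /= add0n => ltin.
  by have := h (Ordinal ltin) I; rewrite /= -AE.
rewrite -JE (sample_indep J mA).
have -> : (\prod_(i <- J) P (pair_RV (X_ i) (Y_ i) @^-1` A i) =
   \prod_(i < n) P (pair_RV (X_ i) (Y_ i) @^-1` A i))%E.
  rewrite -(big_mkord xpredT (fun i => P (pair_RV (X_ i) (Y_ i) @^-1` A i))).
  apply: perm_big; apply: uniq_perm; rewrite ?fset_uniq ?iota_uniq// => i.
  by rewrite mem_index_iota inE mem_iota add0n.
have fP (i : 'I_n) : P (pair_RV (X_ i) (Y_ i) @^-1` A i) = (p (om i))%:E.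
  by rewrite -(point_law i) AE fineK// fin_num_measure//; exact: measurable_funPTI.
by rewrite (eq_bigr _ (fun i _ => fP i)) -(big_morph EFin (@EFinM R) erefl).
Qed.

Let u_inj : injective u. Proof. by case: X_supp. Qed.
Let v_inj : injective v. Proof. by case: Y_supp. Qed.

Let observed_disjoint n : trivIset setT (@observed n).
Proof.
move=> om om' _ _ [w [h h']]; apply/ffunP => i.
have := h i I; have := h' i I; rewrite /point /= => -[e1 e2] [e3 e4].
rewrite [om i]surjective_pairing [om' i]surjective_pairing; congr pair.
  by apply: u_inj; rewrite -e3 -e1.
by apply: v_inj; rewrite -e4 -e2.
Qed.

Lemma sample_weight_sum : \sum_z p z = 1.
Proof. by apply: joint_pmf_sum; apply: pmf_support_sum. Qed.

(** The law of a statistic of the sample is a finite sum over the samples of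
    atoms, all other samples being negligible. *)
Lemma n_tstar_law n (t : R) :
  fine (P [set w | n_tstar X_ Y_ n w <= t]) =
  @sample_mean R S p n (fun om =>
    (scaled_u_statistic (joint_sign u v) om <= t)%R%:R).
Proof.
pose stat (om : {ffun 'I_n -> S}) := scaled_u_statistic (joint_sign u v) om.
have statE om w : observed om w -> n_tstar X_ Y_ n w = stat om.
  move=> h; rewrite /n_tstar /tstar /stat /scaled_u_statistic.
  congr (_ * (_ * _)); rewrite /sum_distinct4.
  apply: eq_bigr => i _; apply: eq_bigr => j _; apply: eq_bigr => k _.
  apply: eq_bigr => l _; rewrite /joint_sign.
  have hX m : X_ (val m) w = u (om m).1 by have [] := h m I.
  have hY m : Y_ (val m) w = v (om m).2 by have [] := h m I.
  by rewrite !hX !hY.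
have mB (B : pred {ffun 'I_n -> S}) :
    measurable (\bigcup_(om in [set om | B om]) observed om).
  by apply: fin_bigcup_measurable => //; exact: finite_finset.
have PB (B : pred {ffun 'I_n -> S}) :
    fine (P (\bigcup_(om in [set om | B om]) observed om)) =
    \sum_(om | B om) \prod_i p (om i).
  rewrite fine_probability_sum//; last exact: observed_disjoint.
  by apply: eq_bigr => om _; exact: observed_prob.
have full : fine (P (~` \bigcup_(om in [set om : {ffun 'I_n -> S} | xpredT om]) observed om)) = 0.
  rewrite (probability_setC P (mB xpredT)) fineB ?fin_num_measure ?PB//.
  have := sample_mean_cst sample_weight_sum n 1; rewrite /sample_mean.
  by under eq_bigr do rewrite mulr1; move=> ->; rewrite subrr.
have mW : measurable [set w | n_tstar X_ Y_ n w <= t].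
  have -> : [set w | n_tstar X_ Y_ n w <= t] = n_tstar X_ Y_ n @^-1` `]-oo, t].
    by apply/seteqP; split => w /=; rewrite in_itv.
  exact: measurable_funPTI.
transitivity (fine (P (\bigcup_(om in [set om | stat om <= t]) observed om))).
  apply/eqP; rewrite eq_le; apply/andP; split.
    rewrite -[leRHS]addr0 -full; apply: fine_probability_subadd.
    - exact: mW.
    - exact: (mB (fun om => stat om <= t)).
    - by apply: measurableC; exact: (mB xpredT).
    - move=> w /= wt.
      have [[om _ h]|] :=
        pselect ((\bigcup_(om in [set om : {ffun 'I_n -> S} | xpredT om]) observed om) w);
        last by right.
      by left; exists om => //=; rewrite -(statE om w h).
  apply: fine_probability_le; [exact: (mB (fun om => stat om <= t))|exact: mW|].
  by move=> w [om /= omt h]; rewrite /= (statE om w h).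
rewrite (PB (fun om => stat om <= t)) big_mkcond; apply: eq_bigr => om _.
by rewrite -/(stat om); case: ifP; rewrite ?mulr1 ?mulr0.
Qed.

End sampling.

Unset Implicit Arguments.

Theorem theorem4p5 (R : realType)
  (* (X, Y): independent, with supports enumerated by u and v *)
  (d0 : measure_display) (T0 : measurableType d0) (P0 : probability T0 R)
  (X Y : {RV P0 >-> R}) (r s : nat) (u : 'I_r -> R) (v : 'I_s -> R)
  (XY_indep : independent_RV P0 X Y)
  (X_supp : enumerates_support P0 X u) (Y_supp : enumerates_support P0 Y v)
  (* the sample: i.i.d. copies of (X, Y) *)
  (d : measure_display) (T : measurableType d) (P : probability T R)
  (X_ Y_ : nat -> {RV P >-> R})
  (sample_indep :
     mutually_independent P (fun n => pair_RV (X_ n) (Y_ n)))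
  (sample_law : forall n,
     same_distribution P P0 (pair_RV (X_ n) (Y_ n)) (pair_RV X Y))
  (lX : 'I_r -> R) (lY : 'I_s -> R)
  (lX_eig : eigenvalues_of (R_mx P0 X u) lX)
  (lY_eig : eigenvalues_of (R_mx P0 Y v) lY)
  (* r s i.i.d. chi-square variables with one degree of freedom *)
  (d' : measure_display) (T' : measurableType d') (P' : probability T' R)
  (C : 'I_r * 'I_s -> {RV P' >-> R})
  (C_indep : mutually_independent P' C)
  (C_law : forall ij (A : set R), measurable A ->
     distribution P' (C ij) A = chi_square1 A) :
  cvg_in_distribution P P'
    (fun n => n_tstar X_ Y_ n) (weighted_chi_square lX lY C).
Proof.
have [phi [phi_orth phi_spec phi_centred]] := sign_kernel_spectral X_supp lX_eig.
have [psi [psi_orth psi_spec psi_centred]] := sign_kernel_spectral Y_supp lY_eig.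
pose p := joint_pmf (fun i => pmf X (u i)) (fun j => pmf Y (v j)).
pose w (k : 'I_r * 'I_s) := lX k.1 * lY k.2.
pose xi (z k : 'I_r * 'I_s) := phi z.1 k.1 * psi z.2 k.2.
have p0 z : 0 <= p z by rewrite mulr_ge0 ?pmf_ge0.
have p1 : \sum_z p z = 1 by exact: sample_weight_sum.
have prod_sum (a : 'I_r -> R) (b : 'I_s -> R) :
    \sum_(z : 'I_r * 'I_s) a z.1 * b z.2 = (\sum_i a i) * (\sum_j b j).
  by rewrite big_distrlr /= pair_bigA.
have xi_orth k l : \sum_z p z * (xi z k * xi z l) = (k == l)%:R.
  transitivity ((\sum_i pmf X (u i) * (phi i k.1 * phi i l.1)) *
                (\sum_j pmf Y (v j) * (psi j k.2 * psi j l.2))).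
    rewrite -prod_sum; apply: eq_bigr => z _.
    by rewrite /p /joint_pmf /xi; ring.
  by rewrite phi_orth psi_orth -natrM mulnb -pair_eqE.
have xi_centred k : w k != 0 -> \sum_z p z * xi z k = 0.
  rewrite mulf_eq0 negb_or => /andP[lk _].
  transitivity ((\sum_i pmf X (u i) * phi i k.1) *
                (\sum_j pmf Y (v j) * psi j k.2)).
    rewrite -prod_sum; apply: eq_bigr => z _.
    by rewrite /p /joint_pmf /xi; ring.
  by rewrite phi_centred// mul0r.
have kernelE z z' : spectral_kernel w xi z z' =
    sign_kernel (fun i => pmf X (u i)) u z.1 z'.1 *
    sign_kernel (fun j => pmf Y (v j)) v z.2 z'.2.
  rewrite phi_spec psi_spec mulrNN -prod_sum; apply: eq_bigr => k _.
  by rewrite /w /xi; ring.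
have deg := joint_sign_degenerate (pmf_support_sum X_supp) (pmf_support_sum Y_supp) kernelE.
have limE t : weighted_chi_square lX lY C t = limit_form w C t.
  by rewrite /weighted_chi_square /limit_form pair_bigA /=; congr (_ * _); apply: eq_bigr => -[].
pose F t := fine (P' [set y | limit_form w C y <= t]).
have FE t : cdf (P := P') (weighted_chi_square lX lY C) t = (F t)%:E.
  have e : [set y | limit_form w C y <= t] = weighted_chi_square lX lY C @^-1` `]-oo, t].
    by apply/seteqP; split => y /=; rewrite in_itv /= limE.
  rewrite /F e fineK//.
  by apply: fin_num_measure; exact: measurable_funPTI.
move=> x cx.
have Fx : F y @[y --> x] --> F x.
  have {}cx : cdf (P := P') (weighted_chi_square lX lY C) y @[y --> x] --> (F x)%:E.
    by rewrite -FE; exact: cx.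
  have fineF : fine \o cdf (P := P') (weighted_chi_square lX lY C) = F.
    by apply/funext => t; rewrite /= FE.
  have fc := fine_cvg cx.
  by rewrite fineF in fc; exact: fc.
pose Un n (t : R) := fine (P [set y | n_tstar X_ Y_ n y <= t]).
have UnE n : cdf (P := P) (n_tstar X_ Y_ n) x = (Un n x)%:E.
  have e : [set y | n_tstar X_ Y_ n y <= x] = n_tstar X_ Y_ n @^-1` `]-oo, x].
    by apply/seteqP; split => y /=; rewrite in_itv.
  rewrite /Un e fineK//.
  by apply: fin_num_measure; exact: measurable_funPTI.
rewrite FE (_ : (fun n => _) = fun n => (Un n x)%:E); last first.
  by apply/funext => n; exact: UnE.
apply: cvg_EFin; first by near=> n.
have -> : fine \o (fun n => (Un n x)%:E) = Un^~ x by [].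
apply/cvgrPdist_le => e e0; have e2 : 0 < e / 2 by rewrite divr_gt0.
move/cvgrPdist_le : Fx => /(_ _ e2) [dl /= dl0 dlP].
(* the thresholds are moved within the range where the limit varies by at most
   [e / 2] *)
have dl2 : 0 < dl / 2 by rewrite divr_gt0.
have lo : x - dl / 2 < x by rewrite ltrBlDr ltrDl.
have hi : x < x + dl / 2 by rewrite ltrDl.
have Flo : `|F x - F (x - dl / 2)| <= e / 2.
  by apply: dlP; rewrite /ball_ /= opprB addrC subrK gtr0_norm// ltr_pdivrMr// ltr_pMr// ltr1n.
have Fhi : `|F x - F (x + dl / 2)| <= e / 2.
  by apply: dlP; rewrite /ball_ /= opprD addrA subrr sub0r normrN gtr0_norm//
    ltr_pdivrMr// ltr_pMr// ltr1n.
near=> n.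
have up : Un n x <= F (x + dl / 2) + e / 2.
  rewrite /Un (n_tstar_law XY_indep X_supp Y_supp sample_indep sample_law).
  near: n; exact: (u_statistic_limit_le p0 p1 xi_orth xi_centred deg C_indep C_law hi e2).
have low : F (x - dl / 2) - e / 2 <= Un n x.
  rewrite /Un (n_tstar_law XY_indep X_supp Y_supp sample_indep sample_law).
  near: n; exact: (u_statistic_limit_ge p0 p1 xi_orth xi_centred deg C_indep C_law lo e2).
move: Flo Fhi; rewrite !ler_norml => /andP[? ?] /andP[? ?]; apply/andP; split; lra.
Unshelve. all: by end_near. Qed.
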